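(* Let $\Phi: G\times S_{\mathrm{reg}}\to\mathfrak{g}$ be the holomorphic submersion $\Phi(g,x)=-\mathrm{Ad}_{g^{-1}}(x)$, and let $\mathcal{F}_{\mathrm{reg}}$ be the holomorphic foliation of $G\times S_{\mathrm{reg}}$ whose leaves are the connected components of the fibres of $\Phi$. Then $(G\times S_{\mathrm{reg}},\mathcal{F}_{\mathrm{reg}})$ is an abstract integrable system of rank equal to $\mathrm{rk}(G)$.
   Context: $G$ is a connected, simply-connected, complex semisimple linear algebraic group of rank $\mathrm{rk}(G)$, with Lie algebra $\mathfrak{g}$, Killing form $\langle\cdot,\cdot\rangle$, and adjoint representation $\mathrm{Ad}:G\to\mathrm{GL}(\mathfrak{g})$. For $x\in\mathfrak{g}$, $Z_{\mathfrak{g}}(x)=\{y\in\mathfrak{g}:[x,y]=0\}$; $x$ is regular if $\dim Z_{\mathfrak{g}}(x)=\mathrm{rk}(G)$ (not assumed semisimple). There is exactly one nilpotent adjoint orbit consisting of regular elements, denoted $\mathcal{O}_{\mathrm{reg}}$. Fix a regular $\mathfrak{sl}_2(\mathbb{C})$-triple $(\xi,h,\eta)$ in $\mathfrak{g}$, i.e. $[\xi,\eta]=h$, $[h,\xi]=2\xi$, $[h,\eta]=-2\eta$ with $\xi,\eta\in\mathcal{O}_{\mathrm{reg}}$. The associated Slodowy slice is $S_{\mathrm{reg}}:=\xi+Z_{\mathfrak{g}}(\eta)\subseteq\mathfrak{g}$. The manifold $G\times\mathfrak{g}$ carries the holomorphic symplectic form $\omega$ given at $(g,x)$ by $$\omega_{(g,x)}\big((d_eR_g(y_1),z_1),(d_eR_g(y_2),z_2)\big)=\langle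 y_1,z_2\rangle-\langle y_2,z_1\rangle-\langle x,[y_1,y_2]\rangle,\quad y_1,y_2,z_1,z_2\in\mathfrak{g},$$ where $R_g$ is right multiplication by $g$. The holomorphic symplectic form on $G\times S_{\mathrm{reg}}$ is the restriction of $\omega$ (it is known, by Bielawski, that this restriction is symplectic). An abstract integrable system of rank $r$ is a pair $(X,\mathcal{F})$ consisting of a holomorphic symplectic manifold $X$ with an $r$-dimensional holomorphic foliation $\mathcal{F}$ such that each point $x\in X$ has an open neighbourhood $U\subseteq X$ together with holomorphic first integrals of $\mathcal{F}$ defined on $U$ (i.e. holomorphic functions on $U$ that are constant on the leaves of $\mathcal{F}|_U$) whose Hamiltonian vector fields span $T\mathcal{F}$ on $U$. *)

(* Defs.v *)
From HB Require Import structures.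
From Stdlib Require Import Relation_Operators.
From mathcomp Require Import all_boot all_order all_algebra.
From mathcomp Require Import all_classical all_reals all_analysis.
From mathcomp Require Import complex.
From mathcomp Require mpoly.

Set Implicit Arguments.
Unset Strict Implicit.
Unset Printing Implicit Defensive.

Import Order.TTheory GRing.Theory Num.Theory.
Import numFieldNormedType.Exports.

Local Open Scope classical_set_scope.
Local Open Scope ring_scope.

(** * The complex numbers over the real numbers [R] *)

Definition Cx (R : realType) : numClosedFieldType := R[i].

(** * Linear subspaces given as sets *)

Definition span_of (K : numFieldType) (V : lmodType K) (k : nat)
    (b : 'I_k -> V) : set V :=
  [set v | exists c : 'I_k -> K, v = \sum_(i < k) c i *: b i].

Definition has_dim (K : numFieldType) (V : lmodType K) (A : set V) (k : nat) :=
  exists b : 'I_k -> V, A = span_of b /\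
    forall c : 'I_k -> K, \sum_(i < k) c i *: b i = 0 -> forall i, c i = 0.

(* [A] as an element of [{vspace V}], when [A] is a linear subspace. *)
Definition vspace_of (K : fieldType) (V : vectType K) (A : set V) : {vspace V} :=
  xget 0%VS [set U : {vspace V} | forall v, v \in U <-> A v].

(** * Complex submanifolds

    Here [K] stands for the field of complex numbers, so that [differentiable]
    is complex differentiability, and manifolds are embedded submanifolds [X]
    of an ambient complex vector space [E] (in the sequel, a space of matrices
    or of pairs of matrices). *)

Section Manifolds.
Variable K : numFieldType.

Definition holomorphic (E F : normedModType K) (U : set E) (f : E -> F) :=
  forall x, U x -> differentiable f x.

(* Each point of [X] has a neighbourhood in [X] which a holomorphic map [phi]
   identifies with an open subset of [K^d], with holomorphic inverse [psi]. *)
Definition complex_submanifold (E : normedModType K) (X : set E) (d : nat) :=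
  forall p, X p ->
  exists (U : set E) (V : set 'rV[K]_d) (phi : E -> 'rV[K]_d)
         (psi : 'rV[K]_d -> E),
    [/\ open U /\ U p, open V,
        holomorphic U phi /\ holomorphic V psi,
        forall x, X x -> U x -> V (phi x) /\ psi (phi x) = x &
        forall y, V y -> [/\ X (psi y), U (psi y) & phi (psi y) = y]].

(* Velocities at [p] of the holomorphic curves contained in [X]. *)
Definition tangent (E : normedModType K) (X : set E) (p : E) : set E :=
  [set v | exists gamma : K^o -> E,
     [/\ gamma 0 = p,
         \forall t \near (0 : K^o), X (gamma t) /\ differentiable gamma t &
         'D_1 gamma 0 = v]].

(* [s] restricts to a holomorphic submersion from the open subset [U `&` X]
   of [X] to the linear subspace [N]. *)
Definition submersion (E W : normedModType K) (X U : set E) (s : E -> W)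
    (N : set W) :=
  holomorphic U s /\
  forall q, X q -> U q -> N (s q) /\ ('d s q : E -> W) @` tangent X q = N.

(** ** Symplectic forms *)

Definition alternating_bilinear (E : normedModType K) (b : E -> E -> K) :=
  [/\ forall (a : K) u v w, b (a *: u + v) w = a * b u w + b v w,
      forall (a : K) u v w, b w (a *: u + v) = a * b w u + b w v &
      forall v, b v v = 0].

(* Exterior derivative of a 2-form on the ambient space, evaluated at [q] on
   the constant vector fields [u], [v], [w]. *)
Definition ext_d (E : normedModType K) (Om : E -> E -> E -> K) (q u v w : E) : K :=
  'D_u (fun x => Om x v w : K^o) q - 'D_v (fun x => Om x u w : K^o) q
  + 'D_w (fun x => Om x u v : K^o) q.

(* A 2-form on [X] is holomorphic when it is locally the restriction of a
   holomorphic 2-form [Om] on the ambient space. Its exterior derivative is then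
   the restriction of that of [Om], since [d] commutes with pullbacks.
   Only the values of [om q] on [tangent X q] matter. *)
Definition symplectic_form (E : normedModType K) (X : set E)
    (om : E -> E -> E -> K) :=
  (forall p, X p -> exists (U : set E) (Om : E -> E -> E -> K),
     [/\ open U /\ U p,
         forall q, U q -> alternating_bilinear (Om q),
         forall v w, holomorphic U (fun q => Om q v w : K^o),
         forall q v w, X q -> U q -> tangent X q v -> tangent X q w ->
           om q v w = Om q v w &
         forall q u v w, X q -> U q ->
           tangent X q u -> tangent X q v -> tangent X q w ->
           ext_d Om q u v w = 0]) /\
  (forall q v, X q -> tangent X q v ->
     (forall w, tangent X q w -> om q v w = 0) -> v = 0).

Definition symplectic_submanifold (E : normedModType K) (X : set E)
    (om : E -> E -> E -> K) :=
  (exists d, complex_submanifold X d) /\ symplectic_form X om.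

(* [v] is the value at [q] of the Hamiltonian vector field of the restriction of
   [f] to [X], with the convention [om (H_f, -) = df]. *)
Definition hamiltonian_at (E : normedModType K) (X : set E)
    (om : E -> E -> E -> K) (f : E -> K^o) (q v : E) :=
  tangent X q v /\ forall w, tangent X q w -> om q v w = 'd f q w.

(** ** Foliations

    A foliation of [X] is presented by local submersions which cover [X] and
    whose differentials have the same kernels on overlaps. *)

Record foliated_atlas (E W : normedModType K) := FoliatedAtlas {
  fol_idx : Type;
  fol_dom : fol_idx -> set E;
  fol_sub : fol_idx -> E -> W;
  fol_cod : fol_idx -> set W }.

Definition plaque (E W : normedModType K) (X : set E) (F : foliated_atlas E W)
    (i : fol_idx F) (q : E) : set E :=
  connected_component
    [set x | [/\ X x, fol_dom i x & fol_sub i x = fol_sub i q]] q.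

(* Two points are in the same leaf when they are joined by a chain of plaques. *)
Definition leaf (E W : normedModType K) (X : set E) (F : foliated_atlas E W)
    (p : E) : set E :=
  [set q | clos_refl_trans E (fun a b => exists i, plaque X (F := F) i a b) p q].

Definition fol_tangent (E W : normedModType K) (X : set E)
    (F : foliated_atlas E W) (q : E) : set E :=
  [set v | tangent X q v /\ exists i, fol_dom (f := F) i q /\ 'd (fol_sub i) q v = 0].

Definition foliation (E W : normedModType K) (X : set E) (F : foliated_atlas E W)
    (r : nat) :=
  [/\ forall p, X p -> exists i, fol_dom (f := F) i p,
      forall i, open (fol_dom (f := F) i),
      forall i, submersion X (fol_dom (f := F) i) (fol_sub i) (fol_cod i),
      forall i q v, X q -> fol_dom (f := F) i q -> fol_tangent X F q v ->
        'd (fol_sub i) q v = 0 &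
      forall q, X q -> has_dim (fol_tangent X F q) r].

Definition fol_restrict (E W : normedModType K) (F : foliated_atlas E W)
    (U : set E) : foliated_atlas E W :=
  FoliatedAtlas (fun i => fol_dom (f := F) i `&` U) (@fol_sub _ _ F) (@fol_cod _ _ F).

Definition fol_of_submersion (E W : normedModType K) (U : set E) (s : E -> W)
    (N : set W) : foliated_atlas E W :=
  FoliatedAtlas (fun _ : unit => U) (fun _ => s) (fun _ => N).

(* A holomorphic function on an open subset of [X] is locally the restriction of
   one on the ambient space, so it is harmless to take [f] holomorphic on [U]. *)
Definition first_integral (E W : normedModType K) (X : set E)
    (F : foliated_atlas E W) (U : set E) (f : E -> K^o) :=
  holomorphic U f /\
  forall p q, X p -> U p -> leaf X (fol_restrict F U) p q -> f q = f p.

Definition abstract_integrable_system (E W : normedModType K) (X : set E)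
    (om : E -> E -> E -> K) (F : foliated_atlas E W) (r : nat) :=
  [/\ symplectic_submanifold X om,
      foliation X F r &
      forall p, X p -> exists (U : set E) (k : nat) (f : 'I_k -> E -> K^o)
                              (H : 'I_k -> E -> E),
        [/\ open U /\ U p,
            forall i, first_integral X F U (f i),
            forall i q, X q -> U q -> hamiltonian_at X om (f i) q (H i q) &
            forall q, X q -> U q -> fol_tangent X F q = span_of (H ^~ q)]].

End Manifolds.

(** * Simply connected sets *)

Definition simply_connected (R : realType) (T : topologicalType) (A : set T) :=
  (forall x y, A x -> A y -> exists gamma : R -> T,
     [/\ {within `[0, 1], continuous gamma}, gamma 0 = x, gamma 1 = y &
         forall s, `[0, 1]%classic s -> A (gamma s)]) /\
  (forall gamma : R -> T,
     {within `[0, 1], continuous gamma} -> gamma 0 = gamma 1 ->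
     (forall s, `[0, 1]%classic s -> A (gamma s)) ->
     exists H : R * R -> T,
       [/\ {within `[0, 1] `*` `[0, 1], continuous H},
           forall s t, `[0, 1]%classic s -> `[0, 1]%classic t -> A (H (s, t)),
           forall s, `[0, 1]%classic s ->
             H (s, 0) = gamma s /\ H (s, 1) = gamma 0 &
           forall t, `[0, 1]%classic t ->
             H (0, t) = gamma 0 /\ H (1, t) = gamma 0]).

(** * Linear algebraic groups and their Lie algebras *)

Section Groups.
Variables (K : numFieldType) (n : nat).
Local Notation M := 'M[K]_n.

Definition entry_eval (p : mpoly.mpoly (n * n) K) (g : M) : K :=
  mpoly.meval (fun k => mxvec g 0 k) p.

Definition algebraic_subgroup (G : set M) :=
  [/\ G 1%:M,
      forall a b, G a -> G b -> G (a *m b),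
      forall a, G a -> G (invmx a) &
      exists I : set (mpoly.mpoly (n * n) K),
        G = [set g | g \in unitmx /\ forall p, I p -> entry_eval p g = 0]].

(* The second clause records the structure of complex manifold on [G]: it holds
   for every Zariski closed subgroup of [GL_n] over the complex numbers. *)
Definition linear_algebraic_group (G : set M) :=
  algebraic_subgroup G /\ exists d, complex_submanifold G d.

Definition Lie (G : set M) : {vspace M} := vspace_of (tangent G 1%:M).

Definition lb (x y : M) : M := x *m y - y *m x.

Definition lieprod (U V : {vspace M}) : {vspace M} :=
  <<[seq lb u v | u <- vbasis U, v <- vbasis V]>>%VS.

Definition solvable_lie (U : {vspace M}) :=
  exists k, iter k (fun V => lieprod V V) U = 0%VS.

Definition semisimple_lie (g : {vspace M}) :=
  forall I : {vspace M}, (I <= g)%VS -> (lieprod g I <= I)%VS ->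
    solvable_lie I -> I = 0%VS.

Definition torus (T : set M) :=
  [/\ algebraic_subgroup T, connected T &
      exists2 P : M, P \in unitmx &
        forall t, T t -> is_diag_mx (P *m t *m invmx P)].

(* The largest dimension of a torus contained in [G]. *)
Definition rk (G : set M) : nat :=
  \max_(k < (n * n).+1 |
      `[< exists T, [/\ torus T, T `<=` G & \dim (Lie T) = k] >]) k.

Definition centralizer (g : {vspace M}) (x : M) : {vspace M} :=
  vspace_of [set y | y \in g /\ lb x y = 0].

Definition regular (G : set M) (x : M) :=
  x \in Lie G /\ \dim (centralizer (Lie G) x) = rk G.

Definition nilpotent_elt (g : {vspace M}) (x : M) :=
  x \in g /\ exists k, forall y, y \in g -> iter k (lb x) y = 0.

(* The regular nilpotent elements, which form a single adjoint orbit. *)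
Definition Oreg (G : set M) : set M :=
  [set x | regular G x /\ nilpotent_elt (Lie G) x].

Definition regular_sl2_triple (G : set M) (xi h eta : M) :=
  [/\ Oreg G xi, h \in Lie G, Oreg G eta, lb xi eta = h &
      lb h xi = 2 *: xi /\ lb h eta = - (2 *: eta)].

(* The trace of [ad x \o ad y] on [g]. *)
Definition killing (g : {vspace M}) (x y : M) : K :=
  \sum_(i < \dim g) coord (vbasis g) i (lb x (lb y (vbasis g)`_i)).

Definition Sreg (G : set M) (xi eta : M) : set M :=
  [set x | x - xi \in centralizer (Lie G) eta].

(* At [p = (g, x)], a tangent vector is [(y *m g, z)] with [y], [z] in [Lie G],
   [y *m g] being the image of [y] under the differential of [R_g]. *)
Definition omega (G : set M) (p v w : M * M) : K :=
  let y1 := v.1 *m invmx p.1 in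
  let y2 := w.1 *m invmx p.1 in
  killing (Lie G) y1 w.2 - killing (Lie G) y2 v.2
  - killing (Lie G) p.2 (lb y1 y2).

Definition Phi (p : M * M) : M := - (invmx p.1 *m p.2 *m p.1).

Definition Phi_dom : set (M * M) := [set p | p.1 \in unitmx].

Definition Freg (G : set M) : foliated_atlas (M * M)%type M :=
  fol_of_submersion Phi_dom Phi [set` Lie G].

End Groups.

(* Main.v *)
(** The symplectic form on G x S is read off from the slice geometry: S meets the adjoint
    orbits transversally and, for x in S, the Killing form pairs {y : [x,y] in Z(eta)}
    with Z(eta) perfectly. The elements y_i dual to a
    basis of Z(eta) provide the tangent vectors (y_i g, -[x,y_i]), which span the kernel
    of dPhi and are the Hamiltonian vectors of the linear coordinates of x on S. These
    coordinates are first integrals because x is locally constant on the fibres of Phi: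
    since dim Z(x) >= rk(G) for every x, equality holds along S and Z(eta) meets [x,g]
    trivially, so that S meets the orbit of x in isolated points. The last step needs
    neither the exponential map nor an inverse function theorem: an element a close to 1
    which conjugates x to x + z is repeatedly corrected by elements almost centralizing x,
    until a - 1 is comparable to z, and then z is almost in [x,g]. Semisimplicity enters
    through Cartan's criterion, and the bound on dim Z(x) through the density of the
    conjugates of the centralizer of a maximal torus. *)

Require Import Defs.
From HB Require Import structures.
From Stdlib Require Import Relation_Operators.
From mathcomp Require Import all_boot all_order all_algebra.
From mathcomp Require Import all_classical all_reals all_analysis.
From mathcomp Require Import complex.
From mathcomp Require Import ring lra.
Set Implicit Arguments.
Unset Strict Implicit.
Unset Printing Implicit Defensive.
Import Order.TTheory GRing.Theory Num.Theory.
Import numFieldNormedType.Exports.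
Local Open Scope classical_set_scope.
Local Open Scope ring_scope.

(** * Commutators and Engel's theorem *)

(** Neither the representation theory of sl2 nor eigenspace decompositions of [ad h] are used.
    Weights are recorded by one device: a vector annihilated by a product of operators [ad h - mu],
    the scalars [mu] forming a list. The sl2 relations translate such lists, nilpotency of [xi] and
    [eta] makes their entries integers of known sign on the relevant vectors, and two disjoint lists
    annihilating the same vector force it to be 0. In Cartan's criterion, [ad x] is paired with an
    operator having the conjugate eigenvalues, so that a vanishing trace becomes a vanishing sum of
    squared moduli. The rank is defined through tori, whereas regularity of [eta] only gives dim
    Z(eta) = rk(G). The comparison dim Z(eta) <= dim Z(x) therefore has to come from tori: a maximal
    one commutes with the whole centralizer of its generic element. Leaves are topological connected
    components, so constancy of [x] along them is not obtained by following curves: the points of a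
    component with a given [x] form a closed subset, which is open because [x] is constant on the
    fibre near each point. *)

Section Bracket.
Variables (K : numFieldType) (n : nat).
Local Notation M := 'M[K]_n.
Implicit Types (x y z b c : M) (L U V W : {vspace M}) (rs : seq K).

Lemma lbE x y : lb x y = x *m y - y *m x.
Proof. by []. Qed.

Lemma lb_is_linear x : linear (lb x).
Proof.
move=> a u v; rewrite /lb mulmxDr mulmxDl -scalemxAr -scalemxAl scalerBr.
by rewrite opprD addrACA.
Qed.
HB.instance Definition _ x :=
  GRing.isLinear.Build K M M _ (lb x) (lb_is_linear x).

Lemma lbDr x y z : lb x (y + z) = lb x y + lb x z.
Proof. exact: linearD. Qed.

Lemma lbZr a x y : lb x (a *: y) = a *: lb x y.
Proof. exact: linearZ. Qed.

Lemma lbNr x y : lb x (- y) = - lb x y.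
Proof. exact: linearN. Qed.

Lemma lbBr x y z : lb x (y - z) = lb x y - lb x z.
Proof. exact: linearB. Qed.

Lemma lb0r x : lb x 0 = 0.
Proof. exact: linear0. Qed.

Lemma lbC x y : lb y x = - lb x y.
Proof. by rewrite /lb opprB. Qed.

Lemma lbxx x : lb x x = 0.
Proof. by rewrite /lb subrr. Qed.

Lemma lbDl x y z : lb (x + y) z = lb x z + lb y z.
Proof. by rewrite (lbC z) lbDr opprD -!(lbC z). Qed.

Lemma lbZl a x z : lb (a *: x) z = a *: lb x z.
Proof. by rewrite (lbC z) lbZr -scalerN -(lbC z). Qed.

Lemma lbNl x z : lb (- x) z = - lb x z.
Proof. by rewrite (lbC z) lbNr -(lbC z). Qed.

Lemma lbBl x y z : lb (x - y) z = lb x z - lb y z.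
Proof. by rewrite lbDl lbNl. Qed.

Lemma lb0l z : lb 0 z = 0.
Proof. by rewrite (lbC z) lb0r oppr0. Qed.

Lemma lb_suml I (r : seq I) P (F : I -> M) z :
  lb (\sum_(i <- r | P i) F i) z = \sum_(i <- r | P i) lb (F i) z.
Proof.
apply: (big_morph (fun x => lb x z)) => [a b|]; [exact: lbDl|exact: lb0l].
Qed.

Lemma jacobi x y z : lb x (lb y z) = lb (lb x y) z + lb y (lb x z).
Proof.
rewrite /lb !(mulmxBl, mulmxBr, mulmxA).
by apply/matrixP => i j; rewrite !mxE; ring.
Qed.

(** The relation [adshifts x rs v = 0] expresses that the weights of [v] under [ad x] lie in [rs],
    multiplicities included, without requiring [ad x] to be diagonalizable. *)
Definition adshift x (mu : K) (v : M) : M := lb x v - mu *: v.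
Definition adshifts x rs (v : M) : M := foldr (adshift x) v rs.

Lemma shift_is_linear x mu : linear (adshift x mu).
Proof.
move=> a u v; rewrite /adshift linearP scalerDr scalerBr !scalerA [mu * a]mulrC.
by rewrite opprD addrACA.
Qed.
HB.instance Definition _ x mu :=
  GRing.isLinear.Build K M M _ (adshift x mu) (shift_is_linear x mu).

Lemma shifts_is_linear x rs : linear (adshifts x rs).
Proof. by move=> a u v; elim: rs => //= mu rs ->; rewrite linearP. Qed.
HB.instance Definition _ x rs :=
  GRing.isLinear.Build K M M _ (adshifts x rs) (shifts_is_linear x rs).

Lemma shiftC x mu nu v : adshift x mu (adshift x nu v) = adshift x nu (adshift x mu v).
Proof.
rewrite /adshift !lbBr !lbZr.
by apply/matrixP => i j; rewrite !mxE; ring.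
Qed.

Lemma shiftsC x mu rs v : adshifts x rs (adshift x mu v) = adshift x mu (adshifts x rs v).
Proof. by elim: rs => //= nu rs ->; rewrite shiftC. Qed.

Lemma shifts_cat x rs rs' v : adshifts x (rs ++ rs') v = adshifts x rs (adshifts x rs' v).
Proof. by rewrite /adshifts foldr_cat. Qed.

Lemma shifts_catC x rs rs' v : adshifts x (rs ++ rs') v = adshifts x (rs' ++ rs) v.
Proof.
elim: rs v => [|mu rs IH] v; first by rewrite cats0.
by rewrite /= IH !shifts_cat /= shiftsC.
Qed.

Lemma shifts_cat0l x rs rs' v : adshifts x rs v = 0 -> adshifts x (rs ++ rs') v = 0.
Proof. by move=> h; rewrite shifts_catC shifts_cat h linear0. Qed.

Lemma shifts_cat0r x rs rs' v : adshifts x rs' v = 0 -> adshifts x (rs ++ rs') v = 0.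
Proof. by move=> h; rewrite shifts_cat h linear0. Qed.

Lemma shift_lb x mu nu b c :
  adshift x (mu + nu) (lb b c) = lb (adshift x mu b) c + lb b (adshift x nu c).
Proof.
rewrite /adshift jacobi (lbBl (lb x b)) (lbBr b (lb x c)) lbZl lbZr scalerDl opprD.
by rewrite addrACA.
Qed.

(** Weights add under the bracket. By the Leibniz rule [shift_lb], the shift by [a + d] removes [a]
    from the first list or [d] from the second, whence the induction on the total length. *)
Lemma shifts_lb x rs1 rs2 b c : adshifts x rs1 b = 0 -> adshifts x rs2 c = 0 ->
  exists2 rs, {in rs, forall r, exists2 p, p.1 \in rs1 /\ p.2 \in rs2 & r = p.1 + p.2} &
    adshifts x rs (lb b c) = 0.
Proof.
have [k] := ubnP (size rs1 + size rs2)%N.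
elim: k rs1 rs2 b c => // k IH [|a rs1] [|d rs2] b c /=.
- by move=> _ ->; exists [::] => //=; rewrite lb0l.
- by move=> _ ->; exists [::] => //=; rewrite lb0l.
- by move=> _ _ ->; exists [::] => //=; rewrite linear0.
rewrite ltnS => sz hb hc.
have [| |rs hrs r0] := IH rs1 (d :: rs2) (adshift x a b) c _ _ hc.
- by rewrite /= (leq_trans _ sz).
- by rewrite shiftsC.
have [| |rs' hrs' r0'] := IH (a :: rs1) rs2 b (adshift x d c) _ hb.
- by rewrite /= (leq_trans _ sz) // addnS.
- by rewrite shiftsC.
exists ((rs ++ rs') ++ [:: a + d]).
  move=> r; rewrite !mem_cat inE => /orP[/orP[/hrs|/hrs']|/eqP->].
  - by case=> p [h1 h2] ->; exists p; rewrite ?inE //; split; rewrite ?h1 ?orbT.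
  - by case=> p [h1 h2] ->; exists p; rewrite ?inE //; split; rewrite ?h2 ?orbT.
  - by exists (a, d) => //; split; rewrite inE eqxx.
rewrite shifts_cat /= shift_lb linearD /= shifts_cat0l // add0r.
by rewrite shifts_cat0r.
Qed.

Lemma shifts_eigen x rs mu v : lb x v = mu *: v ->
  adshifts x rs v = (\prod_(r <- rs) (mu - r)) *: v.
Proof.
move=> h; elim: rs => [|r rs IH] /=; first by rewrite big_nil scale1r.
by rewrite IH /adshift linearZ /= h !scalerA mulrC -scalerBl big_cons -mulrBl.
Qed.

(** Removing the last factor [c] of [rs'] leaves an eigenvector of eigenvalue [c], on which the
    other product is multiplication by a nonzero scalar. *)
Lemma shifts_coprime x rs rs' v : {in rs & rs', forall mu nu, mu != nu} ->
  adshifts x rs v = 0 -> adshifts x rs' v = 0 -> v = 0.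
Proof.
move=> h hv; elim: rs' h => //= c rs' IH h hc.
apply: IH => [a c' ha hc'|]; first by apply: h; rewrite // inE hc' orbT.
set w := adshifts x rs' v in hc *.
have hw : lb x w = c *: w by apply/eqP; rewrite -subr_eq0; apply/eqP.
have : adshifts x rs w = 0.
  by rewrite /w -shifts_cat shifts_catC shifts_cat hv linear0.
rewrite (shifts_eigen _ hw) => /eqP; rewrite scaler_eq0 => /orP[|/eqP//].
rewrite prodf_seq_eq0 => /hasP[a ha]; rewrite /= subr_eq0 => /eqP e.
by have := h a c ha (mem_head _ _); rewrite e eqxx.
Qed.

End Bracket.

Lemma dim_addv_line (K : fieldType) (V : vectType K) (W : {vspace V}) x : x \notin W -> (\dim W < \dim (W + <[x]>))%N.
Proof.
move=> h; rewrite ltn_neqAle dimvS ?addvSl // andbT.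
rewrite (dimv_leqif_eq (addvSl W <[x]>)); apply: contra h => /eqP ->.
by rewrite memvE addvSr.
Qed.

(** [vspace_of] is meaningful only if some [{vspace V}] has exactly the elements of [A]; one of
    maximal dimension among those contained in [A] does. *)
Lemma vspace_ofP (K : fieldType) (V : vectType K) (A : set V) :
  A 0 -> (forall a u v, A u -> A v -> A (a *: u + v)) ->
  forall v, v \in vspace_of A <-> A v.
Proof.
move=> A0 Alin.
suff [U hU] : exists U : {vspace V}, forall v, v \in U <-> A v.
  by move=> v; apply: (xgetPex 0%VS (P := [set W : {vspace V} | forall v, v \in W <-> A v])); exists U.
pose Q d := `[< exists2 U : {vspace V}, (forall v, v \in U -> A v) & \dim U = d >].
have exQ : exists d, Q d.
  by exists (\dim (0%VS : {vspace V})); apply/asboolP; exists 0%VS => // v; rewrite memv0 => /eqP ->.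
have ubQ d : Q d -> (d <= \dim {:V})%N by move/asboolP => [U _ <-]; apply/dimvS/subvf.
case: (ex_maxnP exQ ubQ) => d /asboolP[U hU <-] hmax.
exists U => v; split=> [/hU//|Av]; apply: contraT => vU.
have : (\dim (U + <[v]>) <= \dim U)%N.
  apply: hmax; apply/asboolP; exists (U + <[v]>)%VS => // w /memv_addP[u hu [_ /vlineP[k ->] ->]].
  by rewrite addrC; apply: Alin => //; apply: hU.
by rewrite leqNgt dim_addv_line.
Qed.

(** * Engel's theorem and a criterion of solvability *)

Section Engel.
Variables (K : numFieldType) (n : nat).
Local Notation M := 'M[K]_n.
Implicit Types (x y z b c : M) (L U V W : {vspace M}).

Definition brackets_into U V W := forall u v, u \in U -> v \in V -> lb u v \in W.

Lemma lieprod_mem U V : brackets_into U V (lieprod U V).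
Proof.
move=> u v hu hv; rewrite (coord_vbasis hu) (coord_vbasis hv) lb_suml.
apply: rpred_sum => i _; rewrite linear_sum /=; apply: rpred_sum => j _.
rewrite lbZl lbZr; do 2![apply: rpredZ]; apply: memv_span.
by apply: allpairs_f; apply: mem_nth; rewrite size_tuple.
Qed.

Lemma lieprod_subP U V W : brackets_into U V W -> (lieprod U V <= W)%VS.
Proof.
move=> h; apply/span_subvP => y /allpairsP[p [h1 h2 ->]].
by apply: h; apply: vbasis_mem.
Qed.

Lemma brackets_addv_line W x U V :
  brackets_into U W V -> (forall u, u \in U -> lb u x \in V) ->
  brackets_into U (W + <[x]>) V.
Proof.
move=> h1 h2 u v hu /memv_addP[w hw [_ /vlineP[k ->] ->]].
by rewrite lbDr lbZr; apply: rpredD; [exact: h1|apply/rpredZ/h2].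
Qed.

Lemma brackets_sub U V W U' V' W' : (U' <= U)%VS -> (V' <= V)%VS -> (W <= W')%VS ->
  brackets_into U V W -> brackets_into U' V' W'.
Proof.
by move=> /subvP hU /subvP hV /subvP hW h u v /hU hu /hV hv; apply/hW/h.
Qed.

Lemma maximal_proper (P : {vspace M} -> Prop) U V0 : P V0 -> (V0 <= U)%VS -> V0 != U ->
  exists2 V, [/\ P V, (V <= U)%VS & V != U] &
    forall V', P V' -> (V' <= U)%VS -> V' != U -> (\dim V' <= \dim V)%N.
Proof.
move=> h1 h2 h3.
pose Q d := `[< exists2 V, [/\ P V, (V <= U)%VS & V != U] & \dim V = d >].
have exQ : exists d, Q d by exists (\dim V0); apply/asboolP; exists V0.
have ubQ d : Q d -> (d <= \dim U)%N by move/asboolP => [V [_ h _] <-]; apply: dimvS.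
case: (ex_maxnP exQ ubQ) => d /asboolP[V hV <-] hmax.
by exists V => // V' h1' h2' h3'; apply: hmax; apply/asboolP; exists V'.
Qed.

Definition ad_nilpotent_on L U :=
  forall u, u \in U -> exists k, forall y, y \in L -> iter k (lb u) y = 0.

(** Engel's theorem for the action of [U] on the quotient W2/W1. A maximal proper subalgebra [V]
    acts on U/V; by induction some [x] outside [V] satisfies [V, x] in V, so U = V + <x> by
    maximality, and only [x] remains to be treated. *)
Lemma engel L U W1 W2 : brackets_into U U U -> ad_nilpotent_on L U ->
  (U <= L)%VS -> (W2 <= L)%VS -> (W1 <= W2)%VS -> W1 != W2 ->
  brackets_into U W1 W1 -> brackets_into U W2 W2 ->
  exists w, [/\ w \in W2, w \notin W1 & forall u, u \in U -> lb u w \in W1].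
Proof.
have [k] := ubnP (\dim U).
elim: k U W1 W2 => // k IH U W1 W2; rewrite ltnS => sz hU hnil hUL hWL h12 hne h1 h2.
have exw (V1 V2 : {vspace M}) : (V1 <= V2)%VS -> V1 != V2 -> exists2 w, w \in V2 & w \notin V1.
  by move=> hV hVne; apply/subvPn; apply: contra hVne => hV'; rewrite eqEsubv hV hV'.
have [->|Un0] := eqVneq U 0%VS.
  have [w w2 w1] := exw _ _ h12 hne; exists w; split=> // u.
  by rewrite memv0 => /eqP ->; rewrite lb0l mem0v.
have [||V [hV hVU hVne] Vmax] := @maximal_proper (fun V => brackets_into V V V) U 0%VS _ (sub0v _).
- by move=> u v; rewrite !memv0 => /eqP -> _; rewrite lb0l.
- by rewrite eq_sym.
have dV : (\dim V < k)%N.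
  apply: leq_trans sz; rewrite ltn_neqAle dimvS // andbT.
  by rewrite (dimv_leqif_eq hVU).
have nilV : ad_nilpotent_on L V by move=> u /(subvP hVU); apply: hnil.
have VL := subv_trans hVU hUL.
have VUU : brackets_into V U U by apply: brackets_sub hU.
have [x [xU xV Vx]] := IH _ _ _ dV hV nilV VL hUL hVU hVne hV VUU.
have defU : (V + <[x]>)%VS = U.
  have subU : (V + <[x]> <= U)%VS by rewrite subv_add hVU -memvE.
  apply/eqP; apply: contraT => ne; have := Vmax (V + <[x]>)%VS _ subU ne.
  rewrite leqNgt dim_addv_line // => /(_ _)/negP[] // a d ha hd.
  apply: (subvP (addvSl V _)); move: a d ha hd.
  apply: brackets_addv_line => [a d ha hd|a ha].
    rewrite lbC rpredN; move: hd a ha; suff h : brackets_into V (V + <[x]>) V by move=> hd a; apply: h.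
    by apply: brackets_addv_line.
  rewrite lbC rpredN; move: a ha; suff h : brackets_into <[x]> (V + <[x]>) V.
    by move=> a; apply: h; rewrite memv_line.
  apply: brackets_addv_line => [_ d /vlineP[q ->] hd|_ /vlineP[q ->]].
    by rewrite lbZl rpredZ // lbC rpredN Vx.
  by rewrite lbZl lbxx scaler0 mem0v.
have h1V : brackets_into V W1 W1 by apply: brackets_sub h1.
have h2V : brackets_into V W2 W2 by apply: brackets_sub h2.
have [w0 [w02 w01 Vw0]] := IH _ _ _ dV hV nilV VL hWL h12 hne h1V h2V.
have [j hj] := hnil x xU.
have exj : exists j, iter j (lb x) w0 \in W1.
  by exists j; rewrite hj ?mem0v // (subvP hWL).
(* Since [V, x] lies in V, [ad x] preserves the vectors that V sends into W1. The last iterate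
   outside W1 is then sent into W1 by [x] as well. *)
have Q i : iter i (lb x) w0 \in W2 /\ forall m, m \in V -> lb m (iter i (lb x) w0) \in W1.
  elim: i => // i [IH1 IH2]; split=> [|m hm] /=; first exact: h2.
  rewrite jacobi rpredD //; last by apply: h1 => //; apply: IH2.
  by apply: IH2; apply: Vx.
case: (ex_minnP exj) => [[|i]] hi1 hi2; first by case/negP: w01.
exists (iter i (lb x) w0); have [Q1 Q2] := Q i; split=> //.
  by apply/negP => /hi2; rewrite ltnn.
move=> u; rewrite -defU => /memv_addP[v hv [_ /vlineP[q ->] ->]].
by rewrite lbDl lbZl; apply: rpredD; [exact: Q2|apply/rpredZ].
Qed.

(** For a maximal proper ideal [W], Engel on U/W yields [w] with [U, w] in W. Then U = W + <w>, so
    [U, U] lies in W, against perfectness. *)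
Lemma nil_perfect0 L U : brackets_into U U U -> ad_nilpotent_on L U ->
  (U <= L)%VS -> lieprod U U = U -> U = 0%VS.
Proof.
move=> hU hnil hUL perf; apply/eqP; apply: contraT => Un0.
have [||W [hW hWU hWne] Wmax] := @maximal_proper (fun W => brackets_into U W W) U 0%VS _ (sub0v _).
- by move=> u v _; rewrite !memv0 => /eqP ->; rewrite lb0r.
- by rewrite eq_sym.
have [w [wU wW Uw]] := engel hU hnil hUL hUL hWU hWne hW hU.
have subU : (W + <[w]> <= U)%VS by rewrite subv_add hWU -memvE.
have into : brackets_into U (W + <[w]>) W by apply: brackets_addv_line.
have defU : (W + <[w]>)%VS = U.
  apply/eqP; apply: contraT => ne; have := Wmax (W + <[w]>)%VS _ subU ne.
  rewrite leqNgt dim_addv_line // => /(_ _)/negP[] //.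
  by apply: brackets_sub into => //; apply: addvSl.
rewrite defU in into; case/negP: wW.
by rewrite -perf in wU; apply: (subvP (lieprod_subP into)).
Qed.

Lemma derived_series_stable U : brackets_into U U U ->
  exists k, let J := iter k (fun V => lieprod V V) U in
    brackets_into J J J /\ lieprod J J = J.
Proof.
have [m] := ubnP (\dim U).
elim: m U => // m IH U; rewrite ltnS => sz hU.
have [e|ne] := eqVneq (lieprod U U) U; first by exists 0%N.
have hsub : (lieprod U U <= U)%VS by apply: lieprod_subP.
have [||k hk] := IH (lieprod U U).
- by apply: leq_trans sz; rewrite ltn_neqAle dimvS // (dimv_leqif_eq hsub) ne.
- by apply: brackets_sub (@lieprod_mem U U).
by exists k.+1; rewrite iterSr.
Qed.

Lemma solvable_of_derived_nil L U : brackets_into U U U -> (U <= L)%VS ->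
  ad_nilpotent_on L (lieprod U U) -> solvable_lie U.
Proof.
move=> hU hUL hnil.
have hD : (lieprod U U <= U)%VS by apply: lieprod_subP.
have hD' : brackets_into (lieprod U U) (lieprod U U) (lieprod U U).
  by apply: brackets_sub (@lieprod_mem U U).
have [k /= []] := derived_series_stable hD'.
set J := iter _ _ _ => hJ perf; exists k.+1; rewrite iterSr.
have JD : (J <= lieprod U U)%VS.
  rewrite /J; elim: k {J hJ perf} => //= k IH; apply: lieprod_subP.
  by apply: brackets_sub hD'.
apply: (nil_perfect0 hJ) perf; last exact: subv_trans (subv_trans JD hD) hUL.
by move=> u /(subvP JD); apply: hnil.
Qed.

End Engel.

(** * The Killing form and Cartan's criterion *)

Section SemisimplePart.
Variable K : numClosedFieldType.

Lemma horner_mx_similar m (P A : 'M[K]_m.+1) (q : {poly K}) : P \in unitmx ->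
  horner_mx (invmx P *m A *m P) q = invmx P *m horner_mx A q *m P.
Proof.
move=> hP; elim/poly_ind: q => [|q c IH]; first by rewrite !rmorph0 mulmx0 mul0mx.
rewrite !rmorphD !rmorphM /= !horner_mx_X !horner_mx_C IH mulmxDr mulmxDl.
congr (_ + _); first by rewrite -!mulmxE !mulmxA mulmxK.
by rewrite mul_mx_scalar -scalemxAl mulVmx // scalemx1.
Qed.

Lemma trig_mx_mul m (A B : 'M[K]_m) : is_trig_mx A -> is_trig_mx B ->
  is_trig_mx (A *m B) /\ forall i, (A *m B) i i = A i i * B i i.
Proof.
move=> /is_trig_mxP hA /is_trig_mxP hB; split=> [|i].
  apply/is_trig_mxP => i j ij; rewrite mxE big1 // => k _.
  have [ik|ki] := ltnP i k; first by rewrite hA // mul0r.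
  by rewrite hB ?mulr0 // (leq_ltn_trans ki).
rewrite mxE (bigD1 i) //= big1 ?addr0 // => k; rewrite neq_ltn => /orP[ki|ik].
  by rewrite hB ?mulr0.
by rewrite hA ?mul0r.
Qed.

Lemma horner_mx_trig m (T : 'M[K]_m.+1) (q : {poly K}) : is_trig_mx T ->
  is_trig_mx (horner_mx T q) /\ forall i, horner_mx T q i i = q.[T i i].
Proof.
move=> hT; elim/poly_ind: q => [|q c [IH1 IH2]].
  by rewrite rmorph0; split=> [|i]; rewrite ?mx0_is_trig // mxE horner0.
rewrite rmorphD rmorphM /= horner_mx_X horner_mx_C.
have [t1 t2] := trig_mx_mul IH1 hT; split=> [|i].
  move/is_trig_mxP: t1 => t1; apply/is_trig_mxP => i j ij; rewrite mxE t1 //.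
  by rewrite mxE -val_eqE /= ltn_eqF // add0r.
by rewrite mxE t2 IH2 !mxE eqxx !hornerE.
Qed.

Lemma coprimep_XsubC_exp (a b : K) k l : a != b ->
  coprimep (('X - a%:P) ^+ k) (('X - b%:P) ^+ l).
Proof.
move=> ab; apply/coprimep_expl/coprimep_expr/coprimep_XsubC2.
by rewrite subr_eq0 eq_sym.
Qed.

Lemma coprimep_prod_XsubC_exp (a : K) k l (s : seq K) : a \notin s ->
  coprimep (('X - a%:P) ^+ k) (\prod_(c <- s) ('X - c%:P) ^+ l).
Proof.
move=> has; elim: s has => [|c s IH] /=; first by rewrite big_nil coprimep1.
rewrite inE negb_or => /andP[ac /IH h]; rewrite big_cons coprimepMr h andbT.
exact: coprimep_XsubC_exp.
Qed.

Lemma dvdp_prod_XsubC_exp k (s : seq K) (w : {poly K}) : uniq s ->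
  {in s, forall c, ('X - c%:P) ^+ k %| w} ->
  \prod_(c <- s) ('X - c%:P) ^+ k %| w.
Proof.
elim: s => [|c s IH] /=; first by rewrite big_nil dvd1p.
move=> /andP[cs us] h; rewrite big_cons Gauss_dvdp.
  by rewrite h ?mem_head // IH // => d hd; apply: h; rewrite inE hd orbT.
exact: coprimep_prod_XsubC_exp.
Qed.

Lemma poly_chinese (f : K -> K) k (s : seq K) : uniq s ->
  exists q : {poly K}, {in s, forall c, ('X - c%:P) ^+ k %| q - (f c)%:P}.
Proof.
elim: s => [|a s IH] /=; first by exists 0.
move=> /andP[as_ /IH[q0 hq0]].
have [[u v] /= uv1] := Bezout_eq1_coprimepP _ _ (coprimep_prod_XsubC_exp k k as_).
set Q := _ ^+ k in uv1 *; set P := \prod_(c <- s) _ in uv1.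
exists (q0 + P * v * ((f a)%:P - q0)) => c; rewrite inE => /orP[/eqP->|hc].
  have -> : q0 + P * v * ((f a)%:P - q0) - (f a)%:P = (q0 - (f a)%:P) * u * Q.
    have -> : P * v = 1 - u * Q by rewrite -uv1 [v * P]mulrC addrAC subrr add0r.
    by ring.
  by rewrite dvdp_mull.
rewrite addrAC; apply: dvdp_add; first exact: hq0.
do 2![apply: dvdp_mulr]; rewrite /P (big_rem c) //=; exact: dvdp_mulr.
Qed.

Lemma horner_mx_coprime m (A : 'M[K]_m.+1) (p q : {poly K}) (v : 'rV_m.+1) :
  coprimep p q -> v *m horner_mx A p = 0 -> v *m horner_mx A q = 0 -> v = 0.
Proof.
move=> /Bezout_eq1_coprimepP[[a b] /= e] hp hq.
have : v *m horner_mx A 1 = 0.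
  rewrite -e !rmorphD !rmorphM /= mulmxDr (comm_horner_mx2 A a) (comm_horner_mx2 A b).
  by rewrite -!mulmxE !mulmxA hp hq !mul0mx addr0.
by rewrite rmorph1 mulmx1.
Qed.

Definition gen_eigenvector m (A : 'M[K]_m) (mu : K) (v : 'rV_m) :=
  exists k, v *m (A - mu%:M) ^+ k = 0.

(* [D] is the operator with the generalized eigenspaces of [A] and the conjugate
   eigenvalues, so that the trace of [A D] is the sum of the [|mu|^2]. *)
Lemma conj_semisimple_part m (A : 'M[K]_m) : exists D : 'M[K]_m,
  [/\ forall mu v, gen_eigenvector A mu v -> v *m D = mu^* *: v,
      forall P : 'rV[K]_m -> Prop, P 0 -> (forall u v, P u -> P v -> P (u + v)) ->
        (forall mu v, gen_eigenvector A mu v -> P v) -> forall v, P v &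
      \tr (A *m D) = 0 -> exists k, A ^+ k = 0].
Proof.
case: m A => [|m] A.
  exists 0; split=> [mu v _|P P0 _ _ v|_]; rewrite ?thinmx0 //.
  by exists 1%N.
have [//|P uP trigT] := Schur A.
have Pu := unitarymx_unit uP.
pose T := P *m A *m invmx P.
have {}trigT : is_trig_mx T by rewrite /T -conjumx.
have defA : A = invmx P *m T *m P by rewrite /T !mulmxA mulVmx // mul1mx mulmxKV.
pose s := undup [seq T i i | i <- enum 'I_m.+1].
have us : uniq s := undup_uniq _.
have sT i : T i i \in s by rewrite mem_undup (map_f (fun j => T j j)) // mem_enum.
pose N := m.+1.
pose p := \prod_(c <- s) ('X - c%:P) ^+ N : {poly K}.
(* By triangularity the characteristic polynomial is a product of [m.+1] linear factors, so the
   exponent [N] bounds every multiplicity and it divides [p]. *)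
have hp : horner_mx A p = 0.
  suff : char_poly T %| p.
    case/dvdpP => w ->; rewrite {1}defA horner_mx_similar // rmorphM /=.
    by rewrite Cayley_Hamilton mulr0 mulmx0 mul0mx.
  have big_dvd (r : seq 'I_m.+1) : \prod_(i <- r) ('X - (T i i)%:P) %|
      \prod_(c <- s) ('X - c%:P) ^+ size r.
    elim: r => [|i r IH]; first by rewrite big_nil dvd1p.
    rewrite big_cons [X in _ %| X](eq_bigr (fun c => ('X - c%:P) * ('X - c%:P) ^+ size r)); last first.
      by move=> c _; rewrite exprS.
    rewrite big_split /=; apply: dvdp_mul => //.
    by rewrite (big_rem (T i i)) //= dvdp_mulr.
  rewrite char_poly_trig // -big_enum /=; apply: dvdp_trans (big_dvd _) _.
  by rewrite -cardE card_ord.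
have powE mu k : (A - mu%:M) ^+ k = horner_mx A (('X - mu%:P) ^+ k).
  by rewrite rmorphXn rmorphB /= horner_mx_X horner_mx_C.
have gen0 mu v : gen_eigenvector A mu v -> mu \notin s -> v = 0.
  move=> [k]; rewrite powE => hv hmu.
  apply: (@horner_mx_coprime _ A _ p) hv _; last by rewrite hp mulmx0.
  exact: coprimep_prod_XsubC_exp.
have genN mu v : gen_eigenvector A mu v -> v *m horner_mx A (('X - mu%:P) ^+ N) = 0.
  move=> hmu; have [hs|/(gen0 _ _ hmu)->] := boolP (mu \in s); last by rewrite mul0mx.
  case: hmu => k; rewrite powE => hv.
  apply: (@horner_mx_coprime _ A (('X - mu%:P) ^+ k) (\prod_(c <- rem mu s) ('X - c%:P) ^+ N)).
  - by apply: coprimep_prod_XsubC_exp; rewrite mem_rem_uniq // !inE eqxx.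
  - by rewrite -mulmxA mulmxE comm_horner_mx2 -mulmxE mulmxA hv mul0mx.
  - rewrite -mulmxA mulmxE -rmorphM /=.
    suff -> : ('X - mu%:P) ^+ N * \prod_(c <- rem mu s) ('X - c%:P) ^+ N = p.
      by rewrite hp mulmx0.
    by rewrite /p [RHS](big_rem mu).
(* The operator sought is a polynomial in [A] that is congruent to the conjugate of [c] modulo ('X -
   c)^N for every eigenvalue [c]. *)
have [q hq] := poly_chinese (fun c => c^*) N us.
exists (horner_mx A q); split.
- move=> mu v hmu; have [hs|/(gen0 _ _ hmu)->] := boolP (mu \in s); last by rewrite mul0mx scaler0.
  have /dvdpP[w hw] := hq _ hs.
  have -> : q = ('X - mu%:P) ^+ N * w + (mu^*)%:P by rewrite mulrC -hw subrK.
  rewrite rmorphD rmorphM /= horner_mx_C mulmxDr -mulmxE mulmxA genN // mul0mx add0r.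
  by rewrite mul_mx_scalar.
- move=> Q Q0 QD Qg v.
  (* The [del c] evaluate at [A] to the projections on the generalized eigenspaces; they sum to 1
     modulo [p]. *)
  have [del hdel] := choice (fun c => poly_chinese (fun d => (d == c)%:R) N us).
  have -> : v = \sum_(c <- s) v *m horner_mx A (del c).
    rewrite -mulmx_sumr -rmorph_sum /=.
    have /dvdpP[w hw] : p %| \sum_(c <- s) del c - 1.
      apply: dvdp_prod_XsubC_exp => // d hd.
      have -> : \sum_(c <- s) del c - 1 = \sum_(c <- s) (del c - ((d == c)%:R)%:P).
        rewrite sumrB; congr (_ - _); rewrite (big_rem d) //= eqxx big_seq big1 ?addr0 //.
        move=> c; rewrite mem_rem_uniq // !inE => /andP[cd _].
        by rewrite eq_sym (negbTE cd).
      by rewrite big_seq; apply: (big_ind (fun w => _ %| w)) => [|a b|c _]; [exact: dvdp0|exact: dvdp_add|exact: hdel].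
    have -> : \sum_(c <- s) del c = w * p + 1 by rewrite -hw subrK.
    by rewrite rmorphD rmorphM /= hp mulr0 add0r rmorph1 mulmx1.
  rewrite big_seq; apply: big_ind => // c hc; apply: (Qg c); exists N.
  rewrite powE -mulmxA mulmxE -rmorphM /=.
  suff /dvdpP[w ->] : p %| del c * ('X - c%:P) ^+ N by rewrite rmorphM /= hp mulr0 mulmx0.
  apply: dvdp_prod_XsubC_exp => // d hd.
  have [->|dc] := eqVneq d c; first by rewrite dvdp_mull.
  by apply: dvdp_mulr; have := hdel c d hd; rewrite (negbTE dc) subr0.
- move=> tr0.
  (* In triangular form only the diagonal counts, and there [q] takes the conjugate value.
     Nonnegativity of the terms will kill every eigenvalue. *)
  have tr : \tr (A *m horner_mx A q) = \sum_i (T i i) * (T i i)^*.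
    have -> : A *m horner_mx A q = invmx P *m horner_mx T ('X * q) *m P.
      by rewrite -horner_mx_similar // -defA rmorphM /= horner_mx_X mulmxE.
    rewrite mxtrace_mulC mulmxA mulmxV // mul1mx; apply: eq_bigr => i _.
    rewrite (horner_mx_trig _ trigT).2 hornerM hornerX; congr (_ * _).
    have : root (q - ((T i i)^*)%:P) (T i i).
      rewrite -dvdp_XsubCl; apply: dvdp_trans (hq _ (sT i)).
      by rewrite /N exprS dvdp_mulr.
    by rewrite /root hornerD hornerN hornerC subr_eq0 => /eqP.
  have T0 i : T i i = 0.
    move: tr0; rewrite tr => /psumr_eq0P h; apply/eqP; rewrite -mul_conjC_eq0.
    by rewrite h // => j _; rewrite mul_conjC_ge0.
  have : char_poly T = 'X ^+ N.
    rewrite char_poly_trig // (eq_bigr (fun=> 'X)) => [|i _]; last by rewrite T0 subr0.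
    by rewrite prodr_const card_ord.
  move=> hT; exists N.
  have := Cayley_Hamilton T; rewrite hT rmorphXn /= horner_mx_X => TN.
  have := horner_mx_similar T ('X ^+ N) Pu; rewrite -defA !rmorphXn /= !horner_mx_X TN.
  by rewrite mulmx0 mul0mx.
Qed.

End SemisimplePart.

(** * Matrices of the adjoint action and the Killing form *)

Section Coordinates.
Variables (K : numFieldType) (n : nat) (L : {vspace 'M[K]_n}).
Local Notation M := 'M[K]_n.
Local Notation B := (vbasis L).
Implicit Types (x y z v : M).

Definition crd v : 'rV[K]_(\dim L) := \row_j coord B j v.
Definition uncrd (w : 'rV[K]_(\dim L)) : M := \sum_j w 0 j *: B`_j.
(** Coordinates are row vectors and operators act on the right, so composition is reversed, as the
    sign in [adm_lb] shows. *)
Definition adm x : 'M[K]_(\dim L) := \matrix_(i, j) coord B j (lb x B`_i).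

Lemma crd_is_linear : linear crd.
Proof. by move=> a u v; apply/rowP => j; rewrite !mxE linearP. Qed.
HB.instance Definition _ := GRing.isLinear.Build K M _ _ crd crd_is_linear.

Lemma uncrd_is_linear : linear uncrd.
Proof.
move=> a u v; rewrite /uncrd scaler_sumr -big_split /=; apply: eq_bigr => j _.
by rewrite !mxE scalerDl scalerA.
Qed.
HB.instance Definition _ := GRing.isLinear.Build K _ M _ uncrd uncrd_is_linear.

Lemma adm_is_linear : linear adm.
Proof.
by move=> a u v; apply/matrixP => i j; rewrite !mxE lbDl lbZl linearP.
Qed.
HB.instance Definition _ := GRing.isLinear.Build K M _ _ adm adm_is_linear.

Lemma free_vbasis : free B. Proof. exact: basis_free (vbasisP L). Qed.

Lemma vbasis_nth_mem i : (i < \dim L)%N -> B`_i \in L.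
Proof. by move=> hi; apply/vbasis_mem/mem_nth; rewrite size_tuple. Qed.

Lemma uncrd_mem w : uncrd w \in L.
Proof. by apply: rpred_sum => j _; apply/rpredZ/vbasis_nth_mem. Qed.

Lemma crdK v : v \in L -> uncrd (crd v) = v.
Proof.
move=> hv; rewrite [RHS](coord_vbasis hv); apply: eq_bigr => j _.
by rewrite mxE.
Qed.

Lemma uncrdK w : crd (uncrd w) = w.
Proof. by apply/rowP => j; rewrite mxE coord_sum_free // free_vbasis. Qed.

Lemma crd_inj v v' : v \in L -> v' \in L -> crd v = crd v' -> v = v'.
Proof. by move=> hv hv' e; rewrite -(crdK hv) e crdK. Qed.

Lemma crd_lb x v : v \in L -> crd (lb x v) = crd v *m adm x.
Proof.
move=> hv; rewrite {1}(coord_vbasis hv) (linear_sum (lb x)); apply/rowP => j.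
rewrite !mxE linear_sum /=; apply: eq_bigr => i _.
by rewrite lbZr linearZ /= !mxE.
Qed.

Lemma crd_vbasis (i : 'I_(\dim L)) : crd B`_i = delta_mx 0 i.
Proof.
by apply/rowP => j; rewrite !mxE coord_free ?free_vbasis // eqxx eq_sym.
Qed.

Lemma admP x (C : 'M[K]_(\dim L)) : (forall v, v \in L -> crd (lb x v) = crd v *m C) ->
  adm x = C.
Proof.
move=> h; apply/row_matrixP => i; rewrite !rowE -crd_vbasis -h ?vbasis_nth_mem //.
by rewrite crd_lb ?vbasis_nth_mem.
Qed.

Hypothesis hL : brackets_into L L L.

Lemma adm_lb x y : x \in L -> y \in L ->
  adm (lb x y) = adm y *m adm x - adm x *m adm y.
Proof.
move=> hx hy; apply: admP => v hv.
have -> : lb (lb x y) v = lb x (lb y v) - lb y (lb x v).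
  by rewrite [lb x (lb y v)]jacobi addrK.
by rewrite linearB /= !crd_lb ?hL // mulmxBr !mulmxA.
Qed.

Lemma killingE x y : y \in L -> killing L x y = \tr (adm y *m adm x).
Proof.
move=> hy; apply: eq_bigr => i _.
have := crd_lb x (hL hy (vbasis_nth_mem (ltn_ord i))).
move/rowP => /(_ i); rewrite [LHS]mxE => ->.
by rewrite crd_lb ?vbasis_nth_mem // crd_vbasis -mulmxA -rowE mxE.
Qed.

Lemma killingC x y : x \in L -> y \in L -> killing L x y = killing L y x.
Proof. by move=> hx hy; rewrite !killingE // mxtrace_mulC. Qed.

Lemma killing_lb x y z : x \in L -> y \in L -> z \in L ->
  killing L (lb x y) z = killing L x (lb y z).
Proof.
move=> hx hy hz; rewrite !killingE ?hL // !adm_lb // mulmxBr mulmxBl !linearB /=.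
by rewrite !mulmxA; congr (_ - _); rewrite mxtrace_mulC mulmxA.
Qed.

End Coordinates.

Section KillingBilinear.
Variables (K : numFieldType) (n : nat) (L : {vspace 'M[K]_n}).
Local Notation M := 'M[K]_n.
Implicit Types (x y z : M).

Lemma killing_is_linear x : linear_for *%R (killing L x).
Proof.
move=> a u v; rewrite /killing mulr_sumr -big_split /=; apply: eq_bigr => i _.
by rewrite lbDl lbZl lbDr lbZr linearP.
Qed.
HB.instance Definition _ x :=
  GRing.isLinear.Build K M K _ (killing L x) (killing_is_linear x).

Lemma killingDl x y z : killing L (x + y) z = killing L x z + killing L y z.
Proof.
rewrite /killing -big_split /=; apply: eq_bigr => i _.
by rewrite lbDl linearD.
Qed.

Lemma killingZl a x z : killing L (a *: x) z = a * killing L x z.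
Proof.
rewrite /killing mulr_sumr /=; apply: eq_bigr => i _.
by rewrite lbZl linearZ.
Qed.

Lemma killingDr x y z : killing L x (y + z) = killing L x y + killing L x z.
Proof. exact: linearD. Qed.

Lemma killingZr a x y : killing L x (a *: y) = a * killing L x y.
Proof. exact: linearZ. Qed.

Lemma killing0r x : killing L x 0 = 0.
Proof. exact: linear0. Qed.

Lemma killingNr x y : killing L x (- y) = - killing L x y.
Proof. exact: linearN. Qed.

Lemma killingBr x y z : killing L x (y - z) = killing L x y - killing L x z.
Proof. exact: linearB. Qed.

Lemma killing0l z : killing L 0 z = 0.
Proof. by rewrite -(scale0r 0) killingZl mul0r. Qed.

Lemma killingNl x z : killing L (- x) z = - killing L x z.
Proof. by rewrite -scaleN1r killingZl mulN1r. Qed.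

Lemma killingBl x y z : killing L (x - y) z = killing L x z - killing L y z.
Proof. by rewrite killingDl killingNl. Qed.

Lemma killing_suml I (r : seq I) (f : I -> M) z :
  killing L (\sum_(i <- r) f i) z = \sum_(i <- r) killing L (f i) z.
Proof.
apply: (big_morph (fun u => killing L u z)) => [u v|]; [exact: killingDl|exact: killing0l].
Qed.

End KillingBilinear.

(** * Cartan's criterion *)

Section Cartan.
Variables (K : numClosedFieldType) (n : nat) (L : {vspace 'M[K]_n}).
Hypothesis hL : brackets_into L L L.
Local Notation M := 'M[K]_n.
Implicit Types (x y z b c : M).
Local Notation crd := (crd L).
Local Notation uncrd := (@uncrd K n L).
Local Notation adm := (adm L).

Lemma crd_shifts x rs v : x \in L -> v \in L ->
  adshifts x rs v \in L /\
  crd (adshifts x rs v) = crd v *m \prod_(mu <- rev rs) (adm x - mu%:M).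
Proof.
move=> hx hv; elim: rs => [|mu rs [IH1 IH2]] /=; first by rewrite big_nil mulmx1.
split; first by rewrite rpredB ?rpredZ // hL.
rewrite /adshift linearB linearZ /= crd_lb // IH2 rev_cons big_rcons /=.
by rewrite -mulmxE mulmxA mulmxBr mul_mx_scalar.
Qed.

Lemma gen_eigenvector_shifts x mu v : x \in L -> v \in L ->
  gen_eigenvector (adm x) mu (crd v) <-> exists k, adshifts x (nseq k mu) v = 0.
Proof.
move=> hx hv; split=> -[k h]; exists k.
  have [h1 h2] := crd_shifts (nseq k mu) hx hv.
  apply: (crd_inj h1 (mem0v _)); rewrite linear0 h2 rev_nseq big_nseq.
  by rewrite -/(iterop _ _ _ _) -Monoid.iteropE.
have [h1 h2] := crd_shifts (nseq k mu) hx hv.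
move: h2; rewrite h linear0 rev_nseq big_nseq => h2.
by rewrite h2 -Monoid.iteropE.
Qed.

Lemma gen_eigenvector_lb x mu nu b c : x \in L -> b \in L -> c \in L ->
  gen_eigenvector (adm x) mu (crd b) -> gen_eigenvector (adm x) nu (crd c) ->
  gen_eigenvector (adm x) (mu + nu) (crd (lb b c)).
Proof.
move=> hx hb hc /gen_eigenvector_shifts -/(_ hx hb)[k hk].
move=> /gen_eigenvector_shifts -/(_ hx hc)[l hl].
have [rs hrs r0] := shifts_lb hk hl.
apply/gen_eigenvector_shifts => //; first exact: hL.
exists (size rs); suff -> : nseq (size rs) (mu + nu) = rs by [].
apply/esym/all_pred1P/allP => r /hrs[[p1 p2] /= []].
by rewrite !mem_nseq => /andP[_ /eqP ->] /andP[_ /eqP ->] ->; rewrite /= eqxx.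
Qed.

(** By cyclicity the trace is that of [ad a] against the commutator of [D] and [ad b]. This
    commutator is again some [ad b'], so the trace is, up to sign, a value of the Killing form on
    the radical element [a]. *)
Lemma trace_conj_part_radical x D a b :
  x \in L -> a \in L -> b \in L -> (forall y, y \in L -> killing L a y = 0) ->
  (forall mu v, gen_eigenvector (adm x) mu v -> v *m D = mu^* *: v) ->
  (forall P : 'rV[K]_(\dim L) -> Prop, P 0 -> (forall u v, P u -> P v -> P (u + v)) ->
        (forall mu v, gen_eigenvector (adm x) mu v -> P v) -> forall v, P v) ->
  \tr (adm (lb a b) *m D) = 0.
Proof.
move=> hx ha hb rad hD dec; rewrite adm_lb //.
(* For [b] of weight [mu] take b' = mu^* b: on a vector of weight [nu] the two products differ by
   the factor (mu + nu)^* - nu^*, and conjugation is additive. *)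
have [b' hb' comm] : exists2 b', b' \in L & adm b *m D - D *m adm b = adm b'.
  rewrite -(crdK hb); elim/dec: (crd b) => [|u v [u' hu' eu] [v' hv' ev]|mu u hu].
  - by exists 0; rewrite ?mem0v // (linear0 uncrd) (linear0 adm) mul0mx mulmx0 subr0.
  - exists (u' + v'); rewrite ?rpredD // (linearD uncrd) !(linearD adm) mulmxDl mulmxDr opprD addrACA.
    by rewrite eu ev.
  exists (mu^* *: uncrd u); first by rewrite rpredZ ?uncrd_mem.
  apply/esym/admP => v hv; rewrite mulmxBr !mulmxA -!crd_lb //.
  rewrite -(crdK hv); elim/dec: (crd v) => [|c d hc hd|nu c hc].
  - by rewrite (linear0 uncrd) !lb0r (linear0 crd) !mul0mx subr0.
  - have uD : uncrd (c + d) = uncrd c + uncrd d by exact: linearD.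
    have cD w w' : crd (w + w') = crd w + crd w' by exact: linearD.
    rewrite uD !lbDr (cD (lb (mu^* *: uncrd u) _)) hc hd (cD (uncrd c)).
    by rewrite (cD (lb (uncrd u) _)) !mulmxDl opprD addrACA.
  have [uL cL] := (uncrd_mem (L := L) u, uncrd_mem (L := L) c).
  rewrite uncrdK (hD _ _ hc) -scalemxAl.
  have -> : c *m adm (uncrd u) = crd (lb (uncrd u) (uncrd c)) by rewrite crd_lb // uncrdK.
  rewrite (hD (mu + nu)); last by apply: gen_eigenvector_lb; rewrite ?uncrdK.
  by rewrite rmorphD scalerDl addrK lbZl linearZ.
have -> : \tr ((adm b *m adm a - adm a *m adm b) *m D) =
    \tr (adm a *m (D *m adm b - adm b *m D)).
  rewrite mulmxBl mulmxBr !linearB /=; congr (_ - _); last by rewrite mulmxA.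
  by rewrite -mulmxA mxtrace_mulC mulmxA.
rewrite -opprB comm mulmxN linearN /= mxtrace_mulC.
by rewrite mxtrace_mulC -(killingE hL) // (killingC hL) // rad // oppr0.
Qed.

Lemma adm_exp_iter x v k : v \in L -> x \in L ->
  iter k (lb x) v \in L /\ crd (iter k (lb x) v) = crd v *m adm x ^+ k.
Proof.
move=> hv hx; elim: k => [|k [IH1 IH2]] /=; first by rewrite mulmx1.
by rewrite hL // crd_lb // IH2 exprSr -mulmxE mulmxA.
Qed.

(** The radical [N] of the form is an ideal. For [x] in [N, N] the trace of [ad x] against its
    conjugate part vanishes, so [ad x] is nilpotent; hence [N] is solvable, and 0 by
    semisimplicity. *)
Lemma killing_nondegenerate : semisimple_lie L ->
  forall x, x \in L -> (forall y, y \in L -> killing L x y = 0) -> x = 0.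
Proof.
move=> ss x0 hx0 rad0.
pose A : set M := [set x | x \in L /\ forall y, y \in L -> killing L x y = 0].
have hN : forall x, x \in vspace_of A <-> A x.
  apply: vspace_ofP; first by split=> [|y _]; rewrite ?mem0v ?killing0l.
  move=> a u v [hu ru] [hv rv]; split=> [|y hy]; first by rewrite rpredD ?rpredZ.
  by rewrite killingDl killingZl ru // rv // mulr0 addr0.
set N := vspace_of A in hN.
have NL : (N <= L)%VS by apply/subvP => x /hN[].
have NI : brackets_into L N N.
  move=> u v hu /hN[hv rv]; apply/hN; split=> [|y hy]; first exact: hL.
  by rewrite lbC killingNl killing_lb // rv ?oppr0 // hL.
have NN : brackets_into N N N by apply: brackets_sub NI.
suff hsol : solvable_lie N.
  have N0 : N = 0%VS by apply: (ss N NL _ hsol); apply: lieprod_subP.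
  have : x0 \in N by apply/hN.
  by rewrite N0 memv0 => /eqP.
apply: (solvable_of_derived_nil NN NL) => x hx.
have xL : x \in L by apply: (subvP NL); apply: (subvP (lieprod_subP NN)).
have [D [hD dec nil]] := conj_semisimple_part (adm x).
have [|k hk] := nil; last first.
  exists k => y hy; have [h1 h2] := adm_exp_iter k hy xL.
  by apply: (crd_inj h1 (mem0v _)); rewrite h2 hk mulmx0 linear0.
have tr0 z : z \in lieprod N N -> \tr (adm z *m D) = 0.
  set X := [seq lb u v | u <- vbasis N, v <- vbasis N].
  move=> hz; rewrite (@coord_span _ _ _ (in_tuple X) _ hz).
  rewrite linear_sum mulmx_suml linear_sum big1 //= => i _.
  rewrite linearZ /= -scalemxAl linearZ /=.
  have /allpairsP[[a b] /= [/vbasis_mem ha /vbasis_mem hb ->]] :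
      X`_i \in X by apply: mem_nth.
  have /hN[haL ra] := ha; have /hN[hbL _] := hb.
  by rewrite (trace_conj_part_radical xL haL hbL ra hD dec) mulr0.
exact: tr0.
Qed.

End Cartan.

(** * Slodowy slices *)

Section SlTwo.
Variables (K : numFieldType) (n : nat).
Local Notation M := 'M[K]_n.
Implicit Types (e f h u v w : M) (rs : seq K).

Definition sl2_triple e f h :=
  [/\ lb e f = h, lb h e = 2 *: e & lb h f = - (2 *: f)].

Lemma sl2_triple_sym e f h : sl2_triple e f h -> sl2_triple f e (- h).
Proof.
by case=> h1 h2 h3; split; rewrite ?lbNl ?h2 ?h3 ?opprK // lbC h1.
Qed.

Definition nat_shift (rs : seq K) (a : K) :=
  {in rs, forall r, exists k : nat, r = a + k%:R}.

Section Triple.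
Variables (e f h : M).
Hypothesis efh : sl2_triple e f h.

Lemma shift_lb_f mu u : lb f (adshift h mu u) = adshift h (mu - 2) (lb f u).
Proof.
have [_ _ hf] := efh; rewrite addrC (shift_lb h (- 2) mu) /adshift hf scaleNr opprK addNr.
by rewrite lb0l add0r.
Qed.

Lemma shift_lb_e mu u : lb e (adshift h mu u) = adshift h (mu + 2) (lb e u).
Proof.
by have [_ he _] := efh; rewrite addrC (shift_lb h 2 mu) /adshift he subrr lb0l add0r.
Qed.

Lemma shifts_lb_f rs u : lb f (adshifts h rs u) = adshifts h [seq mu - 2 | mu <- rs] (lb f u).
Proof. by elim: rs => //= mu rs IH; rewrite shift_lb_f IH. Qed.

Lemma shifts_lb_e rs u : lb e (adshifts h rs u) = adshifts h [seq mu + 2 | mu <- rs] (lb e u).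
Proof. by elim: rs => //= mu rs IH; rewrite shift_lb_e IH. Qed.

Lemma shifts_lb_fe rs u : lb f (lb e (adshifts h rs u)) = adshifts h rs (lb f (lb e u)).
Proof.
rewrite shifts_lb_e shifts_lb_f -map_comp (eq_map (g := id)) ?map_id //.
by move=> mu /=; rewrite addrK.
Qed.

Lemma iter_lb_f_shift k mu u :
  iter k (lb f) (adshift h mu u) = adshift h (mu - (2 * k)%:R) (iter k (lb f) u).
Proof.
elim: k => [|k IH] /=; first by rewrite muln0 subr0.
by rewrite IH shift_lb_f; congr adshift; rewrite mulnS natrD; ring.
Qed.

(** The identity e f^(k+1) = f^(k+1) e + (k+1) f^k (h - k) for operators satisfying the sl2
    relations. *)
Lemma lb_e_iter_f k u : lb e (iter k.+1 (lb f) u) =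
  iter k.+1 (lb f) (lb e u) + k.+1%:R *: iter k (lb f) (adshift h k%:R u).
Proof.
have [ef _ _] := efh.
have lbef v : lb e (lb f v) = lb f (lb e v) + lb h v.
  by rewrite jacobi ef addrC.
elim: k => [|k IH]; first by rewrite /= lbef scale1r /adshift scale0r subr0.
rewrite [LHS]lbef IH lbDr lbZr -!iterS -addrA; congr (_ + _).
rewrite !iter_lb_f_shift; move: (iter k.+1 (lb f) u) => v; rewrite /adshift.
move: (lb h v) => w; apply/matrixP => i j; rewrite !mxE !natrM -!natr1; ring.
Qed.

(** If f^(k+1) u = 0, the identity [lb_e_iter_f] leaves f^k (h - k) u = 0, and (h - k) u again
    satisfies the first hypothesis: each step costs one weight, the natural number [k]. *)
Lemma shifts_nat_of_fe0 k u : lb f (lb e u) = 0 -> iter k (lb f) u = 0 ->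
  exists2 rs, nat_shift rs 0 & adshifts h rs u = 0.
Proof.
elim: k u => [|k IH] u feu0 fku; first by exists [::].
have [||rs hrs r0] := IH (adshift h k%:R u).
- by rewrite (shifts_lb_fe [:: _]) feu0 linear0.
- have := lb_e_iter_f k u; rewrite fku linear0 iterSr feu0.
  have -> : iter k (lb f) 0 = 0 by elim: k {IH fku} => //= k ->; rewrite lb0r.
  by rewrite add0r => /esym/eqP; rewrite scaler_eq0 pnatr_eq0 => /eqP.
exists (rcons rs k%:R); last by rewrite -cats1 shifts_cat.
by move=> r; rewrite mem_rcons inE => /orP[/eqP->|/hrs//]; exists k; rewrite add0r.
Qed.

End Triple.

Lemma shiftsN h rs v : adshifts h rs v = 0 -> adshifts (- h) [seq - mu | mu <- rs] v = 0.
Proof.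
have E w mu : adshift (- h) (- mu) w = - adshift h mu w.
  by rewrite /adshift lbNl scaleNr; move: (lb h w) (mu *: w) => a b; rewrite opprD.
suff -> : adshifts (- h) [seq - mu | mu <- rs] v = (- 1) ^+ size rs *: adshifts h rs v.
  by move=> ->; rewrite scaler0.
elim: rs => [|mu rs IH] /=; first by rewrite scale1r.
by rewrite IH E linearZ exprS mulN1r scaleNr.
Qed.

Lemma shifts_nat_of_f0 e f h k v : sl2_triple e f h -> lb f v = 0 -> iter k (lb e) v = 0 ->
  exists2 rs, {in rs, forall r, exists k : nat, r = - k%:R} & adshifts h rs v = 0.
Proof.
move=> /sl2_triple_sym efh fv0 ek.
have [|rs hrs r0] := shifts_nat_of_fe0 efh _ ek; first by rewrite fv0 lb0r.
exists [seq - mu | mu <- rs]; last by rewrite -[h]opprK shiftsN.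
by move=> r /mapP[mu /hrs[c ->] ->]; exists c; rewrite add0r.
Qed.

Variable L : {vspace M}.
Hypothesis hL : brackets_into L L L.

(** This stands in for complete reducibility. The weights of [u] are natural numbers, so those of
    [[e, u]] are at least 2; being killed by [f], [[e, u]] also has weights at most 0. *)
Lemma sl2_lb_inj e f h u : sl2_triple e f h -> nilpotent_elt L e -> nilpotent_elt L f ->
  u \in L -> lb f (lb e u) = 0 -> lb e u = 0.
Proof.
move=> efh [eL [k1 e0]] [fL [k2 f0]] uL feu0.
have [rs hrs r0] := shifts_nat_of_fe0 efh feu0 (f0 _ uL).
have [rs' hrs' r0'] := shifts_nat_of_f0 efh feu0 (e0 _ (hL eL uL)).
apply: (shifts_coprime (rs' := [seq mu + 2 | mu <- rs]) _ r0'); last first.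
  by rewrite -(shifts_lb_e efh rs) r0 lb0r.
move=> _ _ /hrs'[a ->] /mapP[_ /hrs[b ->] ->].
by rewrite add0r -subr_eq0 -opprD oppr_eq0 -!natrD pnatr_eq0 addnC addnS.
Qed.

Lemma sl2_fe_inj e f h u : sl2_triple e f h -> nilpotent_elt L e -> nilpotent_elt L f ->
  u \in L -> lb f (lb e (lb f u)) = 0 -> lb f u = 0.
Proof.
move=> efh he hf uL h0; apply: (sl2_lb_inj (sl2_triple_sym efh)) => //.
by apply: (sl2_lb_inj efh) => //; apply: hL => //; case: hf.
Qed.

End SlTwo.

(** Provides both the number of weight-lowering steps in [slice_injective] and the generic
    multiplier in [torus_generic]. *)
Lemma nat_far_from (K : numFieldType) (s : seq K) :
  exists k : nat, {in s, forall d c, (k <= c)%N -> d != c%:R}.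
Proof.
elim: s => [|d s [k hk]]; first by exists 0%N.
have [[c0 e]|ne] := pselect (exists c : nat, d = c%:R).
  exists (maxn k c0.+1) => d'; rewrite inE => /orP[/eqP->|hd'] c; rewrite geq_max => /andP[h1 h2].
    by rewrite e eqr_nat ltn_eqF.
  exact: hk.
exists k => d'; rewrite inE => /orP[/eqP->|hd'] c hc; last exact: hk.
by apply/eqP => e; apply: ne; exists c.
Qed.

Section Slice.
Variables (K : numClosedFieldType) (n : nat) (L : {vspace 'M[K]_n}).
Hypothesis hL : brackets_into L L L.
Local Notation M := 'M[K]_n.
Implicit Types (x y z u : M).

Lemma shifts_exists x y : x \in L -> y \in L -> exists rs, adshifts x rs y = 0.
Proof.
move=> hx hy; have [_ [_ dec _]] := conj_semisimple_part (adm L x).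
rewrite -(crdK hy); elim/dec: (crd L y) => [|u v [r1 h1] [r2 h2]|mu v hv].
- by exists [::]; rewrite (linear0 (@uncrd K n L)).
- exists (r1 ++ r2); have -> : uncrd (u + v) = uncrd u + uncrd v by exact: linearD.
  by rewrite linearD /= shifts_cat0l // shifts_cat0r // addr0.
have /(gen_eigenvector_shifts hL mu hx (uncrd_mem v))[k hk] :
  gen_eigenvector (adm L x) mu (crd L (uncrd v)) by rewrite uncrdK.
by exists (nseq k mu).
Qed.

Variables (xi h eta : M).
Hypotheses (tr : sl2_triple xi eta h) (nxi : nilpotent_elt L xi) (neta : nilpotent_elt L eta).

(* The slice is transverse to the orbits, and the restriction of the symplectic form
   to it is nondegenerate: both come down to this injectivity. With respect to the
   weights of [h], [ad eta \o ad xi] preserves the weight, while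
   [ad eta \o ad z] lowers it by at least 2. *)
Lemma slice_injective z u : z \in L -> lb eta z = 0 -> u \in L ->
  lb eta (lb (xi + z) (lb eta u)) = 0 -> lb eta u = 0.
Proof.
move=> zL z0 uL; rewrite lbDl lbDr; set y := lb eta u => fxy.
have etaL : eta \in L by case: neta.
have xiL : xi \in L by case: nxi.
have hhL : h \in L by case: tr => <- _ _; apply: hL.
have yL : y \in L by apply: hL.
have [k1 xi0] := nxi.2.
have [zs hzs z0'] := shifts_nat_of_f0 tr z0 (xi0 _ zL).
have [rs0 r0] := shifts_exists hhL yL.
have fey : lb eta (lb xi y) = - lb eta (lb z y) by apply/eqP; rewrite -addr_eq0 fxy.
have shL rs v : v \in L -> adshifts h rs v \in L by move=> hv; have [] := crd_shifts hL rs hhL hv.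
(* The equation [eta, [xi, y]] = - [eta, [z, y]] trades the weights of [y] for lower ones: [z]
   contributes weights at most 0 and [eta] contributes -2. *)
have step k : exists2 rs, {in rs, forall r, exists2 mu, mu \in rs0 & exists2 c, (k <= c)%N & r = mu - c%:R} &
    adshifts h rs y = 0.
  elim: k => [|k [rs hrs hy]].
    by exists rs0 => // r hr; exists r => //; exists 0%N; rewrite ?subr0.
  have [rs' hrs' hzy] := shifts_lb z0' hy.
  exists [seq mu - 2 | mu <- rs'].
    move=> _ /mapP[_ /hrs'[[a b] /= [/hzs[c ->] /hrs[mu hmu [d kd ->]]] ->] ->].
    exists mu => //; exists (c + d + 2)%N; first by rewrite addn2 ltnS (leq_trans kd) // leqW // leq_addl.
    by rewrite !natrD; ring.
  (* Shifting [y] keeps it in the image of [ad eta], the subspace on which [sl2_fe_inj] applies; the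
     +2 compensates the weight of [eta]. *)
  pose u' := adshifts h [seq mu + 2 | mu <- [seq mu - 2 | mu <- rs']] u.
  have defy : adshifts h [seq mu - 2 | mu <- rs'] y = lb eta u'.
    rewrite (shifts_lb_f tr) /y -[in RHS]map_comp -[in RHS]map_comp.
    by congr adshifts; apply/eq_map => mu /=; rewrite addrK.
  rewrite defy; apply: (sl2_fe_inj hL tr nxi neta); first exact: shL.
  have shN r w : adshifts h r (- w) = - adshifts h r w by exact: linearN.
  by rewrite -defy (shifts_lb_fe tr) fey shN -(shifts_lb_f tr) hzy lb0r oppr0.
(* Once [k] exceeds all integer differences of initial weights, the lowered list is disjoint from
   the initial one. *)
have [k hk] := nat_far_from [seq mu - nu | mu <- rs0, nu <- rs0].
have [rs hrs hy] := step k.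
apply: (shifts_coprime _ hy r0) => _ nu /hrs[mu hmu [c kc ->]] hnu.
have := hk _ (allpairs_f (fun a b => a - b) hmu hnu) _ kc.
by rewrite !subr_eq addrC.
Qed.

End Slice.

(** * The slice against the adjoint orbits and the Killing form *)

Section SliceGeometry.
Variables (K : numClosedFieldType) (n : nat) (L : {vspace 'M[K]_n}).
Local Notation M := 'M[K]_n.
Implicit Types (x y z u v : M).

Definition adl x : 'End('M[K]_n) := linfun (lb x).

Lemma adlE x v : adl x v = lb x v.
Proof. exact: lfunE. Qed.

Lemma mem_centralizer x v : (v \in centralizer L x) = (v \in L) && (lb x v == 0).
Proof.
have H : forall w, w \in centralizer L x <-> w \in L /\ lb x w = 0.
  apply: vspace_ofP; first by split; rewrite ?mem0v ?lb0r.
  move=> a u w [hu u0] [hw w0]; split; first by rewrite rpredD ?rpredZ.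
  by rewrite lbDr lbZr u0 w0 scaler0 addr0.
apply/idP/andP => [/H[-> ->] //|[hv /eqP h0]].
exact/H.
Qed.

Lemma centralizerE x : centralizer L x = (L :&: lker (adl x))%VS.
Proof. by apply/vspaceP => v; rewrite mem_centralizer memv_cap memv_ker adlE. Qed.

Lemma dim_centralizer x : (\dim (centralizer L x) + \dim (adl x @: L))%N = \dim L.
Proof. by rewrite centralizerE limg_ker_dim. Qed.

Hypotheses (hL : brackets_into L L L) (ss : semisimple_lie L).
Variables (xi h eta : M).
Hypotheses (tr : sl2_triple xi eta h) (nxi : nilpotent_elt L xi) (neta : nilpotent_elt L eta).
Local Notation Z := (centralizer L eta).
Variable x : M.
Hypothesis xS : x - xi \in Z.

Local Notation F := (adl eta @: L)%VS.
Local Notation Y := (L :&: (adl x @^-1: Z))%VS.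

Let etaL : eta \in L. Proof. by case: neta. Qed.
Let xiL : xi \in L. Proof. by case: nxi. Qed.

Lemma slice_mem : x \in L.
Proof. by rewrite -(subrK xi x) rpredD //; move: xS; rewrite mem_centralizer => /andP[]. Qed.

Let ZL : (Z <= L)%VS. Proof. by rewrite centralizerE capvSl. Qed.

Let FL : (F <= L)%VS.
Proof. by apply/subvP => _ /memv_imgP[u hu ->]; rewrite adlE hL. Qed.

Let imgL : (adl x @: L <= L)%VS.
Proof. by apply/subvP => _ /memv_imgP[u hu ->]; rewrite adlE hL // slice_mem. Qed.

Lemma slice_cap0 y : y \in F -> lb x y \in Z -> y = 0.
Proof.
move=> /memv_imgP[u uL ->]; rewrite adlE mem_centralizer => /andP[_ /eqP h0].
move: xS; rewrite mem_centralizer => /andP[zL /eqP z0].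
by apply: (slice_injective hL tr nxi neta zL z0 uL); rewrite addrC subrK.
Qed.

(** By [slice_cap0], [ad x] is injective on F = [eta, L] and its image there meets Z trivially; dim
    F = dim L - dim Z then makes the sum everything. *)
Lemma slice_transverse_F : (Z + adl x @: F)%VS = L.
Proof.
have F0 : (F :&: lker (adl x))%VS = 0%VS.
  apply/eqP; rewrite -subv0; apply/subvP => y; rewrite memv_cap memv_ker adlE memv0.
  by move=> /andP[yF /eqP y0]; rewrite (slice_cap0 yF) // y0 mem0v.
have ZF0 : (Z :&: adl x @: F)%VS = 0%VS.
  apply/eqP; rewrite -subv0; apply/subvP => w; rewrite memv_cap memv0.
  move=> /andP[wZ /memv_imgP[y yF e]]; move: wZ; rewrite e adlE => /(slice_cap0 yF) ->.
  by rewrite lb0r.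
apply/eqP; rewrite eqEdim dimv_disjoint_sum // (limg_dim_eq F0) dim_centralizer leqnn andbT.
by rewrite subv_add ZL (subv_trans (limgS _ FL)).
Qed.

Lemma slice_transverse : (Z + adl x @: L)%VS = L.
Proof.
apply/eqP; rewrite eqEsubv; apply/andP; split; first by rewrite subv_add ZL imgL.
by rewrite -{1}slice_transverse_F addvS // limgS.
Qed.

Lemma mem_slice_preim y : (y \in Y) = (y \in L) && (lb x y \in Z).
Proof. by rewrite memv_cap -memv_preim adlE. Qed.

(** Writing [x, v] = z + [x, y] with [z] in Z and [y] in F puts v - y in Y. *)
Lemma slice_decomposition : (F + Y)%VS = L.
Proof.
apply/eqP; rewrite eqEsubv subv_add FL capvSl; apply/subvP => v vL.
have : lb x v \in L by rewrite hL // slice_mem.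
rewrite -{1}slice_transverse_F => /memv_addP[z zZ [_ /memv_imgP[y yF ->] e]].
apply/memv_addP; exists y => //; exists (v - y); last by rewrite addrC subrK.
rewrite mem_slice_preim rpredB ?(subvP FL _ yF) //= lbBr e adlE addrK //.
Qed.

Lemma dim_slice_preim : \dim Y = \dim Z.
Proof.
have FY0 : (F :&: Y)%VS = 0%VS.
  apply/eqP; rewrite -subv0; apply/subvP => w; rewrite memv_cap memv0 mem_slice_preim.
  by move=> /and3P[wF _ /(slice_cap0 wF) ->].
apply/eqP; rewrite -(eqn_add2r (\dim F)) dim_centralizer addnC.
by rewrite -dimv_disjoint_sum // slice_decomposition.
Qed.

Lemma killing_eta_centralizer y z : y \in F -> z \in Z -> killing L y z = 0.
Proof.
move=> /memv_imgP[u uL ->]; rewrite mem_centralizer adlE => /andP[zL /eqP z0].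
by rewrite lbC killingNl (killing_lb hL) // z0 killing0r oppr0.
Qed.

(** F is orthogonal to Z by invariance and L = F + Y, so an element of Z orthogonal to Y is
    orthogonal to L, hence 0. As dim Y = dim Z, the Gram matrix [P] is invertible, and its inverse
    gives the dual family. *)
Lemma slice_dual_basis : exists y : 'I_(\dim Z) -> M,
  [/\ forall i, y i \in L /\ lb x (y i) \in Z,
      forall i (j : 'I_(\dim Z)), killing L (y i) (vbasis Z)`_j = (i == j)%:R &
      forall v, v \in L -> lb x v \in Z ->
        v = \sum_(i < \dim Z) killing L v (vbasis Z)`_i *: y i].
Proof.
pose b (i : 'I_(\dim Z)) := (vbasis Y)`_i.
have bY i : b i \in Y by apply: vbasis_nth_mem; rewrite dim_slice_preim.
pose P : 'M[K]_(\dim Z) := \matrix_(i, j) killing L (b i) (vbasis Z)`_j.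
have expand v : v \in Y -> exists c : 'rV[K]_(\dim Z), v = \sum_i c 0 i *: b i.
  move=> hv; exists (\row_i coord (vbasis Y) (cast_ord (esym dim_slice_preim) i) v).
  rewrite {1}(coord_vbasis hv) (reindex (cast_ord (esym dim_slice_preim))) /=.
    by apply: eq_bigr => i _; rewrite mxE.
  by exists (cast_ord dim_slice_preim) => i _; apply/val_inj.
have kerP (c : 'cV[K]_(\dim Z)) : P *m c = 0 -> c = 0.
  move=> Pc0; pose z := \sum_j c j 0 *: (vbasis Z)`_j.
  have zZ : z \in Z by apply: rpred_sum => j _; apply/rpredZ/vbasis_nth_mem.
  have z0 : z = 0.
    apply: (killing_nondegenerate hL ss (subvP ZL _ zZ)) => v vL.
    rewrite (killingC hL) ?(subvP ZL _ zZ) //.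
    have : v \in (F + Y)%VS by rewrite slice_decomposition.
    move=> /memv_addP[f fF [y yY ->]].
    rewrite killingDl killing_eta_centralizer // add0r.
    have [d ->] := expand y yY; rewrite killing_suml big1 //= => i _; rewrite killingZl.
    suff -> : killing L (b i) z = (P *m c) i 0 by rewrite Pc0 mxE mulr0.
    rewrite /z linear_sum mxE; apply: eq_bigr => j _.
    by rewrite linearZ /= !mxE mulrC.
  apply/colP => j; rewrite mxE.
  have /freeP fr := free_vbasis Z; exact: (fr (fun j => c j 0) z0 j).
have Punit : P \in unitmx.
  rewrite -unitmx_tr -row_free_unit -kermx_eq0; apply/eqP/row_matrixP => i.
  have hw : row i (kermx P^T) *m P^T = 0 by apply/sub_kermxP/row_sub.
  rewrite row0; apply: trmx_inj; rewrite trmx0; apply: kerP.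
  by rewrite -[LHS]trmxK trmx_mul trmxK hw trmx0.
exists (fun i => \sum_k invmx P i k *: b k); split.
- move=> i; apply/andP; rewrite -mem_slice_preim.
  by apply: rpred_sum => k _; apply: rpredZ.
- move=> i j; have <- : (invmx P *m P) i j = (i == j)%:R by rewrite mulVmx // mxE.
  rewrite mxE killing_suml; apply: eq_bigr => k _.
  by rewrite killingZl !mxE.
- move=> v vL vZ.
  have /expand[c ->] : v \in Y by rewrite mem_slice_preim vL.
  have kc (j : 'I_(\dim Z)) : killing L (\sum_i c 0 i *: b i) (vbasis Z)`_j = (c *m P) 0 j.
    by rewrite mxE killing_suml; apply: eq_bigr => k _; rewrite killingZl !mxE.
  under [RHS]eq_bigr => i _ do rewrite kc scaler_sumr.
  rewrite exchange_big /=; apply: eq_bigr => k _.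
  under eq_bigr => i _ do rewrite scalerA.
  rewrite -scaler_suml; congr (_ *: _).
  by rewrite -[c in LHS](mulmxK Punit) mxE.
Qed.

(** Since Z + [x, L] = L, the intersection has dimension dim Z - dim Z(x). *)
Lemma slice_orbit_cap0 z : (\dim Z <= \dim (centralizer L x))%N ->
  z \in Z -> z \in (adl x @: L)%VS -> z = 0.
Proof.
move=> le zZ zI.
have : (\dim (Z :&: adl x @: L) <= 0)%N.
  rewrite -(leq_add2l (\dim (Z + adl x @: L))) dimv_sum_cap addn0.
  by rewrite slice_transverse -(dim_centralizer x) leq_add2r.
rewrite leqn0 dimv_eq0 => /eqP e; apply/eqP; rewrite -memv0 -e memv_cap zZ.
exact: zI.
Qed.

End SliceGeometry.

(** * Differentials and tangent spaces *)

Section Differentials.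
Variable K : numFieldType.

Lemma is_diff_of_eps (V W : normedModType K) (f : V -> W) (df : {linear V -> W}) x :
  continuous df ->
  (forall e, 0 < e -> \forall y \near x, `|f y - f x - df (y - x)| <= e * `|y - x|) ->
  is_diff x f df.
Proof.
move=> dfc hf.
have E : f \o shift x = cst (f x) + df +o_ 0 id.
  apply/eqaddoP => e e0; have := hf e e0.
  rewrite (near_shift 0 x) subr0; apply: filterS => y /=.
  rewrite addrK -![(_ + _ : _ -> _) _]/(_ + _) -![(- _ : _ -> _) _]/(- _) /=.
  by rewrite opprD addrA.
have D := diff_unique dfc E.
by apply: DiffDef => //; apply/diff_locallyP; rewrite D.
Qed.

Lemma diff_eps (V W : normedModType K) (f : V -> W) x : differentiable f x ->
  forall e, 0 < e -> \forall y \near x, `|f y - f x - 'd f x (y - x)| <= e * `|y - x|.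
Proof.
move=> /diff_locally/eqaddoP hf e e0.
have : \forall y \near (0 : V), `|(f \o shift x - (cst (f x) + 'd f x)) y| <= e * `|y|.
  exact: hf.
rewrite (near_shift x 0); apply: filterS => y /=.
rewrite sub0r -![(_ + _ : _ -> _) _]/(_ + _) -![(- _ : _ -> _) _]/(- _) /=.
by rewrite subrK opprD addrA.
Qed.

Lemma is_diff_near (V W : normedModType K) (f g df : V -> W) x :
  (\forall y \near x, f y = g y) -> is_diff x g df -> is_diff x f df.
Proof.
move=> fg [dg <-]; have fgx : f x = g x by apply: nbhs_singleton fg.
apply: is_diff_of_eps => [|e e0]; first exact: diff_continuous.
near=> y; rewrite fgx (near fg y) //.
by near: y; apply: diff_eps.
Unshelve. all: by end_near. Qed.

Lemma is_diff_sum (V W : normedModType K) x n (f df : 'I_n -> V -> W) :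
  (forall i, is_diff x (f i) (df i)) ->
  is_diff x (fun y => \sum_i f i y) (fun v => \sum_i df i v).
Proof.
elim: n f df => [|n IH] f df h.
  have -> : (fun y => \sum_(i < 0) f i y) = cst 0 by apply/funext => y; rewrite big_ord0.
  have -> : (fun y => \sum_(i < 0) df i y) = 0 by apply/funext => y; rewrite big_ord0.
  exact: is_diff_cst.
have -> : (fun y => \sum_i f i y) = (fun y => \sum_i f (widen_ord (leqnSn n) i) y) + f ord_max.
  by apply/funext => y; rewrite big_ord_recr.
have -> : (fun y => \sum_i df i y) = (fun y => \sum_i df (widen_ord (leqnSn n) i) y) + df ord_max.
  by apply/funext => y; rewrite big_ord_recr.
by apply: is_diffD => //; apply: IH.
Qed.

Lemma is_diff_Zl (V W : normedModType K) x (k dk : V -> K^o) (w : W) :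
  is_diff x k dk -> is_diff x (fun y => k y *: w) (fun v => dk v *: w).
Proof. by move=> hk; apply: (is_diff_comp hk (is_diff_scalel (k x) w)). Qed.

Lemma is_diff_entries (V : normedModType K) m n x (f df : V -> 'M[K]_(m, n)) :
  (forall i j, is_diff x (fun y => f y i j : K^o) (fun v => df v i j : K^o)) ->
  is_diff x f df.
Proof.
move=> h.
have E (g : V -> 'M[K]_(m, n)) : g = (fun y => \sum_i \sum_j g y i j *: delta_mx i j).
  by apply/funext => y; rewrite {1}[g y]matrix_sum_delta.
rewrite (E f) (E df); apply: is_diff_sum => i; apply: is_diff_sum => j.
exact: is_diff_Zl.
Qed.

Lemma linear_mx_continuous m n (W : normedModType K) (f : {linear 'M[K]_(m, n) -> W}) :
  continuous f.
Proof.
move=> x; apply: differentiable_continuous.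
have -> : (f : 'M[K]_(m, n) -> W) = (fun y => \sum_i \sum_j y i j *: f (delta_mx i j)).
  apply/funext => y; rewrite {1}[y]matrix_sum_delta linear_sum.
  by apply: eq_bigr => i _; rewrite linear_sum; apply: eq_bigr => j _; rewrite linearZ.
have [] : is_diff x (fun y : 'M[K]_(m, n) => \sum_i \sum_j y i j *: f (delta_mx i j))
    (fun v => \sum_i \sum_j 'd (fun y : 'M[K]_(m, n) => y i j : K^o) x v *: f (delta_mx i j)).
  apply: is_diff_sum => i; apply: is_diff_sum => j; apply: is_diff_Zl.
  exact: DiffDef (differentiable_coord _ _ _) erefl.
by [].
Qed.

Lemma is_diff_linear_mx m n (W : normedModType K) (f : {linear 'M[K]_(m, n) -> W}) x :
  is_diff x f f.
Proof.
apply: DiffDef; first exact/linear_differentiable/linear_mx_continuous.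
exact/diff_lin/linear_mx_continuous.
Qed.

Lemma is_diff_linear_comp (V : normedModType K) m n (W : normedModType K)
  (f : {linear 'M[K]_(m, n) -> W}) (g dg : V -> 'M[K]_(m, n)) x :
  is_diff x g dg -> is_diff x (fun y => f (g y)) (fun v => f (dg v)).
Proof. by move=> h; apply: (is_diff_comp h (is_diff_linear_mx f (g x))). Qed.

Definition mx_coord m n (i : 'I_m) (j : 'I_n) (A : 'M[K]_(m, n)) : K^o := A i j.

Lemma mx_coord_is_linear m n (i : 'I_m) (j : 'I_n) : linear (mx_coord i j).
Proof. by move=> a u v; rewrite /mx_coord !mxE. Qed.
HB.instance Definition _ m n (i : 'I_m) (j : 'I_n) :=
  GRing.isLinear.Build K 'M[K]_(m, n) K^o _ (mx_coord i j) (@mx_coord_is_linear m n i j).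

Lemma is_diff_coord (V : normedModType K) m n x (f df : V -> 'M[K]_(m, n)) i j :
  is_diff x f df -> is_diff x (fun y => f y i j : K^o) (fun v => df v i j : K^o).
Proof. exact: (is_diff_linear_comp (mx_coord i j)). Qed.

Lemma is_diff_mulmx (V : normedModType K) m n p x
    (f df : V -> 'M[K]_(m, n)) (g dg : V -> 'M[K]_(n, p)) :
  is_diff x f df -> is_diff x g dg ->
  is_diff x (fun y => f y *m g y) (fun v => df v *m g x + f x *m dg v).
Proof.
move=> hf hg; apply: is_diff_entries => i j.
have -> : (fun y => (f y *m g y) i j : K^o) = (fun y => \sum_k f y i k * g y k j).
  by apply/funext => y; rewrite mxE.
have -> : (fun v => (df v *m g x + f x *m dg v) i j : K^o) =
    (fun v => \sum_k (f x i k * dg v k j + g x k j * df v i k)).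
  apply/funext => v; rewrite !mxE -big_split; apply: eq_bigr => k _.
  by rewrite [RHS]addrC [X in _ = X + _]mulrC.
apply: is_diff_sum => k.
exact: (is_diffM (is_diff_coord i k hf) (is_diff_coord k j hg)).
Qed.

Lemma differentiable_bigsum (V : normedModType K) x (I : Type) (r : seq I) (f : I -> V -> K^o) :
  (forall i, differentiable (f i) x) -> differentiable (fun y => \sum_(i <- r) f i y : K^o) x.
Proof.
move=> h; elim: r => [|i r IH].
  have -> : (fun y => \sum_(i <- [::]) f i y : K^o) = cst 0 by apply/funext => y; rewrite big_nil.
  exact: differentiable_cst.
have -> : (fun y => \sum_(j <- i :: r) f j y : K^o) = f i + (fun y => \sum_(j <- r) f j y : K^o).
  by apply/funext => y; rewrite big_cons.
exact: differentiableD.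
Qed.

Lemma differentiable_bigprod (V : normedModType K) x (I : Type) (r : seq I) (f : I -> V -> K^o) :
  (forall i, differentiable (f i) x) -> differentiable (fun y => \prod_(i <- r) f i y : K^o) x.
Proof.
move=> h; elim: r => [|i r IH].
  have -> : (fun y => \prod_(i <- [::]) f i y : K^o) = cst 1 by apply/funext => y; rewrite big_nil.
  exact: differentiable_cst.
have -> : (fun y => \prod_(j <- i :: r) f j y : K^o) = f i * (fun y => \prod_(j <- r) f j y : K^o).
  by apply/funext => y; rewrite big_cons.
exact: differentiableM.
Qed.

Lemma differentiable_mull (V : normedModType K) x (c : K) (f : V -> K^o) :
  differentiable f x -> differentiable (fun y => c * f y : K^o) x.
Proof.
by move=> h; apply: (@differentiableM _ _ (cst (c : K^o)) f) => //; apply: differentiable_cst.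
Qed.

Lemma differentiable_det (V : normedModType K) n x (f : V -> 'M[K]_n) :
  (forall i j, differentiable (fun y => f y i j : K^o) x) ->
  differentiable (fun y => \det (f y) : K^o) x.
Proof.
move=> h; rewrite /determinant; apply: differentiable_bigsum => s.
apply: differentiable_mull; exact: differentiable_bigprod.
Qed.

Lemma differentiable_coord_id m n (A : 'M[K]_(m, n)) i j :
  differentiable (fun B : 'M[K]_(m, n) => B i j : K^o) A.
Proof. exact: differentiable_coord. Qed.

Lemma near_unitmx n (A : 'M[K]_n) : A \in unitmx -> \forall B \near A, B \in unitmx.
Proof.
rewrite unitmxE unitfE => dA.
have dc : {for A, continuous (fun B : 'M[K]_n => \det B : K^o)}.
  apply: (@differentiable_continuous _ _ _ A (fun B => \det B : K^o)).
  by apply: differentiable_det => i j; apply: differentiable_coord_id.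
have o0 : open [set z : K^o | z != 0].
  rewrite (_ : [set z | _] = ~` [set 0]); last by apply/seteqP; split=> z /eqP.
  exact/closed_openC/accessible_closed_set1/hausdorff_accessible/norm_hausdorff.
have : \forall B \near A, \det B != 0 by apply: dc (open_nbhs_nbhs (conj o0 dA)).
by apply: filterS => B hB; rewrite unitmxE unitfE.
Qed.

Lemma open_unitmx n : open [set A : 'M[K]_n | A \in unitmx].
Proof. by rewrite openE => A hA; apply: near_unitmx. Qed.

(** The cofactor formula gives differentiability; the value comes from differentiating B B^-1 =
    1. *)
Lemma is_diff_invmx n (A : 'M[K]_n) : A \in unitmx ->
  is_diff A (@invmx K n) (fun v => - (invmx A *m v *m invmx A)).
Proof.
move=> uA; pose g (B : 'M[K]_n) := (\det B)^-1 *: \adj B.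
(* [invmx] is the identity on singular matrices, so the formula holds only near [A]. *)
have gE : \forall B \near A, invmx B = g B.
  by apply: filterS (near_unitmx uA) => B uB; rewrite /invmx uB.
have ddet : differentiable (fun B : 'M[K]_n => \det B : K^o) A.
  by apply: differentiable_det => i j; apply: differentiable_coord_id.
have dA0 : \det A != 0 by rewrite -unitfE -unitmxE.
have dg i j : differentiable (fun B => g B i j : K^o) A.
  have -> : (fun B => g B i j : K^o) = (fun B => (\det B)^-1) * (fun B => (\adj B) i j).
    by apply/funext => B; rewrite /g mxE.
  apply: differentiableM; first exact: differentiableV.
  have -> : (fun B : 'M[K]_n => (\adj B) i j) = cst ((-1) ^+ (j + i)) * (fun B => \det (row' j (col' i B))).
    by apply/funext => B; rewrite mxE.
  apply: differentiableM; first exact: differentiable_cst.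
  apply: differentiable_det => k l.
  have -> : (fun y : 'M[K]_n => row' j (col' i y) k l : K^o) = (fun y => y (lift j k) (lift i l)).
    by apply/funext => B; rewrite !mxE.
  exact: differentiable_coord_id.
have hg : is_diff A g (fun v => \matrix_(i, j) 'd (fun B => g B i j : K^o) A v).
  by apply: is_diff_entries => i j; apply: DiffDef => //; apply/funext => v; rewrite mxE.
set D := fun v => _ in hg; have hi : is_diff A (@invmx K n) D by apply: is_diff_near hg.
have hid : is_diff A (@id 'M[K]_n) id by apply: is_diff_id.
have hm := is_diff_mulmx hid hi.
have h1 : is_diff A (fun B : 'M[K]_n => B *m invmx B) (fun=> 0).
  apply: is_diff_near (is_diff_cst (1%:M : 'M[K]_n) A).
  by apply: filterS (near_unitmx uA) => B uB; rewrite mulmxV.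
have E v : v *m invmx A + A *m D v = 0.
  by have := @diff_val _ _ _ _ _ _ _ hm; rewrite (@diff_val _ _ _ _ _ _ _ h1) => /(congr1 (fun F => F v)).
suff <- : D = (fun v => - (invmx A *m v *m invmx A)) by [].
apply/funext => v; rewrite -[LHS](mulKmx uA); have /eqP := E v.
by rewrite addrC addr_eq0 => /eqP ->; rewrite mulmxN mulmxA.
Qed.

End Differentials.

(** * Tangent vectors of submanifolds *)

Section Curves.
Variable K : numFieldType.

Lemma fst_continuous (V W : normedModType K) : continuous (@fst V W).
Proof. by move=> p; apply: cvg_fst. Qed.

Lemma snd_continuous (V W : normedModType K) : continuous (@snd V W).
Proof. by move=> p; apply: cvg_snd. Qed.

Lemma is_diff_fst (U V W : normedModType K) x (f df : U -> V * W) :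
  is_diff x f df -> is_diff x (fun y => (f y).1) (fun v => (df v).1).
Proof.
move=> hf; apply: (is_diff_comp hf (g := fst) (dg := fst)).
apply: DiffDef; first exact/linear_differentiable/fst_continuous.
exact/diff_lin/fst_continuous.
Qed.

Lemma is_diff_snd (U V W : normedModType K) x (f df : U -> V * W) :
  is_diff x f df -> is_diff x (fun y => (f y).2) (fun v => (df v).2).
Proof.
move=> hf; apply: (is_diff_comp hf (g := snd) (dg := snd)).
apply: DiffDef; first exact/linear_differentiable/snd_continuous.
exact/diff_lin/snd_continuous.
Qed.

Lemma is_diff_uniq (V W : normedModType K) x (f df dg : V -> W) :
  is_diff x f df -> is_diff x f dg -> df = dg.
Proof. by case=> _ <- [_ <-]. Qed.

Lemma is_diff_curve (E : normedModType K) (gamma : K^o -> E) t :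
  differentiable gamma t -> is_diff t gamma (fun s => s *: 'D_1 gamma t).
Proof.
move=> h; apply: DiffDef => //; apply/funext => s.
by rewrite deriveE // -linearZ /= [s *: _]mulr1.
Qed.

Lemma tangentI (E : normedModType K) (X : set E) p v (gamma : K^o -> E) :
  gamma 0 = p -> (\forall t \near (0 : K^o), X (gamma t) /\ differentiable gamma t) ->
  (exists2 dg, is_diff (0 : K^o) gamma dg & dg 1 = v) -> tangent X p v.
Proof.
move=> h1 h2 [dg [h3 h4] <-]; exists gamma; split=> //.
by rewrite deriveE // h4.
Qed.

Lemma tangentE (E : normedModType K) (X : set E) p v : tangent X p v ->
  exists gamma : K^o -> E, [/\ gamma 0 = p,
    \forall t \near (0 : K^o), X (gamma t) /\ differentiable gamma t &
    is_diff (0 : K^o) gamma (fun s => s *: v)].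
Proof.
move=> [gamma [h1 h2 h3]]; exists gamma; split=> //.
have [_ d0] := nbhs_singleton h2.
by rewrite -h3; apply: is_diff_curve.
Qed.

Lemma near_curve (E : normedModType K) (gamma dg : K^o -> E) (U : set E) :
  is_diff (0 : K^o) gamma dg -> open U -> U (gamma 0) -> \forall t \near (0 : K^o), U (gamma t).
Proof.
move=> [d _] oU h0; apply: (differentiable_continuous d).
by apply: open_nbhs_nbhs.
Qed.

Lemma is_diff_line (E : normedModType K) (p v : E) (t : K^o) :
  is_diff t (fun s : K^o => p + s *: v) (fun s => s *: v).
Proof.
have -> : (fun s : K^o => s *: v) = (fun=> 0) + (fun s : K^o => s *: v).
  by apply/funext => s; rewrite /= -![(_ + _ : _ -> _) _]/(_ + _) add0r.
exact: (is_diffD (is_diff_cst p t) (is_diff_scalel t v)).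
Qed.

Lemma tangent_param (E : normedModType K) (X : set E) d (V : set 'rV[K]_d) (psi : 'rV[K]_d -> E) c0 c :
  open V -> V c0 -> (forall c, V c -> X (psi c) /\ differentiable psi c) ->
  tangent X (psi c0) ('d psi c0 c).
Proof.
move=> oV V0 hpsi; apply: (tangentI (gamma := fun t : K^o => psi (c0 + t *: c))).
- by rewrite scale0r addr0.
- have : \forall t \near (0 : K^o), V (c0 + t *: c).
    by apply: (near_curve (is_diff_line c0 c 0)) => //; rewrite scale0r addr0.
  apply: filterS => t Vt; have [Xt dt] := hpsi _ Vt; split=> //.
  apply: (differentiable_comp (f := fun s : K^o => c0 + s *: c) (g := psi)) => //.
- exists (fun s => 'd psi c0 (s *: c)); last by rewrite scale1r.
  apply: (is_diff_comp (is_diff_line c0 c 0)).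
  by rewrite scale0r addr0; apply: differentiableP; apply: (hpsi _ V0).2.
Qed.

(** Velocities of curves are not visibly closed under addition. Differentiating gamma = psi (phi
    gamma) identifies them with the image of the differential of [psi], with that of [phi] as a
    section. *)
Lemma tangent_submanifold (E : normedModType K) (X : set E) d p :
  complex_submanifold X d -> X p -> exists (L : {linear 'rV[K]_d -> E}) (L' : {linear E -> 'rV[K]_d}),
    (forall v, tangent X p v <-> exists c, v = L c) /\ forall v, tangent X p v -> L (L' v) = v.
Proof.
move=> hX Xp; have [U [V [phi [psi [[oU Up] oV [hphi hpsi] h1 h2]]]]] := hX p Xp.
have [Vp psip] := h1 p Xp Up.
have dphi : differentiable phi p by apply: hphi.
have dpsi : differentiable psi (phi p) by apply: hpsi.
have key v : tangent X p v -> 'd psi (phi p) ('d phi p v) = v.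
  move=> /tangentE[gamma [g0 gX gd]].
  have hd1 : is_diff (gamma 0) phi ('d phi p) by rewrite g0; apply: differentiableP.
  have hd2 : is_diff (phi (gamma 0)) psi ('d psi (phi p)) by rewrite g0; apply: differentiableP.
  have hd := is_diff_comp (is_diff_comp gd hd1) hd2.
  have near0 : \forall t \near (0 : K^o), gamma t = (psi \o (phi \o gamma)) t.
    have nU := near_curve gd oU; rewrite g0 in nU.
    apply: filterS2 gX (nU Up) => t [Xt _] Ut /=.
    by have [_ ->] := h1 _ Xt Ut.
  have := is_diff_uniq gd (is_diff_near near0 hd).
  by move/(congr1 (fun F => F 1)) => /=; rewrite scale1r => <-.
exists ('d psi (phi p)), ('d phi p); split=> // v; split.
  by move=> hv; exists ('d phi p v); rewrite key.
move=> [c ->]; rewrite -[X in tangent _ X _]psip.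
by apply: (tangent_param c oV Vp) => y Vy; split; [have [] := h2 _ Vy | apply: hpsi].
Qed.

(* To first order, a submanifold is its tangent space. *)
Lemma submanifold_near (E : normedModType K) (X : set E) d p :
  complex_submanifold X d -> X p -> forall e, 0 < e ->
  \forall a \near p, X a -> exists2 w, tangent X p w & `|a - p - w| <= e * `|a - p|.
Proof.
move=> hX Xp e e0; have [U [V [phi [psi [[oU Up] oV [hphi hpsi] h1 h2]]]]] := hX p Xp.
have [Vp psip] := h1 p Xp Up.
have dphi : differentiable phi p by apply: hphi.
have dpsi : differentiable psi (phi p) by apply: hpsi.
have [k k0 hk] := linear_lipschitz (diff_continuous dphi).
have k1 : 0 < k + 1 by rewrite ltr_wpDl // ltW.
have ek : 0 < e / (k + 1) by rewrite divr_gt0.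
have hphi1 := diff_eps dphi ltr01.
have hpsi1 := differentiable_continuous dphi (diff_eps dpsi ek).
have nU : nbhs p U by apply: open_nbhs_nbhs.
near=> a => Xa.
have Ua : U a by near: a.
have [_ psia] := h1 a Xa Ua.
exists ('d psi (phi p) (phi a - phi p)).
  rewrite -[X in tangent _ X _]psip.
  by apply: (tangent_param _ oV Vp) => y Vy; split; [have [] := h2 _ Vy | apply: hpsi].
have hpa : `|phi a - phi p| <= (k + 1) * `|a - p|.
  rewrite -[phi a - phi p](subrK ('d phi p (a - p))) addrC mulrDl.
  apply: le_trans (ler_normD _ _) (lerD (hk _) _).
  by near: a.
rewrite -{1}psia -{1}psip; apply: (@le_trans _ _ (e / (k + 1) * `|phi a - phi p|)).
  by near: a.
by apply: le_trans (ler_wpM2l (ltW ek) hpa) _; rewrite mulrA mulfVK // gt_eqF.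
Unshelve. all: by end_near. Qed.

(** Differentiate the identity f = [projv W] f. *)
Lemma is_diff_mem_vspace m n (W : {vspace 'M[K]_(m, n)}) (f df : K^o -> 'M[K]_(m, n)) x v :
  (\forall t \near x, f t \in W) -> is_diff x f df -> df v \in W.
Proof.
move=> fW hd.
have hp : is_diff x (fun t => projv W (f t)) (fun v => projv W (df v)).
  exact: (is_diff_linear_comp (fun_of_lfun (projv W) : {linear 'M[K]_(m, n) -> 'M[K]_(m, n)}) hd).
have fE : \forall t \near x, f t = projv W (f t) by apply: filterS fW => t ht; rewrite projv_id.
by have := is_diff_uniq hd (is_diff_near fE hp) => /(congr1 (fun F => F v)) ->; apply: memv_proj.
Qed.

End Curves.

(** * The Lie algebra of a linear algebraic group *)

Section GroupTangent.
Variables (K : numFieldType) (n : nat) (G : set 'M[K]_n).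
Local Notation M := 'M[K]_n.
Hypothesis hG : linear_algebraic_group G.
Implicit Types (a b : M).

Lemma group1_mem : G 1%:M. Proof. by case: hG => -[]. Qed.
Lemma groupM_mem a b : G a -> G b -> G (a *m b). Proof. by case: hG => -[_ + _ _ _]; apply. Qed.
Lemma groupV_mem a : G a -> G (invmx a). Proof. by case: hG => -[_ _ + _ _]; apply. Qed.
Lemma group_unit a : G a -> a \in unitmx.
Proof. by case: hG => -[_ _ _ [I ->]] _ []. Qed.

Lemma tangent_mulmx a b v : G a -> G b -> tangent G a v -> tangent G (a *m b) (v *m b).
Proof.
move=> Ga Gb /tangentE[gamma [g0 gX gd]].
apply: (tangentI (gamma := fun t => gamma t *m b)); first by rewrite g0.
  apply: filterS gX => t [h1 h2]; split; first exact: groupM_mem.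
  by have [] := is_diff_linear_comp (mulmxr b) (differentiableP h2).
exists (fun s => (s *: v) *m b); last by rewrite scale1r.
exact: (is_diff_linear_comp (mulmxr b) gd).
Qed.

Lemma tangent_mulmxl a b v : G a -> G b -> tangent G a v -> tangent G (b *m a) (b *m v).
Proof.
move=> Ga Gb /tangentE[gamma [g0 gX gd]].
apply: (tangentI (gamma := fun t => b *m gamma t)); first by rewrite g0.
  apply: filterS gX => t [h1 h2]; split; first exact: groupM_mem.
  by have [] := is_diff_linear_comp (mulmx b) (differentiableP h2).
exists (fun s => b *m (s *: v)); last by rewrite scale1r.
exact: (is_diff_linear_comp (mulmx b) gd).
Qed.

Lemma mem_Lie v : v \in Lie G <-> tangent G 1%:M v.
Proof.
have [_ [d hd]] := hG; have [L [_ [hL _]]] := tangent_submanifold hd group1_mem.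
apply: vspace_ofP; first by apply/hL; exists 0; rewrite linear0.
by move=> a u w /hL[c1 ->] /hL[c2 ->]; apply/hL; exists (a *: c1 + c2); rewrite linearP.
Qed.

Lemma tangent_group a v : G a -> tangent G a v <-> v *m invmx a \in Lie G.
Proof.
move=> Ga; have ua := group_unit Ga; split=> [h|/mem_Lie h].
  by apply/mem_Lie; rewrite -(mulmxV ua); apply: tangent_mulmx => //; apply: groupV_mem.
by have := tangent_mulmx group1_mem Ga h; rewrite mul1mx mulmxKV.
Qed.

Lemma Lie_conj a v : G a -> v \in Lie G -> a *m v *m invmx a \in Lie G.
Proof.
move=> Ga /mem_Lie hv; have Ga' := groupV_mem Ga; have ua := group_unit Ga.
apply/mem_Lie; rewrite -(mulmxV ua); apply: tangent_mulmx => //.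
by have := tangent_mulmxl group1_mem Ga hv; rewrite mulmx1.
Qed.

Lemma is_diff_conj (V : normedModType K) x (f df g dg : V -> M) : f x = 1%:M ->
  is_diff x f df -> is_diff x g dg ->
  is_diff x (fun t => f t *m g t *m invmx (f t)) (fun v => lb (df v) (g x) + dg v).
Proof.
move=> f1 hf hg.
have uf : f x \in unitmx by rewrite f1 unitmx1.
have hi := is_diff_comp hf (is_diff_invmx uf).
apply: (is_diff_eq (is_diff_mulmx (is_diff_mulmx hf hg) hi)).
apply/funext => v /=; rewrite f1 invmx1 lbE !(mulmx1, mul1mx) mulmxN.
by rewrite addrAC.
Qed.

(** For a curve [gamma] in [G] of velocity [x], the curve Ad_gamma(y) stays in the Lie algebra and
    has velocity [x, y] at 0. *)
Lemma Lie_bracket : brackets_into (Lie G) (Lie G) (Lie G).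
Proof.
move=> x y /mem_Lie /tangentE[gamma [g0 gX gd]] hy.
have hc : is_diff (0 : K^o) (fun t => gamma t *m y *m invmx (gamma t))
    (fun s => lb (s *: x) y + 0) := is_diff_conj g0 gd (is_diff_cst y (0 : K^o)).
rewrite -[x]scale1r -[lb _ _]addr0.
apply: (is_diff_mem_vspace 1 _ hc).
by apply: filterS gX => t [Gt _]; apply: Lie_conj.
Qed.

End GroupTangent.

(** * The manifold G x S and the differential of Phi *)

Section ProductManifold.
Variables (K : numClosedFieldType) (n : nat) (G : set 'M[K]_n).
Local Notation M := 'M[K]_n.
Hypothesis hG : linear_algebraic_group G.
Variables (xi eta : M).
Local Notation L := (Lie G).
Local Notation Z := (centralizer L eta).
Local Notation X := (G `*` Sreg G xi eta).

Lemma open_fst_preimage (V W : normedModType K) (U : set V) :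
  open U -> open [set p : V * W | U p.1].
Proof. by move=> oU; apply: open_comp => // p _; apply: fst_continuous. Qed.

Lemma tangent_slice p v : X p ->
  tangent X p v <-> v.1 *m invmx p.1 \in L /\ v.2 \in Z.
Proof.
case: p v => a x [v w] /= [Ga Sx]; split.
  move=> /tangentE[gamma [g0 gX gd]]; split.
    apply/(tangent_group hG v Ga); apply: (tangentI (gamma := fun t => (gamma t).1)).
    - by rewrite g0.
    - apply: filterS gX => t [[G1 _] dt]; split=> //.
      by have [] := is_diff_fst (differentiableP dt).
    exists (fun s : K^o => (s *: (v, w)).1); first exact: is_diff_fst.
    by rewrite scale1r.
  have h2 : is_diff (0 : K^o) (fun t => (gamma t).2 - xi) (fun s => (s *: (v, w)).2 - 0).
    exact: (is_diffB (is_diff_snd gd) (is_diff_cst xi (0 : K^o))).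
  have -> : w = ((1 : K^o) *: (v, w)).2 - 0 by rewrite scale1r subr0.
  apply: (is_diff_mem_vspace 1 _ h2).
  by apply: filterS gX => t [[_ S2] _].
move=> [/(tangent_group hG v Ga)/tangentE[gamma [g0 gX gd]] wZ].
apply: (tangentI (gamma := fun t => (gamma t, x + t *: w))).
- by rewrite g0 scale0r addr0.
- apply: filterS gX => t [G1 dt]; split.
    by split=> //=; rewrite /Sreg /= addrAC rpredD ?rpredZ.
  exact: differentiable_pair.
exists (fun s : K^o => (s *: v, s *: w)); last by rewrite !scale1r.
by apply: is_diff_pair => //; apply: is_diff_line.
Qed.

Lemma complex_submanifold_slice : exists d, complex_submanifold X d.
Proof.
have [_ [d hd]] := hG; exists (d + \dim Z)%N => -[a x] [/= Ga Sx].
have [U [V [phi [psi [[oU Ua] oV [hphi hpsi] h1 h2]]]]] := hd a Ga.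
exists [set p : M * M | U p.1], [set c : 'rV[K]_(d + \dim Z) | V (lsubmx c)].
exists (fun p => row_mx (phi p.1) (crd Z (p.2 - xi))).
exists (fun c => (psi (lsubmx c), xi + @uncrd _ _ Z (rsubmx c))); split.
- by split=> //; apply: open_fst_preimage.
- apply: open_comp => // c _.
  have [dl _] := is_diff_linear_mx (lsubmx : {linear 'rV[K]_(d + \dim Z) -> 'rV[K]_d}) c.
  exact: differentiable_continuous dl.
- split=> [p Up|c Vc].
    have hp := differentiableP (hphi _ Up).
    have h1' := is_diff_comp (is_diff_fst (is_diff_id p)) hp.
    have h2' := is_diff_linear_comp (crd Z)
      (is_diffB (is_diff_snd (is_diff_id p)) (is_diff_cst xi p)).
    have [hd' _] := is_diffD (is_diff_linear_comp (mulmxr (row_mx 1%:M 0)) h1')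
      (is_diff_linear_comp (mulmxr (row_mx 0 1%:M)) h2').
    move: hd'; congr (differentiable _ _); apply/funext => q.
    rewrite -![(_ + _ : _ -> _) _]/(_ + _) /= !mul_mx_row !mulmx1 !mulmx0 add_row_mx.
    by rewrite addr0 add0r.
  apply: differentiable_pair.
    apply: (differentiable_comp (f := lsubmx) (g := psi)); last exact: hpsi.
    by have [] := is_diff_linear_mx (lsubmx : {linear 'rV[K]_(d + \dim Z) -> 'rV[K]_d}) c.
  have [] := is_diffD (is_diff_cst xi c) (is_diff_linear_comp (@uncrd K n Z)
    (is_diff_linear_mx (rsubmx : {linear 'rV[K]_(d + \dim Z) -> 'rV[K]_(\dim Z)}) c)).
  by [].
- move=> [b y] [/= Gb Sy] Ub; have [Vb e] := h1 b Gb Ub.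
  by rewrite row_mxKl row_mxKr e crdK // addrC subrK.
- move=> c Vc; have [Gc Uc e] := h2 _ Vc; split=> //=.
    by split=> //=; rewrite /Sreg /= addrAC subrr add0r uncrd_mem.
  by rewrite e addrAC subrr add0r uncrdK hsubmxK.
Qed.

Definition dPhi (p v : M * M) : M :=
  - (invmx p.1 *m (v.2 + lb p.2 (v.1 *m invmx p.1)) *m p.1).

Lemma is_diff_Phi p : Phi_dom p -> is_diff p (@Phi K n) (dPhi p).
Proof.
move=> up; have h1 := is_diff_fst (is_diff_id p).
have h2 := is_diff_snd (is_diff_id p).
have hi := is_diff_comp h1 (is_diff_invmx up).
apply: (is_diff_eq (is_diffN (is_diff_mulmx (is_diff_mulmx hi h2) h1))).
apply/funext => -[v w] /=; rewrite /dPhi lbE /= -![(- _ : _ -> _) _]/(- _); congr (- _).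
rewrite !(mulmxDl, mulmxDr, mulmxN, mulNmx, mulmxA) /= mulmxKV //.
by rewrite [X in X + _]addrC -addrA [X in _ + X = _]addrC.
Qed.

Lemma dPhi_eq0 p v : Phi_dom p -> dPhi p v = 0 <-> v.2 + lb p.2 (v.1 *m invmx p.1) = 0.
Proof.
move=> up; rewrite /dPhi; split=> [|->]; last by rewrite mulmx0 mul0mx oppr0.
move=> /eqP; rewrite oppr_eq0 => /eqP h.
by have := congr1 (fun A => p.1 *m A *m invmx p.1) h; rewrite !mulmxA mulmxV // mul1mx mulmxK // mulmx0 mul0mx.
Qed.

End ProductManifold.

(** * Dimension of centralizers *)

Section PolynomialFunctions.
Variables (K : numFieldType) (n : nat).
Local Notation M := 'M[K]_n.

(** Closure rules in place of monomials: by induction, directional derivatives are again of this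
    form and restrictions to lines are univariate polynomials. *)
Inductive polyfun : (M -> K^o) -> Prop :=
| polyfun_cst c : polyfun (cst c)
| polyfun_lin (f : {linear M -> K^o}) : polyfun f
| polyfun_add f g : polyfun f -> polyfun g -> polyfun (f + g)
| polyfun_mul f g : polyfun f -> polyfun g -> polyfun (f * g).

Lemma polyfun_diff F : polyfun F -> exists dF : M -> M -> K^o,
  (forall x, is_diff x F (dF x)) /\ forall v, polyfun (dF^~ v).
Proof.
elim=> [c|f|f g pf [df [h1 h2]] pg [dg [h3 h4]]|f g pf [df [h1 h2]] pg [dg [h3 h4]]].
- exists (fun _ => 0); split=> [x|v]; [exact: is_diff_cst|exact: polyfun_cst].
- exists (fun _ => f); split=> [x|v]; [exact: is_diff_linear_mx|exact: polyfun_cst].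
- exists (fun x => df x + dg x); split=> [x|v]; first exact: is_diffD.
  by have := polyfun_add (h2 v) (h4 v).
- exists (fun x => f x *: dg x + g x *: df x); split=> [x|v]; first exact: is_diffM.
  by have := polyfun_add (polyfun_mul pf (h4 v)) (polyfun_mul pg (h2 v)).
Qed.

Lemma polyfun_line F x v : polyfun F -> exists P : {poly K}, forall s : K, F (x + s *: v) = P.[s].
Proof.
elim=> [c|f|f g pf [p hp] pg [q hq]|f g pf [p hp] pg [q hq]].
- by exists c%:P => s; rewrite hornerC.
- exists ((f x)%:P + (f v)%:P * 'X) => s.
  by rewrite linearD linearZ !hornerE mulrC.
- by exists (p + q) => s; rewrite hornerD -hp -hq.
- by exists (p * q) => s; rewrite hornerM -hp -hq.
Qed.

Lemma is_diff_horner (P : {poly K}) (s : K^o) :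
  is_diff s (horner P : K^o -> K^o) (fun t : K^o => t * P^`().[s] : K^o).
Proof.
elim/poly_ind: P => [|P c IH].
  rewrite deriv0 (_ : horner _ = cst 0); last by apply/funext => t; rewrite horner0.
  apply: (is_diff_eq (is_diff_cst (0 : K^o) s)).
  by apply/funext => t; rewrite /= mulr0.
have -> : (horner (P * 'X + c%:P) : K^o -> K^o) = (horner P : K^o -> K^o) * id + cst c.
  by apply/funext => t; rewrite !hornerE.
apply: (is_diff_eq (is_diffD (is_diffM IH (is_diff_id s)) (is_diff_cst (c : K^o) s))).
apply/funext => t; rewrite derivD derivM derivX derivC !hornerE.
rewrite -[LHS]/(P.[s] * t + s * (t * P^`().[s])).
ring.
Qed.

Lemma polyfun_line_deriv F (dF : M -> M -> K^o) x v (P : {poly K}) : (forall y, is_diff y F (dF y)) ->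
  (forall s : K, F (x + s *: v) = P.[s]) -> forall s : K, dF (x + s *: v) v = P^`().[s].
Proof.
move=> hd hP s.
have h1 := is_diff_comp (is_diff_line x v (s : K^o)) (hd (x + s *: v)).
have e : F \o (fun t : K^o => x + t *: v) = (horner P : K^o -> K^o).
  by apply/funext => t /=; rewrite hP.
rewrite e in h1; have := is_diff_uniq h1 (is_diff_horner P s).
by move/(congr1 (fun f => f 1)) => /=; rewrite scale1r mul1r.
Qed.

(** The hypothesis iterates: all derivatives of [F] in the direction [v] vanish at [x], hence so do
    all coefficients of [F] on the line through [x]. *)
Lemma polyfun_taylor (A : set M) (L : {vspace M}) :
  (forall F dF, polyfun F -> (forall y, is_diff y F (dF y)) -> (forall y, A y -> F y = 0) ->
     forall v y, v \in L -> A y -> dF y v = 0) ->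
  forall F, polyfun F -> (forall y, A y -> F y = 0) ->
  forall x v, A x -> v \in L -> F (x + v) = 0.
Proof.
move=> hA F pF F0 x v Ax vL.
have [P hP] := polyfun_line x v pF.
have step k : exists2 H, polyfun H /\ (forall y, A y -> H y = 0) &
    forall s : K, H (x + s *: v) = P^`(k).[s].
  elim: k => [|k [H [pH H0] hH]]; first by exists F; rewrite ?derivn0.
  have [dH [h1 h2]] := polyfun_diff pH.
  exists (dH^~ v); first by split=> // y Ay; apply: hA.
  by move=> s; rewrite derivnS; apply: polyfun_line_deriv.
have P0 : P = 0.
  apply/polyP => k; rewrite coef0.
  have [H [_ H0] hH] := step k.
  have := hH 0; rewrite scale0r addr0 (H0 _ Ax) horner_coef0 coef_derivn addn0 ffactnn.
  by move/esym/eqP; rewrite mulrn_eq0 -leqn0 leqNgt fact_gt0 /= => /eqP.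
by rewrite -[v]scale1r hP P0 horner0.
Qed.

Lemma polyfun_sum I (r : seq I) (f : I -> M -> K^o) :
  (forall i, polyfun (f i)) -> polyfun (fun y => \sum_(i <- r) f i y).
Proof.
move=> h; elim: r => [|i r IH].
  by rewrite (_ : (fun _ => _) = cst 0); [exact: polyfun_cst|apply/funext => y; rewrite big_nil].
rewrite (_ : (fun _ => _) = f i + (fun y => \sum_(j <- r) f j y)); first exact: polyfun_add.
by apply/funext => y; rewrite big_cons.
Qed.

Lemma polyfun_prod I (r : seq I) (f : I -> M -> K^o) :
  (forall i, polyfun (f i)) -> polyfun (fun y => \prod_(i <- r) f i y).
Proof.
move=> h; elim: r => [|i r IH].
  by rewrite (_ : (fun _ => _) = cst 1); [exact: polyfun_cst|apply/funext => y; rewrite big_nil].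
rewrite (_ : (fun _ => _) = f i * (fun y => \prod_(j <- r) f j y)); first exact: polyfun_mul.
by apply/funext => y; rewrite big_cons.
Qed.

Lemma polyfun_det m (f : M -> 'M[K]_m) :
  (forall i j, polyfun (fun y => f y i j)) -> polyfun (fun y => \det (f y)).
Proof.
move=> h; rewrite /determinant; apply: polyfun_sum => s.
apply: (@polyfun_mul (cst _)); [exact: polyfun_cst|exact: polyfun_prod].
Qed.

Lemma polyfun_comp_linear (f : {linear M -> M}) F : polyfun F -> polyfun (F \o f).
Proof.
elim=> [c|g|g h _ IHg _ IHh|g h _ IHg _ IHh].
- exact: polyfun_cst.
- exact: (polyfun_lin (g \o f : {linear M -> K^o})).
- exact: polyfun_add IHg IHh.
- exact: polyfun_mul IHg IHh.
Qed.

Lemma poly_eq0_of_horner (P : {poly K}) : (forall s, P.[s] = 0) -> P = 0.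
Proof.
move=> h; apply: (@roots_geq_poly_eq0 _ P [seq (i%:R : K) | i <- iota 0 (size P)]).
- by apply/allP => s _; rewrite /root h.
- by rewrite map_inj_uniq ?iota_uniq // => i j /eqP; rewrite eqr_nat => /eqP.
- by rewrite size_map size_iota.
Qed.

(** Density of the set where [H] is nonzero: on the line from [y0] to [y], a product of two
    polynomials vanishes and one factor is nonzero. *)
Lemma polyfun_mul_eq0 (W : {vspace M}) F H y0 : polyfun F -> polyfun H ->
  y0 \in W -> H y0 != 0 -> (forall y, y \in W -> H y != 0 -> F y = 0) ->
  forall y, y \in W -> F y = 0.
Proof.
move=> pF pH hy0 Hy0 h y hy.
have [P hP] := polyfun_line y0 (y - y0) pF.
have [Q hQ] := polyfun_line y0 (y - y0) pH.
have PQ0 : P * Q = 0.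
  apply: poly_eq0_of_horner => s; rewrite hornerM -hP -hQ.
  have [->|Hs] := eqVneq (H (y0 + s *: (y - y0))) 0; first by rewrite mulr0.
  by rewrite h ?mul0r // rpredD ?rpredZ ?rpredB.
have Q0 : Q != 0.
  apply: contraNneq Hy0 => Q0; have := hQ 0.
  by rewrite scale0r addr0 Q0 horner0 => ->.
move/eqP: PQ0; rewrite mulf_eq0 (negbTE Q0) orbF => /eqP P0.
by have := hP 1; rewrite scale1r P0 horner0 addrC subrK.
Qed.

End PolynomialFunctions.

Lemma rank_adm (K : numClosedFieldType) n (L : {vspace 'M[K]_n}) x : brackets_into L L L -> x \in L ->
  (\rank (adm L x) + \dim (centralizer L x))%N = \dim L.
Proof.
move=> hL hx; set Z := centralizer L x.
have ZL v : v \in Z -> v \in L by rewrite mem_centralizer => /andP[].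
pose Q : 'M[K]_(\dim Z, \dim L) := \matrix_i crd L (vbasis Z)`_i.
have rQ : \rank Q = \dim Z.
  apply/eqP; rewrite -[_ == _]/(row_free Q) -kermx_eq0; apply/eqP/row_matrixP => i.
  set w := row i (kermx Q); rewrite row0.
  have wQ : w *m Q = 0 by apply/sub_kermxP/row_sub.
  have : crd L (uncrd w) = 0.
    rewrite -[RHS]wQ mulmx_sum_row /uncrd linear_sum /=; apply: eq_bigr => j _.
    by rewrite rowK linearZ.
  rewrite -(linear0 (crd L)) => /crd_inj -/(_ (ZL _ (uncrd_mem w)) (mem0v _)) w0.
  by rewrite -[w]uncrdK w0 linear0.
rewrite -rQ addnC.
suff -> : (Q :=: kermx (adm L x))%MS by rewrite mxrank_ker subnK // rank_leq_row.
apply/eqmxP/andP; split.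
  apply/row_subP => i; apply/sub_kermxP; rewrite rowK -crd_lb ?ZL ?vbasis_nth_mem //.
  have := vbasis_nth_mem (ltn_ord i); rewrite mem_centralizer => /andP[_ /eqP ->].
  by rewrite linear0.
apply/row_subP => i; set w := row i _.
have w0 : w *m adm L x = 0 by apply/sub_kermxP/row_sub.
have wZ : uncrd w \in Z.
  rewrite mem_centralizer uncrd_mem; apply/eqP/(crd_inj (hL _ _ hx (uncrd_mem w)) (mem0v _)).
  by rewrite crd_lb ?uncrd_mem // uncrdK w0 linear0.
rewrite -[w]uncrdK (coord_vbasis wZ) linear_sum; apply: summx_sub => j _.
by rewrite linearZ scalemx_sub //= (eq_row_sub j) // rowK.
Qed.

Lemma invmx_mulmx (K : fieldType) n (a b : 'M[K]_n) : a \in unitmx -> b \in unitmx ->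
  invmx (a *m b) = invmx b *m invmx a.
Proof.
move=> ua ub; have uab : a *m b \in unitmx by rewrite unitmx_mul ua.
by rewrite -[RHS](mulKmx uab) !mulmxA (mulmxK ub) (mulmxK ua).
Qed.

(** * Tori and the lower bound on dimensions of centralizers *)

Section Torus.
Variables (K : numClosedFieldType) (n : nat) (G : set 'M[K]_n).
Local Notation M := 'M[K]_n.
Hypothesis hG : linear_algebraic_group G.
Local Notation L := (Lie G).
Implicit Types (x y v s t : M).

(** A torus comes without a manifold structure, so linearity of its tangent vectors is not at hand;
    but a nonzero value of [vspace_of] cannot be the default one. *)
Lemma vspace_of_neq0 (A : set M) v : vspace_of A != 0%VS -> v \in vspace_of A -> A v.
Proof.
move=> An0 vA; have [ex|nex] := pselect (exists U : {vspace M}, forall w, w \in U <-> A w).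
  by apply/(xgetPex 0%VS ex).
by case/negP: An0; apply/eqP/xgetPN => U hU; apply: nex; exists U.
Qed.

Lemma rk_torus : (0 < rk G)%N -> exists t : {vspace M}, [/\ \dim t = rk G, (t <= L)%VS &
  exists2 P : M, P \in unitmx & forall v, v \in t -> is_diag_mx (P *m v *m invmx P)].
Proof.
have : rk G = 0%N \/ exists k : 'I_(n * n).+1,
    `[< exists T, [/\ torus T, T `<=` G & \dim (Lie T) = k] >] /\ rk G = k.
  rewrite /rk; apply: (big_ind (fun r => r = 0%N \/ exists k : 'I_(n * n).+1,
    `[< exists T, [/\ torus T, T `<=` G & \dim (Lie T) = k] >] /\ r = k)).
  - by left.
  - move=> a b ha hb; rewrite /maxn; case: ltnP => _; [exact: hb|exact: ha].
  - by move=> k hk; right; exists k.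
move=> [->//|[k [/asboolP[T [[_ _ [P uP hP]] TG dT]] ->]] k0].
have Tn0 : Lie T != 0%VS by rewrite -dimv_eq0 dT -lt0n.
have tT v : v \in Lie T -> tangent T 1%:M v by apply: vspace_of_neq0.
exists (Lie T); split=> //.
  apply/subvP => v /tT[gamma [h1 h2 h3]]; apply/(mem_Lie hG); exists gamma; split=> //.
  by apply: filterS h2 => s [/TG].
exists P => // v /tT/tangentE[gamma [_ gT gd]].
apply/is_diag_mxP => i j ij.
have hd := is_diff_coord i j (is_diff_linear_comp (mulmxr (invmx P)) (is_diff_linear_comp (mulmx P) gd)).
have h0 : \forall s \near (0 : K^o), (P *m gamma s *m invmx P) i j = cst 0 s.
  by apply: filterS gT => s [/hP/is_diag_mxP h _]; apply: h.
have := is_diff_uniq hd (is_diff_near h0 (is_diff_cst (0 : K^o) (0 : K^o))).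
by move/(congr1 (fun f => f 1)); rewrite /= scale1r => ->.
Qed.

Section Generic.
Variables (t : {vspace M}) (P : M).
Hypotheses (tL : (t <= L)%VS) (uP : P \in unitmx)
  (diag : forall v, v \in t -> is_diag_mx (P *m v *m invmx P)).

Local Notation cj v := (P *m v *m invmx P).

(** In the basis diagonalizing the torus, [ad v] acts diagonally on matrix entries, with differences
    of eigenvalues as weights. *)
Lemma cj_lb v y i j : v \in t -> cj (lb v y) i j = (cj v i i - cj v j j) * cj y i j.
Proof.
move=> /diag/is_diag_mxP hv.
have -> : cj (lb v y) = cj v *m cj y - cj y *m cj v.
  by rewrite lbE mulmxBr mulmxBl !mulmxA !(mulmxKV uP).
move: (cj v) (cj y) hv => A B hA.
rewrite mxE [X in _ + X = _]mxE ![(_ *m _) i j]mxE.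
rewrite (bigD1 i) //= big1 ?addr0; last by move=> k ki; rewrite hA ?mul0r // eq_sym.
rewrite (bigD1 j) //= big1 ?addr0; last by move=> k kj; rewrite hA ?mulr0.
by rewrite mulrBl [X in _ - X]mulrC.
Qed.

Lemma cj_inj v y : cj v = cj y -> v = y.
Proof. by move/(congr1 (fun A => invmx P *m A *m P)); rewrite !mulmxA mulVmx // !mul1mx !mulmxKV. Qed.

Lemma lb_torus0P v y : v \in t ->
  lb v y = 0 <-> forall i j, (cj v i i - cj v j j) * cj y i j = 0.
Proof.
move=> vt; split=> [h i j|h]; first by rewrite -cj_lb // h mulmx0 mul0mx mxE.
apply: cj_inj; rewrite mulmx0 mul0mx; apply/matrixP => i j.
by rewrite cj_lb // h mxE.
Qed.

Lemma torus_semisimple v y : v \in t -> lb v (lb v y) = 0 -> lb v y = 0.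
Proof.
move=> vt /(lb_torus0P _ vt) h; apply/(lb_torus0P _ vt) => i j.
have /eqP := h i j; rewrite cj_lb // !mulf_eq0.
by case/or3P => /eqP ->; rewrite ?mul0r ?mulr0.
Qed.

(** Take [t0] with centralizer of minimal dimension. For generic [k], what commutes with t0 + k v
    commutes with both [t0] and [v]; by minimality this is already the whole centralizer of [t0]. *)
Lemma torus_generic : exists2 t0, t0 \in t &
  forall v y, v \in t -> y \in centralizer L t0 -> lb v y = 0.
Proof.
pose Q d := `[< exists2 v, v \in t & \dim (centralizer L v) = d >].
have exQ : exists d, Q d.
  by exists (\dim (centralizer L 0)); apply/asboolP; exists 0; rewrite ?mem0v.
case: (ex_minnP exQ) => d /asboolP[t0 t0t <-] dmin.
exists t0 => // v y vt.
(* These are the values of [k] for which a weight of t0 + k v could vanish by cancellation. A zero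
   denominator only adds the entry 0; that case is treated apart. *)
pose s := [seq - ((cj t0 ij.1 ij.1 - cj t0 ij.2 ij.2) / (cj v ij.1 ij.1 - cj v ij.2 ij.2)) |
  ij <- enum {: 'I_n * 'I_n}].
have [k hk] := nat_far_from s.
pose t1 := t0 + k%:R *: v; have t1t : t1 \in t by rewrite rpredD ?rpredZ.
have cj1 i : cj t1 i i = cj t0 i i + k%:R * cj v i i.
  by rewrite /t1 mulmxDr mulmxDl mxE -scalemxAr -scalemxAl [X in _ + X = _]mxE.
have both w : lb t1 w = 0 -> lb t0 w = 0 /\ lb v w = 0.
  move=> /(lb_torus0P _ t1t) h.
  suff H i j : cj w i j = 0 \/ cj t0 i i - cj t0 j j = 0 /\ cj v i i - cj v j j = 0.
    split; [apply/(lb_torus0P _ t0t) => i j|apply/(lb_torus0P _ vt) => i j];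
    by have [->|[e1 e2]] := H i j; rewrite ?e1 ?e2 ?mulr0 ?mul0r.
  have /eqP := h i j; rewrite !cj1 mulf_eq0 => /orP[/eqP e|/eqP]; last by left.
  have {}e : cj t0 i i - cj t0 j j + k%:R * (cj v i i - cj v j j) = 0 by rewrite -e; ring.
  right; have [v0|v0] := eqVneq (cj v i i - cj v j j) 0.
    by move: e; rewrite v0 mulr0 addr0.
  have /hk : - ((cj t0 i i - cj t0 j j) / (cj v i i - cj v j j)) \in s.
    by apply/mapP; exists (i, j); rewrite ?mem_enum.
  move=> /(_ k (leqnn k))/eqP[]; rewrite -mulNr; apply: (mulIf v0); rewrite divfK //.
  by apply/eqP; rewrite -subr_eq0 -opprD oppr_eq0 e.
have sub10 : (centralizer L t1 <= centralizer L t0)%VS.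
  apply/subvP => w; rewrite !mem_centralizer => /andP[-> /eqP/both[-> _]].
  by rewrite eqxx.
have e10 : centralizer L t1 = centralizer L t0.
  apply/eqP; rewrite -(dimv_leqif_eq sub10) eqn_leq dimvS //=.
  by apply: dmin; apply/asboolP; exists t1.
by rewrite -e10 mem_centralizer => /andP[_ /eqP/both[_ ->]].
Qed.

End Generic.

Lemma conj_lb a x y : a \in unitmx ->
  a *m lb x y *m invmx a = lb (a *m x *m invmx a) (a *m y *m invmx a).
Proof. by move=> ua; rewrite !lbE mulmxBr mulmxBl !mulmxA !(mulmxKV ua). Qed.

Definition conjm a x : M := a *m x *m invmx a.
Lemma conjm_is_linear a : linear (conjm a).
Proof. by move=> c u v; rewrite /conjm mulmxDr mulmxDl -scalemxAr -scalemxAl. Qed.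
HB.instance Definition _ a := GRing.isLinear.Build K M M _ (conjm a) (conjm_is_linear a).

(* The conjugates of the centralizer of the torus are Zariski dense in the Lie algebra:
   a polynomial function vanishing on them has all its derivatives vanishing on them,
   since the conjugation orbits and the centralizer span the tangent space at a
   generic point. *)
Lemma rk_le_dim_centralizer x : x \in L -> (rk G <= \dim (centralizer L x))%N.
Proof.
move=> xL; have [->//|/rk_torus[t [dt tL [P uP diag]]]] := posnP (rk G).
have [t0 t0t gen] := @torus_generic t P uP diag.
have LL := Lie_bracket hG.
have t0L : t0 \in L by apply: (subvP tL).
set C := centralizer L t0 in gen *.
have CL y : y \in C -> y \in L by rewrite mem_centralizer => /andP[].
pose A : set M := [set z | exists a y, [/\ G a, y \in C & z = conjm a y]].
have t0A : A t0.
  exists 1%:M, t0; split; first exact: group1_mem hG.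
    by rewrite mem_centralizer t0L lbxx eqxx.
  by rewrite /conjm invmx1 mulmx1 mul1mx.
pose A0 := adm L t0; pose Kr := kermx A0.
(* To [ad y] is added the projection on the kernel of [ad t0] along its image. Where the
   determinant, polynomial in [y], is nonzero, [L, y] + C is all of L. *)
pose Lam y := adm L y + proj_mx Kr A0.
have cap0 : (Kr :&: A0)%MS = 0.
  apply/eqP; rewrite -submx0; apply/row_subP => i; set w := row i _.
  have : (w <= Kr :&: A0)%MS by apply: row_sub.
  rewrite sub_capmx => /andP[/sub_kermxP wA /submxP[u wu]].
  have uL := uncrd_mem u; have lL := LL _ _ t0L uL.
  have cu : crd L (lb t0 (uncrd u)) = w by rewrite crd_lb ?uncrd_mem // uncrdK wu.
  have : lb t0 (uncrd u) = 0.
    apply: (torus_semisimple uP diag t0t); apply: (crd_inj (LL _ _ t0L lL) (mem0v _)).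
    by rewrite linear0 crd_lb // cu wA.
  by move=> e; rewrite -cu e linear0 sub0mx.
(* As [ad t0] is semisimple, its kernel and image meet trivially, so the two summands of [Lam t0]
   cannot cancel. *)
have Lam0 : \det (Lam t0) != 0.
  rewrite -unitfE -unitmxE -row_free_unit -kermx_eq0; apply/eqP/row_matrixP => i.
  set u := row i _; rewrite row0.
  have : u *m Lam t0 = 0 by apply/sub_kermxP/row_sub.
  rewrite /Lam mulmxDr => /eqP; rewrite addr_eq0 => /eqP e.
  have uA0 : u *m A0 = 0.
    apply/eqP; rewrite -submx0 -cap0 sub_capmx submxMl andbT.
    by rewrite e eqmx_opp proj_mx_sub.
  have : u *m proj_mx Kr A0 = 0 by apply/eqP; rewrite -oppr_eq0 -e uA0.
  by rewrite proj_mx_id //; apply/sub_kermxP.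
have span y v : y \in C -> \det (Lam y) != 0 -> v \in L ->
    exists u w, [/\ u \in L, w \in C & v = lb u y + w].
  rewrite -unitfE -unitmxE => yC unitLam vL.
  pose u := crd L v *m invmx (Lam y).
  have wC : uncrd (u *m proj_mx Kr A0) \in C.
    rewrite mem_centralizer uncrd_mem /=; apply/eqP/(crd_inj (LL _ _ t0L (uncrd_mem _)) (mem0v _)).
    rewrite linear0 crd_lb ?uncrd_mem // uncrdK; apply/sub_kermxP; exact: proj_mx_sub.
  exists (- uncrd u), (uncrd (u *m proj_mx Kr A0)); split; rewrite ?rpredN ?uncrd_mem //.
  have yL := CL _ yC; have uL := uncrd_mem u.
  rewrite lbNl -lbC; apply: (crd_inj vL); first by rewrite rpredD ?LL ?uncrd_mem.
  set c1 := lb y _; set c2 := uncrd _.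
  have -> : crd L (c1 + c2) = crd L c1 + crd L c2 by exact: linearD.
  by rewrite crd_lb // !uncrdK -mulmxDr -/(Lam y) mulmxKV.
pose rho := \rank (adm L x).
pose S := pinvmx (col_base (adm L x)); pose T := pinvmx (row_base (adm L x)).
(* A generalized minor of size [rho]: it equals 1 at [x] by the choice of [S] and [T], and vanishes
   wherever [ad y] has smaller rank. *)
pose F (y : M) : K^o := \det (S *m adm L y *m T).
have pF : polyfun F.
  apply: polyfun_det => i j.
  exact: (polyfun_lin (mx_coord i j \o (mulmxr T \o (mulmx S \o adm L)) : {linear M -> K^o})).
have Fx : F x = 1.
  have e : S *m adm L x *m T = 1%:M.
    have -> : S *m adm L x = S *m (col_base (adm L x) *m row_base (adm L x)).
      by rewrite mulmx_base.
    rewrite mulmxA mulVpmx ?col_base_full // mul1mx.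
    by rewrite mulmxVp // row_base_free.
  by rewrite /F e det1.
rewrite leqNgt; apply/negP => small.
(* An element of [A] commutes with a conjugate of [t], so its [ad] has rank at most dim L - rk(G),
   which is less than [rho] under the assumption to be refuted. *)
have F0 z : A z -> F z = 0.
  move=> [a [y [Ga yC zE]]]; have ua := group_unit hG Ga.
  have yL := CL _ yC; have zL : z \in L by rewrite zE; apply: Lie_conj.
  have dz : (rk G <= \dim (centralizer L z))%N.
    rewrite -dt; have inj : (t :&: lker (linfun (conjm a)))%VS = 0%VS.
      apply/eqP; rewrite -subv0; apply/subvP => v.
      rewrite memv_cap memv_ker lfunE memv0 /= => /andP[_ /eqP e].
      have := congr1 (fun B => invmx a *m B *m a) e.
      by rewrite /conjm !mulmxA mulVmx // mul1mx mulmxKV // mulmx0 mul0mx => ->.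
    rewrite -(limg_dim_eq inj); apply/dimvS/subvP => _ /memv_imgP[v vt ->].
    rewrite lfunE /= mem_centralizer zE -conj_lb // lbC (gen v y) //.
    by rewrite oppr0 mulmx0 mul0mx eqxx andbT; apply/Lie_conj/(subvP tL).
  have rz : (\rank (adm L z) < rho)%N.
    rewrite -(ltn_add2r (\dim (centralizer L x))) rank_adm //.
    by rewrite -[ltnRHS](rank_adm LL zL) ltn_add2l (leq_trans small).
  apply/eqP; rewrite -[_ == 0]negbK -unitfE -unitmxE -row_free_unit; apply/negP => /eqP e.
  have : (\rank (S *m adm L z *m T) <= \rank (adm L z))%N.
    by apply: leq_trans (mxrankM_maxl _ _) (mxrankM_maxr _ _).
  by rewrite e leqNgt rz.
suff : F (t0 + (x - t0)) = 0 by rewrite addrC subrK Fx => /eqP; rewrite oner_eq0.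
apply: (polyfun_taylor (A := A) (L := L)) => //; last by rewrite rpredB.
move=> H dH pH hd H0 v z vL [a [y [Ga yC ->]]].
have ua := group_unit hG Ga; have Ga' := groupV_mem hG Ga.
have [dH' [h1 h2]] := polyfun_diff pH.
have -> : dH = dH' by apply/funext => z'; apply: is_diff_uniq (hd z') (h1 z').
have pHv : polyfun ((dH'^~ v) \o conjm a) by apply: polyfun_comp_linear.
have pL : polyfun (fun z => \det (Lam z) : K^o).
  apply: polyfun_det => i j.
  have -> : (fun z => Lam z i j : K^o) = (mx_coord i j \o adm L : M -> K^o) + cst (proj_mx Kr A0 i j).
    by apply/funext => z'; rewrite /Lam mxE.
  apply: polyfun_add; last exact: polyfun_cst.
  exact: (polyfun_lin (mx_coord i j \o adm L : {linear M -> K^o})).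
have t0C : t0 \in C by rewrite mem_centralizer t0L lbxx eqxx.
(* The derivative at the conjugate of [y] is polynomial in [y], so only those [y] in [C] with
   invertible [Lam y] need be considered. *)
apply: (polyfun_mul_eq0 (W := C) pHv pL t0C Lam0 _ yC) => {}y {}yC detL /=.
pose v' := conjm (invmx a) v.
have v'L : v' \in L by rewrite /v' /conjm; apply: (Lie_conj hG Ga' vL).
have -> : v = conjm a v' by rewrite /v' /conjm invmxK !mulmxA mulmxV // mul1mx mulmxK.
have [u [w [uL wC ->]]] := span y v' yC detL v'L.
rewrite linearD /=.
have -> : dH' (conjm a y) (conjm a (lb u y) + conjm a w) =
    dH' (conjm a y) (conjm a (lb u y)) + dH' (conjm a y) (conjm a w).
  by case: (h1 (conjm a y)) => _ <-; rewrite linearD.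
(* Applied to two curves in [A]: varying the conjugating element yields the bracket part of [v], and
   moving [y] inside [C] yields the rest. *)
have vanish (c dc : K^o -> M) : is_diff (0 : K^o) c dc -> (\forall s \near (0 : K^o), A (c s)) ->
    dH' (c 0) (dc 1) = 0.
  move=> hc cA; have hH := is_diff_comp hc (h1 (c 0)).
  have n0 : \forall s \near (0 : K^o), (H \o c) s = cst 0 s by apply: filterS cA => s /H0.
  have := is_diff_uniq hH (is_diff_near n0 (is_diff_cst (0 : K^o) (0 : K^o))).
  by move/(congr1 (fun f => f 1)).
have [gamma [g0 gG gd]] := tangentE ((mem_Lie hG u).1 uL).
have c1 := is_diff_linear_comp (conjm a) (is_diff_conj g0 gd (is_diff_cst y (0 : K^o))).
have := vanish _ _ c1; rewrite /cst g0 invmx1 mulmx1 mul1mx scale1r.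
rewrite -[(0 : K^o -> M) 1]/(0 : M) addr0 => ->; last first.
  apply: filterS gG => s [Gs _]; exists (a *m gamma s), y; split=> //; first exact: groupM_mem.
  have us := group_unit hG Gs.
  by rewrite -[LHS]/(a *m (gamma s *m y *m invmx (gamma s)) *m invmx a) /conjm invmx_mulmx // !mulmxA.
have c2 := is_diff_linear_comp (conjm a) (is_diff_line y w (0 : K^o)).
have := vanish _ _ c2; rewrite scale0r addr0 scale1r add0r => -> //.
apply: filterE => s; exists a, (y + s *: w); split=> //.
by rewrite rpredD ?rpredZ.
Qed.

End Torus.

(** * Isolated points of orbits *)

Section IsolatedOrbitPoint.
Variables (R : realType) (n : nat).
Local Notation M := 'M[Cx R]_n.
(** A submultiplicative norm with values in [R], where real arithmetic applies. The norm of the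
    identity is left arbitrary, so the estimates on powers must not involve it. *)
Variable N : M -> R.
Hypotheses (N_ge0 : forall A, 0 <= N A) (N_eq0 : forall A, N A = 0 -> A = 0)
  (ND : forall A B, N (A + B) <= N A + N B) (NN : forall A, N (- A) = N A)
  (NZ : forall (k : R) A, 0 <= k -> N (k%:C%C *: A) = k * N A)
  (NM : forall A B, N (A *m B) <= N A * N B).
Implicit Types (A B u v w x y z r : M).

Let NB A B : N (A - B) <= N A + N B.
Proof. by apply: le_trans (ND _ _) _; rewrite NN. Qed.

Let N0 : N 0 = 0.
Proof. by rewrite -[X in N X](scale0r 0) -[0 in X in N (X *: _)]/(0%:C%C) NZ ?mul0r. Qed.

Definition mxpow A k : M := iter k (mulmx A) 1%:M.

Lemma mxpow_comm A x k : A *m x = x *m A -> mxpow A k *m x = x *m mxpow A k.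
Proof.
move=> h; elim: k => [|k IH]; first by rewrite /= mul1mx mulmx1.
by rewrite /= -mulmxA IH !mulmxA h.
Qed.

(** The power (1 + u)^k replaces exp(k u); its second-order remainder obeys D' = D + u D + k u^2,
    which the square bound absorbs as long as k N(u) <= 1. *)
Lemma mxpow_bound u k : k%:R * N u <= 1 ->
  N (mxpow (1%:M + u) k - 1%:M - (k%:R : R)%:C%C *: u) <= (k%:R * N u) ^+ 2.
Proof.
have u0 := N_ge0 u.
elim: k => [|k IH] hk.
  by rewrite /= subrr sub0r NN NZ // !mul0r expr0n.
have k0 : 0 <= k%:R :> R by [].
have hk' : k%:R * N u <= 1 by move: hk; rewrite -natr1; nra.
have {}IH := IH hk'.
set P := mxpow _ k in IH *; set D := P - 1%:M - _ in IH.
have -> : mxpow (1%:M + u) k.+1 - 1%:M - (k.+1%:R : R)%:C%C *: u =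
    D + u *m D + (k%:R : R)%:C%C *: (u *m u).
  rewrite /D /= -/P mulmxDl mul1mx !mulmxBr mulmx1 -scalemxAr -natr1 rmorphD scalerDl rmorph1.
  move: (u *m P) (u *m u) => a b; rewrite scale1r.
  by apply/matrixP => i j; rewrite !mxE; ring.
have h1 : N (u *m D) <= N u * (k%:R * N u) ^+ 2.
  by apply: le_trans (NM _ _) _; rewrite ler_wpM2l.
have h2 : N ((k%:R : R)%:C%C *: (u *m u)) <= k%:R * (N u * N u).
  by rewrite NZ // ler_wpM2l.
apply: le_trans (ND _ _) _; apply: le_trans (lerD (ND _ _) (lexx _)) _.
rewrite -natr1; move: (N D) (N (u *m D)) (N (_ *: _)) IH h1 h2 => d1 d2 d3 IH h1 h2.
move: (k%:R : R) hk' k0 IH h1 h2 => t hk' t0 IH h1 h2.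
have : (t * N u) ^+ 2 * N u <= t * N u * N u.
  by apply: ler_wpM2r => //; rewrite expr2 ler_piMr // mulr_ge0.
have : 0 <= N u * N u by rewrite mulr_ge0.
nra.
Qed.

Lemma mxpow_perturb u r k : 2 * (k%:R * (N u + N r)) <= 1 ->
  N (mxpow (1%:M + u + r) k - mxpow (1%:M + u) k) <= 6 * N r * k%:R.
Proof.
have u0 := N_ge0 u; have r0 := N_ge0 r.
pose b := N u + N r; have b0 : 0 <= b by rewrite addr_ge0.
rewrite -/b => hk.
(* Each step adds at most 3 N(r) and multiplies by 1 + b; the last factor makes the induction close
   and is at most 2, whence the constant 6. *)
suff H : N (mxpow (1%:M + u + r) k - mxpow (1%:M + u) k) <= 3 * N r * k%:R * (1 + 2 * (k%:R * b)).
  apply: le_trans H _; have t0 : 0 <= 3 * N r * k%:R by rewrite !mulr_ge0.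
  have -> : 6 * N r * k%:R = (3 * N r * k%:R) * 2 by ring.
  by rewrite ler_wpM2l //; lra.
elim: k hk => [|k IH] hk; first by rewrite subrr N0 !(mulr0, mul0r).
have k0 : 0 <= k%:R :> R by [].
have hk' : 2 * (k%:R * b) <= 1 by move: hk; rewrite -natr1; nra.
have {}IH := IH hk'.
set A := 1%:M + u in IH *; set D := _ - _ in IH.
(* The product r A^k is expanded around [r], which keeps the norm of the identity out of the
   bound. *)
have -> : mxpow (A + r) k.+1 - mxpow A k.+1 = D + (u + r) *m D +
    (r + r *m (mxpow A k - 1%:M - (k%:R : R)%:C%C *: u) + (k%:R : R)%:C%C *: (r *m u)).
  rewrite /D /= /A -/A; move: (mxpow (A + r) k) (mxpow A k) => p q.
  rewrite /A !mulmxDl !mulmxDr !mul1mx !mulmxN mulmx1 -scalemxAr.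
  move: (u *m p) (u *m q) (r *m p) (r *m q) (r *m u) => a1 a2 a3 a4 a5.
  by apply/matrixP => i j; rewrite !mxE; ring.
have ku : k%:R * N u <= 1.
  have := hk'; rewrite /b; have : 0 <= k%:R * N u by rewrite mulr_ge0.
  have : 0 <= k%:R * N r by rewrite mulr_ge0.
  by rewrite mulrDr; lra.
have h1 : N ((u + r) *m D) <= b * N D.
  by apply: le_trans (NM _ _) _; rewrite ler_wpM2r.
have h2 : N (r *m (mxpow A k - 1%:M - (k%:R : R)%:C%C *: u)) <= N r * 1.
  apply: le_trans (NM _ _) _; rewrite ler_wpM2l //.
  apply: le_trans (mxpow_bound ku) _.
  by rewrite expr_le1 // mulr_ge0.
have h3 : N ((k%:R : R)%:C%C *: (r *m u)) <= N r.
  rewrite NZ //; apply: le_trans (ler_wpM2l k0 (NM _ _)) _.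
  by rewrite mulrCA mulrC; move: ku; move: (k%:R * N u) => t ht; nra.
apply: le_trans (ND _ _) _.
apply: le_trans (lerD (ND _ _) (le_trans (ND _ _) (lerD (ND _ _) (lexx _)))) _.
have D0 := N_ge0 D.
move: (N ((u + r) *m D)) (N (r *m _)) (N (_ *: _)) h1 h2 h3 => d1 d2 d3 h1 h2 h3.
have {h1 h2 h3} : N D + d1 + (N r + d2 + d3) <= (1 + b) * N D + 3 * N r by nra.
move=> /le_trans; apply.
have : (1 + b) * N D <= (1 + b) * (3 * N r * k%:R * (1 + 2 * (k%:R * b))).
  by rewrite ler_wpM2l // addr_ge0.
move=> h; apply: le_trans (lerD h (lexx _)) _ => {h IH}.
rewrite -[k.+1%:R]natr1; move: (k%:R : R) (N r) k0 r0 hk' {hk ku} => t s t0 s0 hk'.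
have -> : (1 + b) * (3 * s * t * (1 + 2 * (t * b))) + 3 * s =
  3 * s * ((1 + b) * (t * (1 + 2 * (t * b))) + 1) by ring.
rewrite -[leRHS]mulrA ler_wpM2l ?mulr_ge0 //.
have tb0 : 0 <= t * b by rewrite mulr_ge0.
have tb : t * b * (2 * (t * b)) <= t * b by rewrite ler_piMr.
nra.
Qed.

Variables (G : set M) (L : {vspace M}).
Hypotheses (G1 : G 1%:M) (GM : forall a b, G a -> G b -> G (a *m b)).
(** First-order contact of [G] and 1 + L at the identity, in both directions: points of [G] lie near
    1 + L, and rays of L are approximated in [G]. *)
Hypothesis G_near : forall e, 0 < e -> exists2 d, 0 < d & forall a, G a -> N (a - 1%:M) < d ->
  exists2 w, w \in L & N (a - 1%:M - w) <= e * N (a - 1%:M).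
Hypothesis G_curve : forall y, y \in L -> forall e, 0 < e -> exists2 d, 0 < d &
  forall s, 0 < s < d -> exists2 g, G g & N (g - 1%:M - s%:C%C *: y) <= e * s.

(* Elements of the group close to [exp y], without exponentials: [E] is (1 + y/m)^m,
   and [e] is the m-th power of a point of a curve of velocity [y]. *)
Lemma approx_exp y t : y \in L -> N y <= 4^-1 -> 0 < t -> exists e E,
  [/\ G e, N (e - E) <= t, N (E - 1%:M - y) <= N y ^+ 2 & forall x, y *m x = x *m y -> E *m x = x *m E].
Proof.
(* The bound t/6 offsets the constant of [mxpow_perturb]; 1/4, together with N(y) <= 1/4, gives its
   smallness hypothesis. *)
move=> yL y4 t0; pose e := Num.min (t / 6) 4^-1.
have e0 : 0 < e by rewrite lt_min divr_gt0 //= invr_gt0.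
have [et e4] : e <= t / 6 /\ e <= 4^-1 by split; rewrite ge_min lexx ?orbT.
have [d d0 hd] := G_curve yL e0.
pose m := (Num.bound (d^-1)).+1; pose s : R := m%:R^-1.
have m0 : 0 < m%:R :> R by rewrite ltr0n.
have s0 : 0 < s by rewrite invr_gt0.
have sd : s < d.
  rewrite /s -[d]invrK ltf_pV2 ?posrE ?invr_gt0 //.
  apply: lt_trans (archi_boundP _) _; first by rewrite invr_ge0 ltW.
  by rewrite ltr_nat.
have [|g Gg hg] := hd s; first by rewrite s0.
pose u : M := s%:C%C *: y; pose r := g - 1%:M - u.
have Nu : N u = s * N y by rewrite /u NZ // ltW.
have ms : m%:R * s = 1 by rewrite mulfV // gt_eqF.
have mu : m%:R * N u = N y by rewrite Nu mulrA ms mul1r.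
have mr : m%:R * N r <= e.
  by apply: le_trans (ler_wpM2l (ltW m0) hg) _; rewrite mulrCA ms mulr1.
have gE : g = 1%:M + u + r by rewrite /r; apply/matrixP => i j; rewrite !mxE; ring.
exists (mxpow g m), (mxpow (1%:M + u) m); split.
- by elim: m {s m0 s0 sd hg u r Nu ms mu mr gE} => //= k IH; apply: GM.
- rewrite gE; apply: le_trans (mxpow_perturb _) _.
    by rewrite mulrDr mu; lra.
  by rewrite -mulrA [N r * _]mulrC; lra.
- have -> : y = (m%:R : R)%:C%C *: u by rewrite /u scalerA -rmorphM ms rmorph1 scale1r.
  have := @mxpow_bound u m; rewrite mu NZ ?(ltW m0) // mu; apply; lra.
- move=> x yx; apply: mxpow_comm.
  by rewrite mulmxDl mulmxDr mul1mx mulmx1 -scalemxAl -scalemxAr yx.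
Qed.

Variables (x0 : M) (q : R).
Hypothesis q_gt0 : 0 < q.
Hypothesis ad_bound : forall w, w \in L ->
  exists y, [/\ y \in L, lb y x0 = 0 & N (w - y) <= q * N (lb w x0)].

(** The tolerance [t] is there because group elements approximate exponentials only up to an error.
    The radius [rho] does not depend on it, so the step can be iterated without passing to a
    limit. *)
Definition almost_conj z rho := forall t, 0 < t -> exists a,
  [/\ G a, N (a - 1%:M) <= rho & N (a *m x0 - (x0 + z) *m a) <= t].

Let Nlb A B : N (lb A B) <= 2 * N A * N B.
Proof.
apply: le_trans (NB _ _) _; apply: le_trans (lerD (NM _ _) (NM _ _)) _.
by rewrite [N B * _]mulrC -mulrA mulr_natl mulr2n.
Qed.

Lemma almost_conj_ad z a w t : N (a - 1%:M) <= 1 -> N (a *m x0 - (x0 + z) *m a) <= t ->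
  N (z - lb w x0) <= 2 * N (a - 1%:M - w) * N x0 + N z * N (a - 1%:M) + t.
Proof.
move=> a1 ht.
have -> : z - lb w x0 = lb (a - 1%:M - w) x0 - z *m (a - 1%:M) - (a *m x0 - (x0 + z) *m a).
  rewrite /lb !(mulmxBl, mulmxBr, mulmxDl, mul1mx, mulmx1).
  move: (a *m x0) (x0 *m a) (w *m x0) (x0 *m w) (z *m a) => p1 p2 p3 p4 p5.
  by apply/matrixP => i j; rewrite !mxE; ring.
apply: le_trans (NB _ _) _; apply: lerD => //.
by apply: le_trans (NB _ _) _; apply: lerD.
Qed.

(* Multiplying [a] by an approximation of [exp (- y)], where [y] centralizes [x0] and
   [a] is close to [1 + y] up to [N z], halves its distance to 1 modulo [N z]. *)
Lemma almost_conj_step z e d rho : 0 < N z -> 0 < e -> e * (2 * q * N x0 + 1) <= 8^-1 ->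
  (forall a, G a -> N (a - 1%:M) < d ->
    exists2 w, w \in L & N (a - 1%:M - w) <= e * N (a - 1%:M)) ->
  0 <= rho -> rho < d -> rho <= 32^-1 -> 3 * rho + 3 * (q * N z) <= 32^-1 ->
  almost_conj z rho -> almost_conj z (rho / 2 + (4 * q + 2) * N z).
Proof.
move=> z0 e0 he hd rho0 rd rho32 hz hP t t0.
have X0 := N_ge0 x0; have B0 := N_ge0 1%:M; pose B := N 1%:M + 1.
have Bp : 0 < B by rewrite /B ltr_wpDl.
have X1 : 0 < N x0 + 1 by rewrite ltr_wpDl.
(* Half of the tolerance goes to [a], the other half to the approximate exponential through [t2];
   [B] bounds the norms of both factors. The caps by N(z) let the errors be absorbed there. *)
pose t1 := Num.min (N z) (t / (2 * B)).
have t10 : 0 < t1 by rewrite lt_min z0 divr_gt0 ?mulr_gt0.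
have [t1z t1t] : t1 <= N z /\ t1 <= t / (2 * B) by split; rewrite ge_min lexx ?orbT.
pose t2 := Num.min (Num.min (N z) 4^-1) (t / (4 * B * (N x0 + 1))).
have t20 : 0 < t2 by rewrite !lt_min z0 invr_gt0 ltr0n divr_gt0 ?mulr_gt0.
have [t2z t24 t2t] : [/\ t2 <= N z, t2 <= 4^-1 & t2 <= t / (4 * B * (N x0 + 1))].
  by split; rewrite !ge_min lexx ?orbT.
have [a [Ga ha hx]] := hP t1 t10.
have ha1 : N (a - 1%:M) <= 1 by lra.
have a0 := N_ge0 (a - 1%:M).
have [w wL hw] := hd a Ga (le_lt_trans ha rd).
set r := a - 1%:M - w in hw.
have Nr : N r <= e * rho by apply: le_trans hw _; rewrite ler_wpM2l // ltW.
have Nlw : N (lb w x0) <= 3 * N z + 2 * (e * rho) * N x0.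
  have -> : lb w x0 = z - (z - lb w x0) by rewrite opprB addrC subrK.
  apply: le_trans (NB _ _) _.
  have := almost_conj_ad w ha1 hx; rewrite -/r => h.
  have h2 : N r * N x0 <= e * rho * N x0 by rewrite ler_wpM2r.
  have h3 : N z * N (a - 1%:M) <= N z * 32^-1 by rewrite ler_wpM2l ?(le_trans ha) // ltW.
  rewrite -mulrA in h; lra.
have [y [yL yx wy]] := ad_bound wL.
(* The smallness of [e] is used here; the subtracted term leaves room for the remainder [r], of norm
   at most e rho. *)
have {Nlw}wy : N (w - y) <= 3 * (q * N z) + 8^-1 * rho - e * rho.
  apply: le_trans wy _; apply: le_trans (ler_wpM2l (ltW q_gt0) Nlw) _.
  have := ler_wpM2r rho0 he.
  have -> : e * (2 * q * N x0 + 1) * rho = q * (2 * (e * rho) * N x0) + e * rho by ring.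
  rewrite [q * (_ + _)]mulrDr [q * (3 * _)]mulrCA -addrA lerD2l lerBrDr.
  exact: le_trans.
have er0 : 0 <= e * rho by rewrite mulr_ge0 // ltW.
have Ny : N y <= 3 * rho + 3 * (q * N z).
  have -> : y = (a - 1%:M) - r - (w - y).
    by rewrite /r; apply/matrixP => i j; rewrite !mxE; ring.
  apply: le_trans (NB _ _) _; apply: le_trans (lerD (NB _ _) (lexx _)) _; lra.
have y0 := N_ge0 y.
have qz0 : 0 <= q * N z by rewrite mulr_ge0 ?ltW.
have [||e' [E [Ge' he' hE cE]]] := @approx_exp (- y) t2 _ _ t20; rewrite ?rpredN ?NN //.
  lra.
rewrite NN opprK in hE.
have {}cE : lb E x0 = 0.
  apply/eqP; rewrite subr_eq0; apply/eqP; apply: cE.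
  by rewrite mulNmx mulmxN; congr (- _); apply/eqP; rewrite -subr_eq0; apply/eqP.
have y2 : N y ^+ 2 <= 32^-1 * N y by rewrite expr2 ler_wpM2r //; lra.
have Ne1 : N (e' - 1%:M) <= t2 + 32^-1 * N y + N y.
  have -> : e' - 1%:M = (e' - E) + (E - 1%:M + y) - y.
    by apply/matrixP => i j; rewrite !mxE; ring.
  apply: le_trans (NB _ _) _; apply: le_trans (lerD (ND _ _) (lexx _)) _; lra.
exists (a *m e'); split; first exact: GM.
  (* The first-order parts of [a] and e' cancel up to w - y. The remaining multiples of [rho],
     roughly 3/32, 1/8 and 1/10, add up to less than 1/2. *)
  have -> : a *m e' - 1%:M = (e' - E) + (E - 1%:M + y) + (w - y) + r + (a - 1%:M) *m (e' - 1%:M).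
    rewrite /r mulmxBl mulmxBr mulmx1 mul1mx; move: (a *m e') => p.
    by apply/matrixP => i j; rewrite !mxE; ring.
  apply: le_trans (ND _ _) _; apply: le_trans (lerD (ND _ _) (NM _ _)) _.
  apply: le_trans (lerD (lerD (ND _ _) (lexx _)) (lexx _)) _.
  apply: le_trans (lerD (lerD (lerD (ND _ _) (lexx _)) (lexx _)) (lexx _)) _.
  have : N (a - 1%:M) * N (e' - 1%:M) <= 32^-1 * (t2 + 32^-1 * N y + N y).
    by apply: ler_pM => //; apply: le_trans ha _.
  rewrite mulrDl -mulrA; lra.
have -> : a *m e' *m x0 - (x0 + z) *m (a *m e') =
    a *m lb (e' - E) x0 + (a *m x0 - (x0 + z) *m a) *m e'.
  have -> : lb (e' - E) x0 = lb e' x0 by rewrite -[RHS]subr0 -cE lbBl.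
  by rewrite /lb mulmxBl !mulmxBr -!mulmxA addrA subrK.
have Na : N a <= B.
  by rewrite -[a](subrK 1%:M) addrC; apply: le_trans (ND _ _) _; rewrite lerD2l.
have Ne : N e' <= B.
  by rewrite -[e'](subrK 1%:M) addrC; apply: le_trans (ND _ _) _; rewrite lerD2l; lra.
apply: le_trans (ND _ _) _; apply: le_trans (lerD (NM _ _) (NM _ _)) _.
have h1 : N a * N (lb (e' - E) x0) <= B * (2 * t2 * (N x0 + 1)).
  apply: ler_pM => //; apply: le_trans (Nlb _ _) _; apply: ler_pM; rewrite ?mulr_ge0 ?ler_wpM2l //; lra.
have h2 : N (a *m x0 - (x0 + z) *m a) * N e' <= t / (2 * B) * B.
  by apply: ler_pM => //; apply: le_trans hx _.
have h3 : t / (2 * B) * B = t / 2 by field; rewrite gt_eqF.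
have h4 : B * (2 * t2 * (N x0 + 1)) <= t / 2.
  have c0 : 0 < 4 * B * (N x0 + 1) by rewrite !mulr_gt0.
  have -> : B * (2 * t2 * (N x0 + 1)) = t2 * (4 * B * (N x0 + 1)) / 2 by field.
  by rewrite ler_pM2r // -ler_pdivlMr.
by apply: le_trans (lerD (le_trans h1 h4) h2) _; rewrite h3 -splitr.
Qed.

Variables (Zs : set M) (c : R).
Hypotheses (c_gt0 : 0 < c)
  (transverse : forall z w, Zs z -> w \in L -> N z <= c * N (z - lb w x0)).

Let le_twice (s b t : R) : s <= b + t -> b <= s * 2^-1 -> s <= 2 * t.
Proof. by move=> h1 h2; lra. Qed.

(* Iterating the previous step, one may take [a - 1] of the order of [N z]; then [z] is
   [lb w x0] up to a small multiple of [N z], which contradicts transversality. *)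
Lemma orbit_isolated : exists2 d, 0 < d & forall a z, G a -> Zs z ->
  N (a - 1%:M) < d -> a *m x0 = (x0 + z) *m a -> z = 0.
Proof.
have X0 := N_ge0 x0; set X := N x0 in X0.
(* The recursion rho -> rho/2 + C N(z) has the fixed point 2 C N(z); the extra 1 in [D] absorbs the
   geometric remainder. *)
have [C CE] : exists C, C = 4 * q + 2 by exists (4 * q + 2).
have [D DE] : exists D, D = 2 * C + 1 by exists (2 * C + 1).
have C0 : 0 < C by rewrite CE addr_gt0 // mulr_gt0.
have D0 : 0 < D by rewrite DE addr_gt0 // mulr_gt0.
(* The first bound is the hypothesis of the halving step; the second makes the final linearization
   error at most a quarter of N(z). *)
pose e := Num.min (8 * (2 * q * X + 1))^-1 (8 * c * (D * X + 1))^-1.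
have qX0 : 0 <= q * X by rewrite mulr_ge0 // ltW.
have DX0 : 0 <= D * X by rewrite mulr_ge0 // ltW.
have e1p : 0 < 8 * (2 * q * X + 1) by rewrite -mulrA; lra.
have e2p : 0 < 8 * c * (D * X + 1) by rewrite !mulr_gt0 //; lra.
have e0 : 0 < e by rewrite lt_min !invr_gt0 e1p.
have he1 : e * (2 * q * X + 1) <= 8^-1.
  have : e <= (8 * (2 * q * X + 1))^-1 by rewrite ge_min lexx.
  by rewrite -[_^-1]mul1r ler_pdivlMr //; move: (2 * q * X + 1) => s; lra.
have he2 : c * (2 * (e * D * X)) <= 4^-1.
  have : e <= (8 * c * (D * X + 1))^-1 by rewrite ge_min lexx orbT.
  rewrite -[_^-1]mul1r ler_pdivlMr //.
  have : 0 <= e * c by rewrite mulr_ge0 // ltW.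
  have -> : c * (2 * (e * D * X)) = 2 * (e * c * (D * X)) by ring.
  have -> : e * (8 * c * (D * X + 1)) = 8 * (e * c * (D * X)) + 8 * (e * c) by ring.
  by move: (e * c * (D * X)) (e * c) => p1 p2; lra.
have [d d0 hd] := G_near e0.
(* Three times 1/192 is 1/64, half of the 1/32 allowed by the halving step; [qz] supplies the other
   half. *)
pose d1 := Num.min (d / 2) 192^-1.
have d10 : 0 < d1 by rewrite lt_min divr_gt0 //= invr_gt0.
have [d1d d1s] : d1 < d /\ d1 <= 192^-1.
  split; last by rewrite ge_min lexx orbT.
  by apply: (@le_lt_trans _ _ (d / 2)); [rewrite ge_min lexx|lra].
pose k := 4 * X + 1; have k0 : 0 < k by rewrite /k; lra.
(* [N z <= k * d2] for the [z] of the conclusion; the four bounds on [d2] make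
   [2 C N z], [q N z] and [c D N z] small against [d1] and 1. *)
pose d2 := Num.min (d1 / 2) (Num.min (d1 / (4 * C * k)) (Num.min (192 * q * k)^-1 (4 * c * D * k)^-1)).
have d20 : 0 < d2.
  by rewrite !lt_min !divr_gt0 ?invr_gt0 //= ?mulr_gt0.
have [d2a d2b d2c d2d] : [/\ d2 <= d1 / 2, d2 <= d1 / (4 * C * k), d2 <= (192 * q * k)^-1 & d2 <= (4 * c * D * k)^-1].
  by split; rewrite !ge_min lexx ?orbT.
have d2h : d2 <= 2^-1 by lra.
have {}d2b : 4 * C * (k * d2) <= d1.
  by move: d2b; rewrite ler_pdivlMr ?mulr_gt0 // mulrC mulrA.
have {}d2c : 192 * q * (k * d2) <= 1.
  by move: d2c; rewrite -[_^-1]mul1r ler_pdivlMr ?mulr_gt0 // mulrC mulrA.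
have {}d2d : 4 * c * D * (k * d2) <= 1.
  by move: d2d; rewrite -[_^-1]mul1r ler_pdivlMr ?mulr_gt0 // mulrC mulrA.
exists d2 => // a z Ga Zz ha hz; apply: N_eq0; apply/eqP; apply/negP => /negP nz.
have z0 : 0 < N z by rewrite lt0r nz N_ge0.
have za : N z <= k * d2.
  have h1 : N (a - 1%:M) <= 1 by lra.
  have h2 : N (a *m x0 - (x0 + z) *m a) <= 0 by rewrite hz subrr N0.
  have := almost_conj_ad (a - 1%:M) h1 h2; rewrite subrr N0.
  rewrite addr0 mulr0 mul0r add0r => h3.
  have h4 : N z <= N (z - lb (a - 1%:M) x0) + N (lb (a - 1%:M) x0).
    by rewrite -[X in N X <= _](subrK (lb (a - 1%:M) x0)); apply: ND.
  have h5 : N z * N (a - 1%:M) <= N z * 2^-1 by rewrite ler_wpM2l ?(ltW z0) // ltW // (lt_le_trans ha).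
  have h6 : N (lb (a - 1%:M) x0) <= 2 * d2 * X.
    by apply: le_trans (Nlb _ _) _; rewrite ler_wpM2r // ler_wpM2l // ltW.
  apply: le_trans (le_twice h4 (le_trans h3 h5)) _.
  apply: le_trans (ler_wpM2l _ h6) _ => //.
  have -> : 2 * (2 * d2 * X) = k * d2 - d2 by rewrite /k; ring.
  by rewrite gerBl ltW.
have Cz : 2 * C * N z <= d1 / 2.
  have : C * N z <= C * (k * d2) by rewrite ler_wpM2l // ltW.
  by lra.
have qz : 3 * (q * N z) <= 64^-1.
  have : q * N z <= q * (k * d2) by rewrite ler_wpM2l // ltW.
  by lra.
have cz : c * (N z * (D * N z)) <= 4^-1 * N z.
  have : c * D * N z <= c * D * (k * d2) by rewrite ler_wpM2l // ltW // mulr_gt0.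
  have -> : c * (N z * (D * N z)) = N z * (c * D * N z) by ring.
  by move=> h; rewrite [4^-1 * _]mulrC ler_wpM2l ?(ltW z0) //; lra.
have p2 i : d1 / 2 ^+ i.+1 <= d1 / 2.
  by rewrite ler_pM2l // lef_pV2 ?posrE ?exprn_gt0 // -[leLHS]expr1 ler_weXn2l // ler1n.
have almost j : almost_conj z (2 * C * N z + d1 / 2 ^+ j.+1).
  elim: j => [|j IH].
    move=> t t0; exists a; split=> //; last by rewrite hz subrr N0 ltW.
    have Cz1 : 0 < C * N z by rewrite mulr_gt0.
    rewrite expr1.
    lra.
  set rho := _ + _ in IH; have p2j := p2 j.
  have p20 : 0 < d1 / 2 ^+ j.+1 by rewrite divr_gt0 ?exprn_gt0.
  have -> : 2 * C * N z + d1 / 2 ^+ j.+2 = rho / 2 + (4 * q + 2) * N z.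
    rewrite /rho -CE [2 ^+ j.+2]exprS invfM; lra.
  have rho0 : 0 <= rho by rewrite /rho -mulrA addr_ge0 ?mulr_ge0 ?ltW.
  have rho1 : rho <= d1 by rewrite [leRHS]splitr lerD.
  have rho2 := le_trans rho1 d1s.
  apply: (almost_conj_step z0 e0 he1 hd) => //; first exact: le_lt_trans d1d.
    by apply: le_trans rho2 _; rewrite lef_pV2 ?posrE ?ler_nat.
  have -> : 32^-1 = 3 * 192^-1 + 64^-1 :> R by field.
  by rewrite lerD // ler_wpM2l.
(* Enough halvings to bring the geometric remainder below N(z). *)
pose j := Num.bound (d1 / Num.min (N z) d1).
have m0 : 0 < Num.min (N z) d1 by rewrite lt_min z0.
have hj : d1 / 2 ^+ j.+1 <= Num.min (N z) d1.
  rewrite ler_pdivrMr ?exprn_gt0 // -ler_pdivrMl // mulrC.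
  apply: ltW; apply: lt_trans (archi_boundP _) _; first by rewrite divr_ge0 ?ltW.
  rewrite -[_%:R]/(j%:R) -natrX ltr_nat.
  by apply: ltn_trans (ltn_expl j (isT : (1 < 2)%N)) _; rewrite ltn_exp2l.
have [hjz hjd] : d1 / 2 ^+ j.+1 <= N z /\ d1 / 2 ^+ j.+1 <= d1 / 2.
  split; first by apply: le_trans hj _; rewrite ge_min lexx.
  exact: p2.
have t0 : 0 < N z / (4 * c) by rewrite divr_gt0 // mulr_gt0.
have [b [Gb hb hbz]] := almost j _ t0.
have hbD : N (b - 1%:M) <= D * N z by rewrite DE mulrDl mul1r; apply: le_trans hb _; rewrite lerD2l.
have hbd : N (b - 1%:M) <= d1.
  by apply: le_trans hb _; rewrite [leRHS]splitr lerD.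
have hb1 : N (b - 1%:M) < d by exact: le_lt_trans d1d.
have [w wL hw] := hd b Gb hb1.
have hb2 : N (b - 1%:M) <= 1.
  by apply: le_trans hbd (le_trans d1s _); rewrite invf_le1 ?ler1n.
have h1 := almost_conj_ad w hb2 hbz; rewrite -/X -[2 * _ * X]mulrA in h1.
have h2 := transverse Zz wL.
have h3 : N (b - 1%:M - w) * X <= e * (D * N z) * X.
  by rewrite ler_wpM2r //; apply: le_trans hw _; rewrite ler_wpM2l // ltW.
have h4 : N z * N (b - 1%:M) <= N z * (D * N z) by rewrite ler_wpM2l // ltW.
have h5 : N z <= c * (2 * (e * (D * N z) * X) + N z * (D * N z) + N z / (4 * c)).
  by apply: le_trans h2 _; rewrite ler_wpM2l ?(ltW c_gt0) //; lra.
have h6 : c * (2 * (e * D * X)) * N z <= 4^-1 * N z by rewrite ler_wpM2r // ltW.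
(* Three terms, each at most a quarter of N(z), bound N(z), which contradicts N(z) > 0. *)
move: h5; rewrite !mulrDr.
have -> : c * (2 * (e * (D * N z) * X)) = c * (2 * (e * D * X)) * N z by ring.
have -> : c * (N z / (4 * c)) = N z / 4 by field; rewrite gt_eqF.
lra.
Qed.

End IsolatedOrbitPoint.

(** * Boundedness of the matrix product *)

Section MatrixBounds.
Variables (K : numFieldType) (n : nat).
Local Notation M := 'M[K]_n.

Lemma mulmx_bound : exists2 c : K, 0 < c & forall A B : M, `|A *m B| <= c * `|A| * `|B|.
Proof.
have /choice[c hc] (p : 'I_n * 'I_n) : exists c : K,
    0 <= c /\ forall A B : M, `|A p.1 p.2 *: (delta_mx p.1 p.2 *m B)| <= c * `|A| * `|B|.
  have [k k0 hk] := linear_lipschitz (@linear_mx_continuous K n n _ (mx_coord p.1 p.2)).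
  have [l l0 hl] := linear_lipschitz (@linear_mx_continuous K n n _ (mulmx (delta_mx p.1 p.2 : M))).
  exists (k * l); split=> [|A B]; first by rewrite mulr_ge0 ?ltW.
  have -> : k * l * `|A| * `|B| = k * `|A| * (l * `|B|) by rewrite mulrACA mulrA.
  by rewrite normrZ; apply: ler_pM; rewrite ?normr_ge0 //; [apply: hk|apply: hl].
have S0 : 0 <= \sum_p c p by apply: sumr_ge0 => p _; have [] := hc p.
exists (1 + \sum_p c p) => [|A B]; first by rewrite ltr_pwDl.
rewrite {1}[A]matrix_sum_delta mulmx_suml.
apply: (@le_trans _ _ (\sum_p c p * `|A| * `|B|)).
  under eq_bigr do rewrite mulmx_suml.
  rewrite pair_big /=; apply: le_trans (ler_norm_sum _ _ _) _; apply: ler_sum => p _.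
  by rewrite -scalemxAl; have [_] := hc p.
by rewrite -!mulr_suml -!mulrA ler_wpM2r ?mulr_ge0 // lerDr ler01.
Qed.

End MatrixBounds.

(** * Isolated orbit points for the group and its slice *)

Section LocalInjectivity.
Variables (R : realType) (n : nat) (G : set 'M[Cx R]_n).
Local Notation K := (Cx R).
Local Notation M := 'M[K]_n.
Local Notation L := (Lie G).
Hypothesis hG : linear_algebraic_group G.

(** The matrix norm takes its values in [Cx R]; they are nonnegative reals, so the real part loses
    nothing. Rescaled by the constant of [mulmx_bound], it becomes submultiplicative. *)
Let nm (A : M) : R := complex.Re `|A|.

Let nmE A : (nm A)%:C%C = `|A| :> K.
Proof. by rewrite /nm RRe_real // ger0_real. Qed.

Let leC (s t : R) : (s%:C%C <= t%:C%C :> K) = (s <= t). Proof. exact: lecR. Qed.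
Let ltC (s t : R) : (s%:C%C < t%:C%C :> K) = (s < t). Proof. exact: ltcR. Qed.
Let CM (s t : R) : (s * t)%:C%C = s%:C%C * t%:C%C :> K. Proof. exact: rmorphM. Qed.
Let CD (s t : R) : (s + t)%:C%C = s%:C%C + t%:C%C :> K. Proof. exact: rmorphD. Qed.

Let C_inj : injective (fun t : R => t%:C%C : K). Proof. by move=> s t []. Qed.

Lemma real_gt0C (r : K) : 0 < r -> exists2 s : R, 0 < s & r = s%:C%C.
Proof.
move=> r0; have rE : (complex.Re r)%:C%C = r by rewrite RRe_real // gtr0_real.
by exists (complex.Re r) => //; rewrite -ltC rE.
Qed.

Lemma linear_nm_bound (f : {linear M -> M}) : exists2 k : R, 0 < k & forall A, nm (f A) <= k * nm A.
Proof.
have [k /real_gt0C[s s0 ->] hk] := linear_lipschitz (@linear_mx_continuous K n n _ f).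
by exists s => // A; rewrite -leC CM !nmE; apply: hk.
Qed.

Lemma near_nm (P : M -> Prop) (x : M) : (\forall a \near x, P a) ->
  exists2 d : R, 0 < d & forall a, nm (a - x) < d -> P a.
Proof.
move/nbhs_normP => [d /= /real_gt0C[s s0 ->] hd]; exists s => // a ha.
by apply: hd => /=; rewrite /ball_ /= distrC -nmE ltC.
Qed.

Lemma slice_locally_injective x0 (Zs : {vspace M}) : x0 \in L ->
  (forall z, z \in Zs -> z \in (adl x0 @: L)%VS -> z = 0) ->
  \forall a \near (1%:M : M), G a -> forall z, z \in Zs -> a *m x0 = (x0 + z) *m a -> z = 0.
Proof.
move=> x0L hZ; have [c /real_gt0C[s s0 ->] hc] := mulmx_bound K n.
pose N A := s * nm A.
have nm0 A : 0 <= nm A by rewrite -leC nmE normr_ge0.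
have N_ge0 A : 0 <= N A by rewrite mulr_ge0 // ltW.
have N_eq0 A : N A = 0 -> A = 0.
  move/eqP; rewrite mulf_eq0 (gt_eqF s0) /= => /eqP h.
  by apply/eqP; rewrite -normr_eq0 -nmE h.
have ND A B : N (A + B) <= N A + N B.
  by rewrite -mulrDr ler_wpM2l ?(ltW s0) // -leC CD !nmE ler_normD.
have NN A : N (- A) = N A by rewrite /N /nm normrN.
have NZ (k : R) A : 0 <= k -> N (k%:C%C *: A) = k * N A.
  move=> k0; rewrite /N mulrCA; congr (_ * _); apply: C_inj.
  by rewrite /= CM !nmE normrZ ger0_norm // leC.
have NM A B : N (A *m B) <= N A * N B.
  rewrite /N -mulrA ler_wpM2l ?(ltW s0) //.
  by rewrite mulrA [nm A * s]mulrC -leC !CM !nmE.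
have [d d0 hd] : exists2 d, 0 < d & forall a z, G a -> z \in Zs ->
    N (a - 1%:M) < d -> a *m x0 = (x0 + z) *m a -> z = 0.
  have G1 := group1_mem hG; have GM := groupM_mem hG.
  have G_near e : 0 < e -> exists2 d, 0 < d & forall a, G a -> N (a - 1%:M) < d ->
      exists2 w, w \in L & N (a - 1%:M - w) <= e * N (a - 1%:M).
    move=> e0; have [_ [d hX]] := hG.
    have eC : 0 < e%:C%C :> K by rewrite ltC.
    have [r r0 hr] := near_nm (submanifold_near hX G1 eC).
    exists (s * r) => [|a Ga]; first by rewrite mulr_gt0.
    rewrite /N ltr_pM2l // => /hr /(_ Ga) [w /(mem_Lie hG) wL hw]; exists w => //.
    rewrite mulrCA ler_wpM2l ?(ltW s0) //.
    by rewrite -leC CM !nmE.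
  have G_curve y : y \in L -> forall e, 0 < e -> exists2 d, 0 < d &
      forall t, 0 < t < d -> exists2 g, G g & N (g - 1%:M - t%:C%C *: y) <= e * t.
    move=> /(mem_Lie hG) /tangentE[gamma [g0 gX gd]] e e0.
    have eC : 0 < (e / s)%:C%C :> K by rewrite ltC divr_gt0.
    have [dg dv] := gd; have hg := diff_eps dg eC.
    have hgX : \forall t \near (0 : K^o), (G (gamma t) /\ differentiable gamma t) /\
        `|gamma t - gamma 0 - 'd gamma 0 (t - 0)| <= (e / s)%:C%C * `|t - 0|.
      exact: filterI.
    have [d /= /real_gt0C[r r0 ->] hr] := (nbhs_normP _ _).1 hgX.
    exists r => // t /andP[t0 tr].
    have [|[Gt _]] := hr (t%:C%C); first by rewrite /ball_ /= sub0r normrN ger0_norm ?ltC // leC ltW.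
    rewrite subr0 g0 dv ger0_norm ?leC ?(ltW t0) // => ht.
    exists (gamma t%:C%C) => //; rewrite /N -ler_pdivlMl // mulrA [s^-1 * _]mulrC.
    by rewrite -leC CM nmE.
  have [q q0 ad_bound] : exists2 q, 0 < q & forall w, w \in L ->
      exists y, [/\ y \in L, lb y x0 = 0 & N (w - y) <= q * N (lb w x0)].
    (* A linear, hence bounded, section [g] of [ad x0] on L: subtracting g [x0, w] from [w] leaves
       an element centralizing [x0]. *)
    pose f : 'End(M) := (adl x0 \o projv L)%VF; pose g : 'End(M) := (projv L \o f^-1)%VF.
    have [q q0 hq] := linear_nm_bound g; exists q => // w wL.
    have fw : f w = adl x0 w by rewrite comp_lfunE projv_id.
    have h : adl x0 (g (adl x0 w)) = adl x0 w.
      have := limg_lfunVK (memv_img f (memvf w)).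
      by rewrite -fw [X in X = _ -> _]comp_lfunE [X in _ -> adl x0 X = _]comp_lfunE.
    have gL : g (adl x0 w) \in L by rewrite comp_lfunE memv_proj.
    have hu : nm (g (adl x0 w)) <= q * nm (adl x0 w) := hq _.
    move: (g (adl x0 w)) h gL hu => u h uL hu.
    have hl v : lb v x0 = - adl x0 v by rewrite adlE lbC.
    exists (w - u); split; first exact: rpredB.
      by rewrite lbBl !hl h subrr.
    rewrite opprB addrC subrK hl /N mulrCA ler_wpM2l ?(ltW s0) //.
    by rewrite [X in q * X](_ : _ = nm (adl x0 w)) // /nm normrN.
  have [k k0 transverse] : exists2 k, 0 < k & forall z w, z \in Zs -> w \in L ->
      N z <= k * N (z - lb w x0).
    pose V := (adl x0 @: L)%VS.
    have ZV : (Zs :&: V)%VS = 0%VS.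
      apply/eqP; rewrite -subv0; apply/subvP => z; rewrite memv_cap memv0 => /andP[zZ zV].
      exact/eqP/hZ.
    have VZ : (V :&: Zs)%VS = 0%VS by rewrite capvC.
    (* The projection on [Zs] along [x0, L] fixes [z] and kills [w, x0]; its operator bound is the
       constant sought. *)
    have [k k0 hk] := linear_nm_bound (daddv_pi Zs V); exists k => // z w zZ wL.
    have wV : lb w x0 \in V by rewrite lbC rpredN -adlE memv_img.
    have p0 : daddv_pi Zs V (lb w x0) = 0.
      have e := daddv_pi_add ZV (subvP (addvSr _ _) _ wV).
      by apply: (addIr (daddv_pi V Zs (lb w x0))); rewrite e add0r (daddv_pi_id VZ wV).
    have pB : daddv_pi Zs V (z - lb w x0) = daddv_pi Zs V z - daddv_pi Zs V (lb w x0).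
      exact: linearB.
    have h : nm (daddv_pi Zs V (z - lb w x0)) <= k * nm (z - lb w x0) := hk _.
    rewrite pB p0 subr0 (daddv_pi_id ZV zZ) in h.
    by rewrite /N mulrCA ler_wpM2l ?(ltW s0).
  exact: (orbit_isolated N_ge0 N_eq0 ND NN NZ NM G1 GM G_near G_curve q0 ad_bound
    (Zs := [set` Zs]) k0 transverse).
apply/nbhs_normP; exists (d / s)%:C%C => [|a]; first by rewrite /= ltC divr_gt0.
rewrite /ball_ /= distrC -nmE ltC ltr_pdivlMr // mulrC => ha Ga z zZ.
exact: hd.
Qed.

End LocalInjectivity.

(** * The integrable system *)

Section FibreLeaves.
Variables (K : numFieldType) (E W : normedModType K) (X U : set E) (s : E -> W) (N : set W).
Hypothesis XU : X `<=` U.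

(** With a single chart covering [X], plaques are already components of fibres, and chaining them
    stays in one component. *)
Lemma leaf_fibre p : X p ->
  leaf X (fol_of_submersion U s N) p = connected_component [set q | X q /\ s q = s p] p.
Proof.
move=> Xp; set S := [set q | _].
have plaqueE a : S a -> plaque X (F := fol_of_submersion U s N) tt a = connected_component S a.
  move=> [_ sa]; congr (connected_component _ a); apply/seteqP; split=> x /=.
    by case=> Xx _; rewrite sa.
  by case=> Xx sx; rewrite sa; split=> //; apply: XU.
have Sp : S p by [].
apply/seteqP; split=> q /=; last first.
  by move=> h; apply: rt_step; exists tt; rewrite plaqueE.
move=> pq; move: Sp; elim: pq => [a b [[]] + Sa|a|a b c _ IHab _ IHbc Sa].
- by rewrite plaqueE.
- exact: connected_component_refl.
- have ab := IHab Sa.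
  exact: connected_component_trans ab (IHbc (connected_component_sub ab)).
Qed.

End FibreLeaves.

Section BilinearDifferentials.
Variables (K : numFieldType) (n : nat).
Local Notation M := 'M[K]_n.

Lemma is_diff_lb (V : normedModType K) x (f df g dg : V -> M) :
  is_diff x f df -> is_diff x g dg ->
  is_diff x (fun y => lb (f y) (g y)) (fun v => lb (df v) (g x) + lb (f x) (dg v)).
Proof.
move=> hf hg; apply: (is_diff_eq (is_diffB (is_diff_mulmx hf hg) (is_diff_mulmx hg hf))).
apply/funext => v; rewrite -![(_ + _ : _ -> _) _]/(_ + _) -![(- _ : _ -> _) _]/(- _) /= /lb.
by rewrite opprD [- _ - _]addrC addrACA.
Qed.

Lemma is_diff_killing (L : {vspace M}) (V : normedModType K) x (f df g dg : V -> M) :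
  is_diff x f df -> is_diff x g dg ->
  is_diff x (fun y => killing L (f y) (g y) : K^o)
    (fun v => killing L (df v) (g x) + killing L (f x) (dg v) : K^o).
Proof.
move=> hf hg; have h i := is_diff_lb hf (is_diff_lb hg (is_diff_cst (vbasis L)`_i x)).
have h2 := is_diff_sum (fun i : 'I_(\dim L) =>
  is_diff_linear_comp (coord (vbasis L) i : {linear M -> K^o}) (h i)).
apply: (is_diff_eq h2); apply/funext => v; rewrite /killing -big_split.
by apply: eq_bigr => i _ /=; rewrite lb0r addr0 linearD.
Qed.

End BilinearDifferentials.

Lemma centralizer_sub (K : numClosedFieldType) (n : nat) (L : {vspace 'M[K]_n}) x :
  (centralizer L x <= L)%VS.
Proof. by rewrite centralizerE capvSl. Qed.

(** * The symplectic form, the foliation and its Hamiltonian frame *)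

Section IntegrableSystem.
Variables (K : numClosedFieldType) (n : nat) (G : set 'M[K]_n) (xi h eta : 'M[K]_n).
Local Notation M := 'M[K]_n.
Local Notation L := (Lie G).
Local Notation Z := (centralizer L eta).
Local Notation X := (G `*` Sreg G xi eta).
Local Notation om := (omega G).
Hypothesis hG : linear_algebraic_group G.

Lemma omegaE q v w : om q v w = killing L (v.1 *m invmx q.1) w.2
  - killing L (w.1 *m invmx q.1) v.2 - killing L q.2 (lb (v.1 *m invmx q.1) (w.1 *m invmx q.1)).
Proof. by []. Qed.

Let comb (a p q r s t u : K) : a * p + q - (a * r + s) - (a * t + u) = a * (p - r - t) + (q - s - u).
Proof. by ring. Qed.

Lemma omega_alternating q : alternating_bilinear (om q).
Proof.
split=> [a u v w|a u v w|v]; rewrite !omegaE /=.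
- rewrite !mulmxDl -!scalemxAl killingDl killingZl killingDr killingZr lbDl lbZl killingDr killingZr.
  exact: comb.
- rewrite !mulmxDl -!scalemxAl killingDl killingZl killingDr killingZr lbDr lbZr killingDr killingZr.
  exact: comb.
- by rewrite lbxx killing0r subrr subr0.
Qed.

(** Constant vector fields are not right-invariant: the derivative of [v.1 *m invmx p.1] along [u]
    is -(b a). This is the source of the matrix products, which may lie outside the Lie algebra. *)
Definition domega (v w q u : M * M) : K :=
  let a := u.1 *m invmx q.1 in
  let b := v.1 *m invmx q.1 in
  let c := w.1 *m invmx q.1 in
  - killing L (b *m a) w.2 + killing L (c *m a) v.2 - killing L u.2 (lb b c)
  + killing L q.2 (lb (b *m a) c + lb b (c *m a)).

Lemma is_diff_omega v w (q : M * M) : q.1 \in unitmx ->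
  is_diff q (fun p => om p v w : K^o) (domega v w q : _ -> K^o).
Proof.
move=> uq; have h1 := is_diff_fst (is_diff_id q); have h2 := is_diff_snd (is_diff_id q).
have hi := is_diff_comp h1 (is_diff_invmx uq).
have hm (A : M) : is_diff q (fun p : M * M => A *m invmx p.1)
    (fun u => - (A *m invmx q.1 *m (u.1 *m invmx q.1))).
  apply: (is_diff_eq (is_diff_linear_comp (mulmx A) hi)).
  by apply/funext => u /=; rewrite mulmxN !mulmxA.
apply: (is_diff_eq (is_diffB (is_diffB (is_diff_killing L (hm v.1) (is_diff_cst w.2 q))
  (is_diff_killing L (hm w.1) (is_diff_cst v.2 q))) (is_diff_killing L h2 (is_diff_lb (hm v.1) (hm w.1))))).
apply/funext => u; rewrite -![(_ + _ : _ -> _) _]/(_ + _) -![(- _ : _ -> _) _]/(- _) /= /domega.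
by rewrite !killing0r !killingNl lbNl lbNr -opprD killingNr !addr0 opprK opprD opprK addrA.
Qed.

Lemma omega_closed q u v w : X q -> tangent X q u -> tangent X q v -> tangent X q w ->
  ext_d (om : M * M -> M * M -> M * M -> K) q u v w = 0.
Proof.
move=> Xq; have [Gq Sq] := Xq; have uq : q.1 \in unitmx := group_unit hG Gq.
have hL := Lie_bracket hG.
move=> /(tangent_slice hG _ Xq)[aL /(subvP (centralizer_sub _ _)) AL].
move=> /(tangent_slice hG _ Xq)[bL /(subvP (centralizer_sub _ _)) BL].
move=> /(tangent_slice hG _ Xq)[cL /(subvP (centralizer_sub _ _)) CL].
have dE v' w' u' : 'D_u' (fun x => om x v' w' : K^o) q = domega v' w' q u'.
  by have [d e] := is_diff_omega v' w' uq; rewrite deriveE // e.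
have -> : ext_d (om : M * M -> M * M -> M * M -> K) q u v w =
    domega v w q u - domega u w q v + domega u v q w.
  by congr (_ + _); [congr (_ - _)|]; apply: dE.
rewrite /domega; cbv zeta.
move: (u.1 *m _) (v.1 *m _) (w.1 *m _) aL bL cL => a b c aL bL cL.
(* Symmetry of the Killing form is available on L only, so it is applied to the commutator before
   splitting it into products. *)
have C1 : killing L u.2 (lb b c) = killing L (b *m c) u.2 - killing L (c *m b) u.2.
  by rewrite (killingC hL) ?hL // -killingBl.
have C2 : killing L v.2 (lb a c) = killing L (a *m c) v.2 - killing L (c *m a) v.2.
  by rewrite (killingC hL) ?hL // -killingBl.
have C3 : killing L w.2 (lb a b) = killing L (a *m b) w.2 - killing L (b *m a) w.2.
  by rewrite (killingC hL) ?hL // -killingBl.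
have J : killing L q.2 (lb (b *m a) c + lb b (c *m a)) -
    killing L q.2 (lb (a *m b) c + lb a (c *m b)) + killing L q.2 (lb (a *m c) b + lb a (b *m c)) = 0.
  rewrite -killingBr -killingDr -[RHS](killing0r L q.2); congr killing.
  by rewrite /lb !mulmxA; apply/matrixP => i j; rewrite !mxE; ring.
rewrite C1 C2 C3 -[RHS]J; move: (killing L q.2 _) (killing L q.2 _) (killing L q.2 _) => j1 j2 j3.
move: (killing L (b *m c) _) (killing L (c *m b) _) (killing L (a *m c) _) (killing L (c *m a) _)
  (killing L (a *m b) _) (killing L (b *m a) _) => k1 k2 k3 k4 k5 k6.
ring.
Qed.

Hypothesis ss : semisimple_lie L.
Hypothesis triple : regular_sl2_triple G xi h eta.

Let hL : brackets_into L L L := Lie_bracket hG.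
Let tr : sl2_triple xi eta h. Proof. by case: triple => _ _ _ ? [? ?]. Qed.
Let nxi : nilpotent_elt L xi. Proof. by case: triple => -[]. Qed.
Let neta : nilpotent_elt L eta. Proof. by case: triple => _ _ []. Qed.
Let dimZ : \dim Z = rk G. Proof. by case: triple => _ _ [[]]. Qed.
Let ZL : {subset Z <= L}. Proof. exact/subvP/centralizer_sub. Qed.
Let SL x : Sreg G xi eta x -> x \in L. Proof. exact: slice_mem. Qed.
Let X_unit q : X q -> q.1 \in unitmx. Proof. by case=> /(group_unit hG). Qed.

Lemma slice_orbit_transverse x z : Sreg G xi eta x -> z \in Z -> z \in (adl x @: L)%VS -> z = 0.
Proof.
move=> Sx; apply: (slice_orbit_cap0 hL tr nxi neta Sx).
by rewrite dimZ rk_le_dim_centralizer // SL.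
Qed.

Lemma dPhiE q : Phi_dom q -> 'd (@Phi K n) q = dPhi q :> (_ -> _).
Proof. by move=> /is_diff_Phi[]. Qed.

Lemma Phi_submersion : submersion X (@Phi_dom K n) (@Phi K n) [set` L].
Proof.
split=> [q /is_diff_Phi[] //|q Xq uq]; have [Gq Sq] := Xq.
have Gi := groupV_mem hG Gq; have conjL u : u \in L -> invmx q.1 *m u *m q.1 \in L.
  by move=> uL; rewrite -[X in _ *m X]invmxK; apply: Lie_conj.
split; first by rewrite /= rpredN conjL // SL.
rewrite dPhiE //; apply/seteqP; split=> u /=.
  move=> [v /(tangent_slice hG _ Xq)[yL zZ] <-].
  rewrite /dPhi rpredN; apply/conjL/rpredD; first exact: ZL.
  by apply: hL => //; apply: SL.
move=> uL; have : - (q.1 *m u *m invmx q.1) \in L by rewrite rpredN Lie_conj.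
rewrite -(slice_transverse hL tr nxi neta Sq) => /memv_addP[z zZ [w /memv_imgP[y yL ->] e]].
exists (y *m q.1, z); first by apply/(tangent_slice hG _ Xq); rewrite /= mulmxK.
rewrite /dPhi /= mulmxK // -adlE -e mulmxN mulNmx opprK.
by rewrite !mulmxA mulVmx // mul1mx mulmxKV.
Qed.

(** Testing v = (y g, z) on vectors (y' g, 0) gives z = -[x, y], so [x, y] lies in Z; testing on (0,
    z') makes [y] orthogonal to Z, and the dual basis gives y = 0. *)
Lemma omega_nondegenerate q v : X q -> tangent X q v ->
  (forall w, tangent X q w -> om q v w = 0) -> v = 0.
Proof.
move=> Xq; have [Gq Sq] := Xq; have uq := X_unit Xq; have xL := SL Sq.
case: v => v z /(tangent_slice hG _ Xq)[/= yL zZ] hv.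
set y := v *m invmx q.1 in yL.
have zE : z = - lb q.2 y.
  apply/eqP; rewrite -addr_eq0; apply/eqP/(killing_nondegenerate hL ss).
    by apply: rpredD; [apply: ZL | apply: hL].
  move=> y2 y2L; have := hv (y2 *m q.1, 0).
  rewrite omegaE /= mulmxK // -/y => /(_ _)/eqP.
  rewrite killing0r sub0r -opprD oppr_eq0 -(killing_lb hL) // (killingC hL y2L (ZL zZ)) -killingDl.
  by move/(_ _)/eqP; apply; apply/(tangent_slice hG _ Xq); rewrite /= mulmxK // mem0v.
have y0 : y = 0.
  have [e [_ _ eE]] := slice_dual_basis hL ss tr nxi neta Sq.
  rewrite [LHS]eE //; last by rewrite -rpredN -zE.
  apply: big1 => i _; have bZ : (vbasis Z)`_i \in Z by rewrite vbasis_mem ?mem_nth ?size_tuple.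
  have : om q (v, z) (0, (vbasis Z)`_i) = 0.
    by apply: hv; apply/(tangent_slice hG _ Xq); rewrite /= mul0mx mem0v.
  rewrite omegaE /= mul0mx killing0l lb0r killing0r !subr0 => ->.
  by rewrite scale0r.
have v0 : v = 0 by rewrite -[v](mulmxKV uq) -/y y0 mul0mx.
by rewrite v0 zE y0 lb0r oppr0.
Qed.

Lemma omega_symplectic : symplectic_submanifold X (om : M * M -> M * M -> M * M -> K).
Proof.
split; first exact: complex_submanifold_slice.
split; last exact: omega_nondegenerate.
move=> p Xp; exists (@Phi_dom K n), om; split=> //.
- by split; [exact: (open_fst_preimage (@open_unitmx K n)) | apply: X_unit].
- by move=> q _; apply: omega_alternating.
- by move=> v w q uq; have [] := is_diff_omega v w uq.
- by move=> q u v w Xq _; apply: omega_closed.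
Qed.

(** Paired with (w g, z), the vector (y_i g, -[x, y_i]) gives <y_i, z>, since the two terms in [w]
    cancel by invariance; by duality this is the i-th coordinate of [z]. *)
Lemma hamiltonian_frame q : X q -> exists H : 'I_(\dim Z) -> M * M,
  [/\ forall i, hamiltonian_at X (om : M * M -> M * M -> M * M -> K)
        (fun p => coord (vbasis Z) i p.2) q (H i),
      fol_tangent X (Freg G) q = span_of H &
      forall c : 'I_(\dim Z) -> K, \sum_i c i *: H i = 0 -> forall i, c i = 0].
Proof.
move=> Xq; have [Gq Sq] := Xq; have uq := X_unit Xq; have xL := SL Sq.
have [y [hy yZ yE]] := slice_dual_basis hL ss tr nxi neta Sq.
have lbS c : lb q.2 (\sum_i c i *: y i) = \sum_i c i *: lb q.2 (y i).
  by rewrite (linear_sum (lb q.2)); apply: eq_bigr => i _; apply: lbZr.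
pose H i := (y i *m q.1, - lb q.2 (y i)).
have tH i : tangent X q (H i).
  by apply/(tangent_slice hG _ Xq); rewrite /= mulmxK // rpredN; apply: hy.
have sumH c : \sum_i c i *: H i = ((\sum_i c i *: y i) *m q.1, - lb q.2 (\sum_i c i *: y i)).
  rewrite mulmx_suml lbS -sumrN; elim/big_ind3: _ => //.
    by move=> ? ? ? ? ? ? -> ->.
  by move=> i _; rewrite -scalerN -scalemxAl.
exists H; split.
- move=> i; split=> // -[w z] /(tangent_slice hG _ Xq)[/= wL zZ].
  have -> : 'd (fun p : M * M => coord (vbasis Z) i p.2 : K^o) q (w, z) = coord (vbasis Z) i z.
    have [_ ->] := is_diff_linear_comp (coord (vbasis Z) i : {linear M -> K^o}) (is_diff_snd (is_diff_id q)).
    by [].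
  have [yL lZ] := hy i.
  rewrite omegaE /= mulmxK // killingNr opprK -[killing L q.2 _](killing_lb hL) //.
  rewrite (killingC hL wL) ?hL // addrK.
  rewrite {1}(coord_vbasis zZ) (linear_sum (killing L (y i))) (bigD1 i) //= killingZr yZ eqxx mulr1 big1 ?addr0 //.
  by move=> j ji; rewrite killingZr yZ eq_sym (negPf ji) mulr0.
- apply/seteqP; split=> v.
    move=> [/(tangent_slice hG _ Xq)[vL vZ] [[] /= [_]]]; rewrite dPhiE //.
    move/(dPhi_eq0 _ uq) => e; have {e} v2 : v.2 = - lb q.2 (v.1 *m invmx q.1).
      by apply/eqP; rewrite -addr_eq0; apply/eqP.
    exists (fun i => killing L (v.1 *m invmx q.1) (vbasis Z)`_i).
    rewrite sumH -yE //; last by rewrite -rpredN -v2.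
    by rewrite mulmxKV // -v2 -surjective_pairing.
  move=> [c ->]; rewrite sumH; split.
    apply/(tangent_slice hG _ Xq); rewrite /= mulmxK // lbS rpredN; split.
      by apply: rpred_sum => i _; rewrite rpredZ //; case: (hy i).
    by apply: rpred_sum => i _; rewrite rpredZ //; case: (hy i).
  by exists tt; split=> //=; rewrite dPhiE //; apply/(dPhi_eq0 _ uq); rewrite /= mulmxK // addNr.
- move=> c; rewrite sumH => -[/(congr1 (mulmxr (invmx q.1))) /=].
  rewrite mulmxK // mul0mx => e _ j.
  have := congr1 (fun y => killing L y (vbasis Z)`_j) e; rewrite /= killing0l killing_suml.
  rewrite (bigD1 j) //= killingZl yZ eqxx mulr1 big1 ?addr0 // => i ij.
  by rewrite killingZl yZ (negPf ij) mulr0.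
Qed.

Lemma Freg_foliation : foliation X (Freg G) (rk G).
Proof.
split.
- by move=> p Xp; exists tt; apply: X_unit.
- by move=> []; exact: (open_fst_preimage (@open_unitmx K n)).
- by move=> []; apply: Phi_submersion.
- by move=> [] q v Xq uq [_ [[] []]].
- move=> q Xq; rewrite -dimZ; have [H [_ E free]] := hamiltonian_frame Xq.
  by exists H.
Qed.

End IntegrableSystem.

(** * First integrals and complete integrability *)

Section Integrability.
Variables (R : realType) (n : nat) (G : set 'M[Cx R]_n) (xi h eta : 'M[Cx R]_n).
Local Notation M := 'M[Cx R]_n.
Local Notation X := (G `*` Sreg G xi eta).
Hypothesis hG : linear_algebraic_group G.
Hypothesis ss : semisimple_lie (Lie G).
Hypothesis triple : regular_sl2_triple G xi h eta.

(* [Phi] separates the points of the slice near [p]: on the fibre through [p] the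
   element [q.1 *m invmx p.1], close to 1, conjugates [p.2] to [q.2]. *)
Lemma Phi_fibre_snd p : X p -> \forall q \near p, X q -> Phi q = Phi p -> q.2 = p.2.
Proof.
move=> Xp; have [Gp Sp] := Xp; have up := group_unit hG Gp.
have xL : p.2 \in Lie G by case: triple => -[_ nxi] _ _ _ _; apply: slice_mem nxi _ Sp.
have inj := slice_locally_injective hG xL (Zs := centralizer (Lie G) eta)
  (fun z => slice_orbit_transverse hG triple Sp).
have cont : (fun q : M * M => q.1 *m invmx p.1) @ p --> (1%:M : M).
  rewrite -(mulmxV up).
  apply: (@differentiable_continuous _ _ _ p (fun q : M * M => q.1 *m invmx p.1)).
  by have [] := is_diff_linear_comp (mulmxr (invmx p.1)) (is_diff_fst (is_diff_id p)).
have near_p : \forall q \near p, G (q.1 *m invmx p.1) -> forall z, z \in centralizer (Lie G) eta ->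
    (q.1 *m invmx p.1) *m p.2 = (p.2 + z) *m (q.1 *m invmx p.1) -> z = 0 := cont _ inj.
apply: filterS near_p => q hq [Gq Sq] /oppr_inj e.
have uq := group_unit hG Gq.
have /hq hq' : G (q.1 *m invmx p.1) by apply: groupM_mem => //; apply: groupV_mem.
apply/eqP; rewrite -subr_eq0; apply/eqP/hq'.
  have -> : q.2 - p.2 = (q.2 - xi) - (p.2 - xi) by rewrite opprB addrA subrK.
  exact: rpredB.
rewrite addrC subrK.
have := congr1 (fun A => q.1 *m A *m invmx p.1) e.
by rewrite !mulmxA mulmxV // mul1mx -!mulmxA mulmxV // mulmx1 => <-.
Qed.

(** In the component, the points with second coordinate [p.2] form a nonempty closed subset, open
    because [Phi_fibre_snd] applies at each of them. *)
Lemma snd_const_on_component p q : X p ->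
  connected_component [set q | X q /\ Phi q = Phi p] p q -> q.2 = p.2.
Proof.
move=> Xp; set S := [set q | _]; pose C := connected_component S p.
have Sp : S p by [].
suff CE : C `&` [set q | q.2 = p.2] = C by rewrite -[connected_component _ _]/C -CE => -[].
apply: component_connected.
- by exists p; split=> //; apply: connected_component_refl.
- exists (interior [set q | C q -> q.2 = p.2]); first exact: open_interior.
  apply/seteqP; split=> a [Ca]; last by move/interior_subset => /(_ Ca).
  move=> /= a2; split=> //.
  have [Xa aS] := connected_component_sub Ca.
  apply: filterS (Phi_fibre_snd Xa) => b hb Cb.
  have [Xb bS] := connected_component_sub Cb.
  by rewrite -a2; exact: (hb Xb (etrans bS (esym aS))).
- exists [set q | q.2 = p.2] => //.
  have : closed [set p.2] by exact/accessible_closed_set1/hausdorff_accessible/norm_hausdorff.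
  by apply: preimage_closed => // x _; apply: snd_continuous.
Qed.

Lemma Freg_integrable :
  abstract_integrable_system X (omega G : M * M -> M * M -> M * M -> Cx R) (Freg G) (rk G).
Proof.
split; [exact: omega_symplectic ss triple|exact: Freg_foliation ss triple|].
move=> p Xp; exists setT, (\dim (centralizer (Lie G) eta)).
have /choice[H hH] (q : M * M) : exists H : 'I_(\dim (centralizer (Lie G) eta)) -> M * M, X q ->
    (forall i, hamiltonian_at X (omega G : M * M -> M * M -> M * M -> Cx R)
        (fun p => coord (vbasis (centralizer (Lie G) eta)) i p.2) q (H i)) /\
    fol_tangent X (Freg G) q = span_of H.
  have [Xq|nXq] := pselect (X q); last by exists (fun=> 0).
  by have [H [h1 h2 _]] := hamiltonian_frame hG ss triple Xq; exists H.
exists (fun i p => coord (vbasis (centralizer (Lie G) eta)) i p.2), (fun i q => H q i).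
split=> //.
- by split=> //; apply: openT.
- move=> i; split=> [q _|a b Xa _].
    by have [] := is_diff_linear_comp (coord (vbasis (centralizer (Lie G) eta)) i : {linear M -> (Cx R)^o})
      (is_diff_snd (is_diff_id q)).
  have XU : X `<=` @Phi_dom (Cx R) n `&` setT by move=> q [Gq _]; split=> //; exact: (group_unit hG Gq : q.1 \in unitmx).
  have := leaf_fibre (@Phi (Cx R) n) [set` Lie G] XU Xa => E ab.
  (* Restricting the one-chart atlas is, by conversion, the one-chart atlas on the smaller
     domain. *)
  have {}ab : leaf X (fol_of_submersion (@Phi_dom (Cx R) n `&` setT) (@Phi (Cx R) n) [set` Lie G]) a b by [].
  by rewrite E in ab; rewrite (snd_const_on_component Xa ab).
- by move=> i q Xq _; have [+ _] := hH q Xq; apply.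
- by move=> q Xq _; have [_] := hH q Xq.
Qed.

End Integrability.

Theorem theorem13 (R : realType) (n : nat) (G : set 'M[Cx R]_n)
    (xi h eta : 'M[Cx R]_n)
    (hG : linear_algebraic_group G)
    (hconn : connected G)
    (hsimp : simply_connected R G)
    (hss : semisimple_lie (Lie G))
    (htriple : regular_sl2_triple G xi h eta) :
  let X := G `*` Sreg G xi eta in
  [/\ submersion X (@Phi_dom (Cx R) n) (@Phi (Cx R) n) [set` Lie G],
      forall p, X p ->
        leaf X (Freg G) p =
        connected_component [set q | X q /\ Phi q = Phi p] p &
      abstract_integrable_system X (omega G) (Freg G) (rk G)].
Proof.
move=> X; split; [exact: Phi_submersion htriple| |exact: Freg_integrable htriple].
by move=> p Xp; apply: leaf_fibre Xp => q [Gq _]; exact: (group_unit hG Gq : q.1 \in unitmx).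
Qed.
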